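(* Let $1\le D_1<D_2$ and $L=\log(D_2/D_1)$. For $i\in\{1,2\}$, let $h_i:\mathbb{R}\to\mathbb{R}$ be an absolutely continuous function with $h_i(x)=0$ for $x\le 0$ and $h_i(x)=h_i(1)$ for $x\ge 1$, and such that $V(h_i')<\infty$. Let $\rho_i(t)=h_i\!\left(\frac{\log(D_2/t)}{\log(D_2/D_1)}\right)$ for $t>0$. Then $$\sum_{d_1,d_2\ge 1}\frac{\mu(d_1)\mu(d_2)}{[d_1,d_2]}\rho_1(d_1)\rho_2(d_2)=\frac{\int_{-\infty}^{\infty}h_1'(x)h_2'(x)\,\mathrm{d}x}{L}+O\!\left(\frac{V(h_1')V(h_2')}{L^2}\right),$$ with an absolute implied constant.
   Context: $\mu$ is the Möbius function and $[d_1,d_2]$ the least common multiple. For a function $f$ defined almost everywhere on $\mathbb{R}$, $V(f)$ denotes the infimum of the total variation $|g|_{\mathrm{TV}}$ over all functions $g:\mathbb{R}\to\mathbb{R}$ equal to $f$ almost everywhere. It is not assumed that $h_i(1)=1$. *)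

(* Defs.v *)
From HB Require Import structures.
From mathcomp Require Import all_boot all_order all_algebra.
From mathcomp Require Import all_classical all_reals all_analysis.
From mathcomp Require Import Rstruct Rstruct_topology.
Import numFieldNormedType.Exports.
Set Implicit Arguments. Unset Strict Implicit. Unset Printing Implicit Defensive.
Import Order.TTheory GRing.Theory Num.Theory.
Local Open Scope classical_set_scope.
Local Open Scope ring_scope.

Notation R := Rdefinitions.R.

(* Moebius function mu : nat -> R (mu 0 = 0 by convention; never used at 0). *)
Definition mobius (n : nat) : R :=
  if n == 0%N then 0
  else if all (fun pe : nat * nat => pe.2 == 1%N) (prime_decomp n)
       then (-1) ^+ size (prime_decomp n) else 0.

Definition abs_cont (f : R -> R) : Prop :=
  forall e : R, 0 < e -> exists2 d : R, 0 < d &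
    forall s : seq (R * R),
      sorted (fun p q : R * R => p.2 <= q.1) s ->
      all (fun p : R * R => p.1 <= p.2) s ->
      \sum_(p <- s) (p.2 - p.1) < d ->
      \sum_(p <- s) `|f p.2 - f p.1| < e.

Definition TVR (g : R -> R) : \bar R :=
  ereal_sup (range (fun ab : R * R => total_variation ab.1 ab.2 g)).

Definition Vess (f : R -> R) : \bar R :=
  ereal_inf [set TVR g | g in
    [set g : R -> R | {ae (@lebesgue_measure R), forall x, f x = g x}]].

(* The derivative h' of h : R -> R (MathComp-Analysis's derive1, total
   function; agrees with the classical derivative wherever h is
   differentiable, in particular a.e. for absolutely continuous h). *)
Definition der (h : R -> R) : R -> R := @derive1 R R^o h.

(* Main.v *)
(** Write [T(A, B)] for the sum of [mu(d1) mu(d2) / [d1, d2]] times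
    [log+(A / d1) log+(B / d2)].  Everything rests on [T(A, B) = log (min(A, B)) + O(1)].
    Expanding [gcd] over totients diagonalises the sum: with
    [G_r(x) = sum_{n <= x, (n, r) = 1} mu(n) / n log(x / n)],
    [T(A, B) = sum_r mu(r)^2 phi(r) / r^2 G_r(A / r) G_r(B / r)], while
    [sum_r mu(r)^2 / r G_r(A / r) = log A] exactly.  So it suffices that [G_r(x)] be close to
    [r / phi(r)]; removing the primes of [r] one at a time reduces this to
    [G_1(x) = 1 + O(1 / (1 + log x)^2)].  That estimate is of prime number theorem strength.
    It is proved by Fourier inversion with a Fejer kernel on the line [Re s = 1], from
    Euler-Maclaurin bounds for zeta and the 3-4-1 lower bound for [|zeta(s)|].

    Next, [h'] agrees a.e. with a function [g] of nearly optimal total variation, and [h] is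
    the integral of [g] (absolute continuity, Radon-Nikodym and Lebesgue differentiation).
    Replacing [g] by the step function with values [g(j / n)] turns the sum of the theorem into
    a combination of values of [T].  By partial summation the error terms cost at most
    [V(g1) V(g2) / L^2], and the main terms form a Riemann sum for [int g1 g2 / L]. *)
Require Import Defs.
From Stdlib Require Reals Lra Lia Psatz.
From Coquelicot Require Coquelicot.

(** * Zeta on the line Re s = 1 *)

Module Zeta.

Import Reals Lra Lia Psatz Coquelicot.Coquelicot.
From mathcomp Require Import ssreflect.
Local Open Scope R_scope.

(** Two exponents shape the argument. The error [1 / (1 + log x)^2] has to be summed at [x / r]
    against [1 / r], and this sum stays bounded; with the first power it would grow like a double
    logarithm. Two powers of the logarithm ask for two derivatives of the Laplace transform of
    [G_1(e^v) - 1] at the line. No derivative in [s] and no contour is used: multiplication by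
    [2 cos(h v) - 2] turns the transform into its second difference in the imaginary direction, of
    size [h^2], and [h = pi / v] makes this factor equal to -4 at the point of interest. With [s]
    shifted by 1 the transform is [- A / (1 + s A)], where [A(s) = zeta(1 + s) - 1 / s] stays
    bounded near the pole. Its second differences are bounded uniformly in small [Re s > 0], which
    is finally [1 / v]. The exponent [theta = 1 / 30] is the growth conceded to zeta in the height
    [t]. The lower bound for zeta loses its fourth power, a second difference of the transform its
    fifteenth in all, so that [|t|^(1/2)] stands against [|t|^(-2)] and the transform is
    integrable. *)

Fixpoint rsum (f : nat -> R) (N : nat) : R :=
  match N with O => 0 | S n => rsum f n + f (S n) end.

Fixpoint csum (f : nat -> C) (N : nat) : C :=
  match N with O => RtoC 0 | S n => (csum f n + f (S n))%C end.

Lemma csum_S f N : csum f (S N) = (csum f N + f (S N))%C.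
Proof. by []. Qed.

Lemma rsum_S f N : rsum f (S N) = rsum f N + f (S N).
Proof. by []. Qed.

Lemma rsum_ext f g N : (forall n, (1 <= n <= N)%nat -> f n = g n) -> rsum f N = rsum g N.
Proof.
elim: N => [|N IH] H //=; rewrite IH ?H //; first lia.
by move=> n Hn; apply: H; lia.
Qed.

Lemma csum_ext f g N : (forall n, (1 <= n <= N)%nat -> f n = g n) -> csum f N = csum g N.
Proof.
elim: N => [|N IH] H //=; rewrite IH ?H //; first lia.
by move=> n Hn; apply: H; lia.
Qed.

Lemma rsum_scal c f N : rsum (fun n => c * f n) N = c * rsum f N.
Proof. elim: N => [|N IH] /=; first ring. rewrite IH; ring. Qed.

Lemma csum_scal (c : C) f N : csum (fun n => c * f n)%C N = (c * csum f N)%C.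
Proof. elim: N => [|N IH] /=; first ring. rewrite IH; ring. Qed.

Lemma csum_plus f g N : csum (fun n => f n + g n)%C N = (csum f N + csum g N)%C.
Proof. elim: N => [|N IH] /=; first ring. rewrite IH; ring. Qed.

Lemma Cmod_csum f g N :
  (forall n, (1 <= n <= N)%nat -> Cmod (f n) <= g n) -> Cmod (csum f N) <= rsum g N.
Proof.
elim: N => [|N IH] H /=; first by rewrite Cmod_0; lra.
apply: Rle_trans (Cmod_triangle _ _) _.
apply: Rplus_le_compat; last by apply: H; lia.
by apply: IH => n Hn; apply: H; lia.
Qed.

Lemma Rabs_rsum f g N :
  (forall n, (1 <= n <= N)%nat -> Rabs (f n) <= g n) -> Rabs (rsum f N) <= rsum g N.
Proof.
elim: N => [|N IH] H /=; first by rewrite Rabs_R0; lra.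
apply: Rle_trans (Rabs_triang _ _) _.
apply: Rplus_le_compat; last by apply: H; lia.
by apply: IH => n Hn; apply: H; lia.
Qed.

Lemma Re_csum f N : Re (csum f N) = rsum (fun n => Re (f n)) N.
Proof. by elim: N => [|N IH] //=; rewrite -IH. Qed.

Lemma Im_csum f N : Im (csum f N) = rsum (fun n => Im (f n)) N.
Proof. by elim: N => [|N IH] //=; rewrite -IH. Qed.

Lemma C_eq (z w : C) : Re z = Re w -> Im z = Im w -> z = w.
Proof. by case: z => a b; case: w => c d /= -> ->. Qed.

Lemma csum_scal_RtoC (c : nat -> R) (f : nat -> C) N :
  csum (fun n => RtoC (c n) * f n)%C N = (rsum (fun n => c n * Re (f n)) N, rsum (fun n => c n * Im (f n)) N).
Proof.
apply: C_eq; rewrite ?Re_csum ?Im_csum; apply: rsum_ext => n _; case: (f n) => a b /=; ring.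
Qed.

Lemma Rabs_Im_le_Cmod (z : C) : Rabs (Im z) <= Cmod z.
Proof. exact: Rle_trans (Rmax_r _ _) (Rmax_Cmod z). Qed.

Lemma Cmod_le_abs (z : C) : Cmod z <= Rabs (Re z) + Rabs (Im z).
Proof.
have -> : z = (RtoC (Re z) + Ci * RtoC (Im z))%C.
  by case: z => a b; apply: C_eq => /=; ring.
apply: Rle_trans (Cmod_triangle _ _) _.
rewrite Cmod_mult Cmod_Ci !Cmod_R /=.
rewrite !(Rmult_0_l, Rmult_0_r, Rmult_1_l, Rplus_0_l, Rplus_0_r, Rminus_0_r); lra.
Qed.

(** * Complex exponentials and powers *)

Definition cexp (z : C) : C := (exp (Re z) * cos (Im z), exp (Re z) * sin (Im z)).

Lemma cexp_plus z w : cexp (z + w)%C = (cexp z * cexp w)%C.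
Proof.
case: z => a b; case: w => c d; apply: C_eq => /=; rewrite exp_plus.
- rewrite cos_plus; ring.
- rewrite sin_plus; ring.
Qed.

Lemma Cmod_cexp z : Cmod (cexp z) = exp (Re z).
Proof.
have H0 := exp_pos (Re z).
have -> : cexp z = (RtoC (exp (Re z)) * (cos (Im z), sin (Im z)))%C.
  by apply: C_eq => /=; ring.
rewrite Cmod_mult Cmod_R Rabs_pos_eq; last lra.
rewrite {1}/Cmod /=.
have -> : cos (Im z) * (cos (Im z) * 1) + sin (Im z) * (sin (Im z) * 1) = 1.
  have := sin2_cos2 (Im z); rewrite /Rsqr; lra.
by rewrite sqrt_1 Rmult_1_r.
Qed.

Lemma cexp_0 : cexp 0 = RtoC 1.
Proof. by apply: C_eq => /=; rewrite exp_0 ?cos_0 ?sin_0; ring. Qed.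

(** The case [alpha = 0] serves the Lipschitz bound for [cexp] and the transform of a constant;
    general [alpha] gives primitives for the Laplace integrals of linear functions. *)
Lemma is_derive_Re_cexp_lin (s alpha beta : C) (v : R) :
  is_derive (fun v : R => Re (cexp (- s * RtoC v) * (alpha * RtoC v + beta))%C) v
    (Re (cexp (- s * RtoC v) * (- s * (alpha * RtoC v + beta) + alpha))%C).
Proof.
case: s => p q; case: alpha => a b; case: beta => c d /=.
by auto_derive => //; rewrite /Rminus; ring.
Qed.

Lemma is_derive_Im_cexp_lin (s alpha beta : C) (v : R) :
  is_derive (fun v : R => Im (cexp (- s * RtoC v) * (alpha * RtoC v + beta))%C) v
    (Im (cexp (- s * RtoC v) * (- s * (alpha * RtoC v + beta) + alpha))%C).
Proof.
case: s => p q; case: alpha => a b; case: beta => c d /=.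
by auto_derive => //; rewrite /Rminus; ring.
Qed.

(* [cpow x s] is the complex power x^(-s). *)
Definition cpow (x : R) (s : C) : C := cexp (- s * RtoC (ln x))%C.

Lemma Cmod_cpow x s : Cmod (cpow x s) = exp (- Re s * ln x).
Proof. by rewrite Cmod_cexp; congr exp; case: s => a b /=; ring. Qed.

Lemma Cmod_cpow_le1 x s : 1 <= x -> 0 <= Re s -> Cmod (cpow x s) <= 1.
Proof.
move=> Hx Hs; rewrite Cmod_cpow -exp_0.
have H : 0 <= ln x by rewrite -ln_1; apply: ln_le; lra.
case: (Req_dec (Re s * ln x) 0) => H1.
  by right; congr exp; lra.
left; apply: exp_increasing; nra.
Qed.

Lemma cpow_plus x s t : cpow x (s + t) = (cpow x s * cpow x t)%C.
Proof. by rewrite /cpow -cexp_plus; congr cexp; ring. Qed.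

Lemma cpow_1_l s : cpow 1 s = RtoC 1.
Proof. rewrite /cpow ln_1 -cexp_0; congr cexp; ring. Qed.

Lemma cpow_mult x y s : 0 < x -> 0 < y -> cpow (x * y) s = (cpow x s * cpow y s)%C.
Proof.
move=> Hx Hy; rewrite /cpow ln_mult // -cexp_plus; congr cexp.
rewrite RtoC_plus; ring.
Qed.

Lemma cpow_R1 x : 0 < x -> cpow x 1 = RtoC (/ x).
Proof.
move=> Hx; apply: C_eq => /=.
- have -> : (- 1 * ln x - - 0 * 0) = - ln x by ring.
  have -> : (- 1 * 0 + - 0 * ln x) = 0 by ring.
  by rewrite exp_Ropp exp_ln // cos_0; ring.
- have -> : (- 1 * 0 + - 0 * ln x) = 0 by ring.
  by rewrite sin_0; ring.
Qed.

Lemma is_derive_Re_cpow (z s : C) (x : R) : 0 < x ->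
  is_derive (fun x : R => Re (z * cpow x s)%C) x (Re (z * (- s * cpow x (1 + s)))%C).
Proof.
move=> Hx; rewrite cpow_plus (cpow_R1 _ Hx).
case: z => a b; case: s => p q; rewrite /cpow /=.
by auto_derive => //; rewrite /Rminus; field; lra.
Qed.

Lemma is_derive_Im_cpow (z s : C) (x : R) : 0 < x ->
  is_derive (fun x : R => Im (z * cpow x s)%C) x (Im (z * (- s * cpow x (1 + s)))%C).
Proof.
move=> Hx; rewrite cpow_plus (cpow_R1 _ Hx).
case: z => a b; case: s => p q; rewrite /cpow /=.
by auto_derive => //; rewrite /Rminus; field; lra.
Qed.

Lemma exp_le x y : x <= y -> exp x <= exp y.
Proof. by case => [H|->]; [left; apply: exp_increasing | right]. Qed.

Lemma ln_ge0 x : 1 <= x -> 0 <= ln x.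
Proof. by move=> H; rewrite -ln_1; apply: ln_le; lra. Qed.

Lemma INR_ge1 n : (1 <= n)%nat -> 1 <= INR n.
Proof. by move=> H; have := le_INR 1 n H. Qed.

Lemma MVT_bound (f df : R -> R) a b B : a <= b ->
  (forall x, a <= x <= b -> is_derive f x (df x)) ->
  (forall x, a <= x <= b -> Rabs (df x) <= B) ->
  Rabs (f b - f a) <= B * (b - a).
Proof.
move=> Hab Hd HB.
case: (MVT_gen f a b df).
- by move=> x; rewrite Rmin_left ?Rmax_right // => Hx; apply: Hd; lra.
- move=> x; rewrite Rmin_left ?Rmax_right // => Hx.
  apply: derivable_continuous_pt; apply: ex_derive_Reals_0; eexists; exact: Hd.
move=> c []; rewrite Rmin_left ?Rmax_right // => Hc ->.
rewrite Rabs_mult (Rabs_pos_eq (b - a)); last lra.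
by apply: Rmult_le_compat_r; [lra | exact: HB].
Qed.

(** * Sums of real powers of integers *)

Lemma pw_step d n : 0 < d -> (1 <= n)%nat ->
  d * exp (- (1 + d) * ln (INR (S n))) <= exp (- d * ln (INR n)) - exp (- d * ln (INR (S n))).
Proof.
move=> Hd Hn; have Hn1 := INR_ge1 n Hn; rewrite S_INR.
set x := INR n in Hn1 *.
case: (MVT_gen (fun y => - exp (- d * ln y)) x (x + 1) (fun y => d * exp (- (1 + d) * ln y))).
- move=> y; rewrite Rmin_left; last lra. rewrite Rmax_right; last lra. move=> Hy.
  auto_derive; first lra.
  have -> : - (1 + d) * ln y = - d * ln y + - ln y by ring.
  rewrite exp_plus exp_Ropp exp_ln; last lra. field; lra.
- move=> y; rewrite Rmin_left; last lra. rewrite Rmax_right; last lra. move=> Hy.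
  apply: derivable_continuous_pt; apply: ex_derive_Reals_0; auto_derive; lra.
move=> c []; rewrite Rmin_left; last lra. rewrite Rmax_right; last lra. move=> Hc E.
have -> : exp (- d * ln x) - exp (- d * ln (x + 1)) = d * exp (- (1 + d) * ln c) by lra.
apply: Rmult_le_compat_l; first lra.
apply: exp_le; have := ln_le c (x + 1); nra.
Qed.

Lemma pw_tail d M N : 0 < d -> (1 <= M <= N)%nat ->
  rsum (fun n => exp (- (1 + d) * ln (INR n))) N - rsum (fun n => exp (- (1 + d) * ln (INR n))) M
   <= (exp (- d * ln (INR M)) - exp (- d * ln (INR N))) / d.
Proof.
move=> Hd [HM]; elim => [|m Hm IH].
  by rewrite !Rminus_diag /Rdiv Rmult_0_l; lra.
rewrite [rsum _ (S m)]/= .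
have H := pw_step d m Hd ltac:(lia).
set E := exp (- (1 + d) * _) in H *.
have H2 : E <= (exp (- d * ln (INR m)) - exp (- d * ln (INR (S m)))) / d.
  apply: (Rmult_le_reg_l d) => //; field_simplify; lra.
have -> : (exp (- d * ln (INR M)) - exp (- d * ln (INR (S m)))) / d =
  (exp (- d * ln (INR M)) - exp (- d * ln (INR m))) / d + (exp (- d * ln (INR m)) - exp (- d * ln (INR (S m)))) / d by field; lra.
lra.
Qed.

Lemma pw_tail_le d M N : 0 < d -> (1 <= M <= N)%nat ->
  rsum (fun n => exp (- (1 + d) * ln (INR n))) N - rsum (fun n => exp (- (1 + d) * ln (INR n))) M
   <= exp (- d * ln (INR M)) / d.
Proof.
move=> Hd H; apply: Rle_trans (pw_tail d M N Hd H) _.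
apply: Rmult_le_compat_r; first by left; apply: Rinv_0_lt_compat.
have := exp_pos (- d * ln (INR N)); lra.
Qed.

Lemma pw_sum_le d N : 0 < d -> rsum (fun n => exp (- (1 + d) * ln (INR n))) N <= 1 + / d.
Proof.
move=> Hd; case: N => [|N]; first by have := Rinv_0_lt_compat _ Hd; simpl; lra.
have := pw_tail_le d 1 (S N) Hd ltac:(lia).
rewrite [rsum _ 1]/= ln_1 !Rmult_0_r exp_0 /Rdiv; lra.
Qed.

Lemma ln_le_exp d x : 0 < d -> 1 <= x -> ln x <= / d * exp (d * ln x).
Proof.
move=> Hd Hx; have := exp_ineq1_le (d * ln x) => H.
apply: (Rmult_le_reg_l d) => //; rewrite -Rmult_assoc Rinv_r; lra.
Qed.

(** * Euler-Maclaurin summation *)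

Definition theta := / 30.

(** Two logarithms are paid for by half of the saving [theta]. Here [ln y <= 120 y^(theta / 4)] with
    120 = 4 / theta, one unit is added for passing from [y] to [x], one is already present, and
    14884 = 122^2. *)
Lemma log2_le_pw n x : (1 <= n)%nat -> INR n <= x <= INR n + 1 ->
  (1 + ln x) ^ 2 <= 14884 * exp (theta / 2 * ln (INR n)).
Proof.
move=> Hn Hx; have Hn1 := INR_ge1 n Hn; set y := INR n in Hn1 Hx *.
have H1 : ln x <= 1 + ln y.
  rewrite -{1}(ln_exp 1) -ln_mult; try lra; last exact: exp_pos.
  by apply: ln_le; have := exp_ineq1_le 1; nra.
have H2 := ln_le_exp (theta / 4) y ltac:(rewrite /theta; lra) Hn1.
have H0 : 0 <= ln x by apply: ln_ge0; lra.
have Hy := ln_ge0 y Hn1.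
have -> : exp (theta / 2 * ln y) = exp (theta / 4 * ln y) * exp (theta / 4 * ln y).
  by rewrite -exp_plus; congr exp; field.
have HE : 1 <= exp (theta / 4 * ln y).
  by rewrite -exp_0; apply: exp_le; rewrite /theta; nra.
move: H2 HE; set E := exp _ => H2 HE.
have : / (theta / 4) = 120 by rewrite /theta; field.
move=> H3; rewrite H3 in H2.
have : 1 + ln x <= 122 * E by lra.
nra.
Qed.

(* One step of Euler-Maclaurin summation, [Psi] being a primitive of [- phi]. *)
Lemma em_step (Psi phi dphi : R -> C) (x0 B1 B2 : R) :
  (forall x, x0 <= x <= x0 + 1 -> is_derive (fun x => Re (Psi x)) x (- Re (phi x))) ->
  (forall x, x0 <= x <= x0 + 1 -> is_derive (fun x => Im (Psi x)) x (- Im (phi x))) ->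
  (forall x, x0 <= x <= x0 + 1 -> is_derive (fun x => Re (phi x)) x (Re (dphi x))) ->
  (forall x, x0 <= x <= x0 + 1 -> is_derive (fun x => Im (phi x)) x (Im (dphi x))) ->
  (forall x, x0 <= x <= x0 + 1 -> Cmod (phi x) <= B1) ->
  (forall x, x0 <= x <= x0 + 1 -> Cmod (dphi x) <= B2) ->
  Cmod (phi (x0 + 1)%R + Psi (x0 + 1)%R - Psi x0)%C <= 4 * B1 /\
  Cmod (phi (x0 + 1)%R + Psi (x0 + 1)%R - Psi x0)%C <= 2 * B2.
Proof.
have real_step : forall (f g dg : R -> R) b1 b2,
  (forall x, x0 <= x <= x0 + 1 -> is_derive f x (- g x)) ->
  (forall x, x0 <= x <= x0 + 1 -> is_derive g x (dg x)) ->
  (forall x, x0 <= x <= x0 + 1 -> Rabs (g x) <= b1) ->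
  (forall x, x0 <= x <= x0 + 1 -> Rabs (dg x) <= b2) ->
  Rabs (g (x0 + 1) + f (x0 + 1) - f x0) <= 2 * b1 /\
  Rabs (g (x0 + 1) + f (x0 + 1) - f x0) <= b2.
  move=> f g dg b1 b2 Hf Hg Hb1 Hb2.
  case: (MVT_gen f x0 (x0 + 1) (fun x => - g x)).
  - move=> y; rewrite Rmin_left; last lra. rewrite Rmax_right; last lra. move=> Hy; apply: Hf; lra.
  - move=> y; rewrite Rmin_left; last lra. rewrite Rmax_right; last lra. move=> Hy.
    apply: derivable_continuous_pt; apply: ex_derive_Reals_0; eexists; exact: Hf.
  move=> c []; rewrite Rmin_left; last lra. rewrite Rmax_right; last lra. move=> Hc E.
  have -> : g (x0 + 1) + f (x0 + 1) - f x0 = g (x0 + 1) - g c by lra.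
  split.
    apply: Rle_trans (Rabs_triang _ _) _; rewrite Rabs_Ropp.
    have := Hb1 c Hc; have := Hb1 (x0 + 1) ltac:(lra); lra.
  have H := MVT_bound g dg c (x0 + 1) b2 ltac:(lra).
  have : Rabs (g (x0 + 1) - g c) <= b2 * (x0 + 1 - c).
    by apply: H => x Hx; [apply: Hg; lra | apply: Hb2; lra].
  have : 0 <= b2 by apply: Rle_trans (Rabs_pos (dg c)) _; exact: Hb2.
  nra.
move=> H1 H2 H3 H4 H5 H6.
have [R1 R2] := real_step _ _ _ B1 B2 H1 H3
  (fun x Hx => Rle_trans _ _ _ (re_le_Cmod _) (H5 x Hx)) (fun x Hx => Rle_trans _ _ _ (re_le_Cmod _) (H6 x Hx)).
have [I1 I2] := real_step _ _ _ B1 B2 H2 H4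
  (fun x Hx => Rle_trans _ _ _ (Rabs_Im_le_Cmod _) (H5 x Hx)) (fun x Hx => Rle_trans _ _ _ (Rabs_Im_le_Cmod _) (H6 x Hx)).
have E := Cmod_le_abs (phi (x0 + 1)%R + Psi (x0 + 1)%R - Psi x0)%C.
have ER : Re (phi (x0 + 1)%R + Psi (x0 + 1)%R - Psi x0)%C = Re (phi (x0 + 1)) + Re (Psi (x0 + 1)) - Re (Psi x0) by [].
have EI : Im (phi (x0 + 1)%R + Psi (x0 + 1)%R - Psi x0)%C = Im (phi (x0 + 1)) + Im (Psi (x0 + 1)) - Im (Psi x0) by [].
rewrite ER EI in E; lra.
Qed.

Definition ell (P : R) : R := exp (theta * ln P).

Lemma ell_ge1 P : 1 <= P -> 1 <= ell P.
Proof. by move=> H; rewrite /ell -exp_0; apply: exp_le; have := ln_ge0 P H; rewrite /theta; nra. Qed.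

Lemma ell_le P Q : 0 < P -> P <= Q -> ell P <= ell Q.
Proof. by move=> H HQ; apply: exp_le; have := ln_le P Q H HQ; rewrite /theta; nra. Qed.

(* Interpolating between the bounds [1 / n] and [P / n ^ 2]. *)
Lemma em_step_pw (Psi phi dphi : R -> C) (c P : R) (n : nat) : (1 <= n)%nat -> 0 <= c -> 1 <= P ->
  (forall x, 1 <= x -> is_derive (fun x => Re (Psi x)) x (- Re (phi x))) ->
  (forall x, 1 <= x -> is_derive (fun x => Im (Psi x)) x (- Im (phi x))) ->
  (forall x, 1 <= x -> is_derive (fun x => Re (phi x)) x (Re (dphi x))) ->
  (forall x, 1 <= x -> is_derive (fun x => Im (phi x)) x (Im (dphi x))) ->
  (forall x, 1 <= x -> Cmod (phi x) <= c * (1 + ln x) ^ 2 / x) ->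
  (forall x, 1 <= x -> Cmod (dphi x) <= 2 * c * P * (1 + ln x) ^ 2 / x ^ 2) ->
  Cmod (phi (INR (S n)) + Psi (INR (S n)) - Psi (INR n))%C <=
   60000 * c * ell P * exp (- (1 + theta / 2) * ln (INR n)).
Proof.
move=> Hn Hc HP H1 H2 H3 H4 H5 H6; have Hn1 := INR_ge1 n Hn; rewrite S_INR.
set y := INR n in Hn1 *; set L := 14884 * exp (theta / 2 * ln y).
have HL : forall x, y <= x <= y + 1 -> (1 + ln x) ^ 2 <= L by move=> x Hx; exact: log2_le_pw.
have HL0 : 0 < L by rewrite /L; have := exp_pos (theta / 2 * ln y); lra.
have [A B] : Cmod (phi (y + 1)%R + Psi (y + 1)%R - Psi y)%C <= 4 * (c * L / y) /\
  Cmod (phi (y + 1)%R + Psi (y + 1)%R - Psi y)%C <= 2 * (2 * c * P * L / y ^ 2).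
  apply: (em_step Psi phi dphi) => x Hx.
  - apply: H1; lra.
  - apply: H2; lra.
  - apply: H3; lra.
  - apply: H4; lra.
  - apply: Rle_trans (H5 x ltac:(lra)) _.
    apply: Rmult_le_compat.
    + have := pow2_ge_0 (1 + ln x); nra.
    + left; apply: Rinv_0_lt_compat; lra.
    + apply: Rmult_le_compat_l => //; exact: HL.
    + apply: Rinv_le_contravar; lra.
  - apply: Rle_trans (H6 x ltac:(lra)) _.
    apply: Rmult_le_compat.
    + have := pow2_ge_0 (1 + ln x); have : 0 <= c * P by nra. nra.
    + left; apply: Rinv_0_lt_compat; nra.
    + apply: Rmult_le_compat_l; first nra. exact: HL.
    + apply: Rinv_le_contravar; nra.
have Elny : / y = exp (- ln y) by rewrite exp_Ropp exp_ln; lra.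
have -> : exp (- (1 + theta / 2) * ln y) = exp (theta / 2 * ln y) / y * exp (- theta * ln y).
  rewrite /Rdiv Elny -!exp_plus; congr exp; field.
have -> : 60000 * c * ell P * (exp (theta / 2 * ln y) / y * exp (- theta * ln y)) =
  60000 * c * (exp (theta / 2 * ln y) / y) * (ell P * exp (- theta * ln y)) by ring.
have HEy : 0 < exp (theta / 2 * ln y) / y.
  by apply: Rdiv_lt_0_compat; [exact: exp_pos | lra].
have HcE : 0 <= c * (exp (theta / 2 * ln y) / y) by nra.
rewrite /ell -exp_plus.
have -> : theta * ln P + - theta * ln y = theta * (ln P - ln y) by ring.
(* [min(1, P / y) <= (P / y)^theta]: the bound through [phi] is used up to [P], the one through
   [dphi] beyond it. *)
case: (Rle_dec y P) => HyP.
- have HlnP : ln y <= ln P by apply: ln_le; lra.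
  have : 1 <= exp (theta * (ln P - ln y)).
    by rewrite -exp_0; apply: exp_le; rewrite /theta; nra.
  move=> HE; apply: Rle_trans A _.
  have -> : 4 * (c * L / y) = 59536 * (c * (exp (theta / 2 * ln y) / y)) by rewrite /L; field; lra.
  nra.
- have HlnP : ln P <= ln y by apply: ln_le; lra.
  have : P / y <= exp (theta * (ln P - ln y)).
    have -> : P / y = exp (ln P - ln y).
      by rewrite exp_plus exp_Ropp !exp_ln; lra.
    by apply: exp_le; rewrite /theta; nra.
  move=> HE; apply: Rle_trans B _.
  have -> : 2 * (2 * c * P * L / y ^ 2) = 59536 * (c * (exp (theta / 2 * ln y) / y)) * (P / y) by rewrite /L; field; lra.
  have : 0 <= P / y by apply: Rdiv_le_0_compat; lra.
  nra.
Qed.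

(** One statement for three uses: [AN] itself, its differences and its second differences in [s],
    which bring in no, one and two factors [ln x]; hence [(1 + ln x)^2]. Constants: 60000 exceeds 4
    * 14884, the tail of [n^(-1 - theta / 2)] is at most 61 times the last factor, and 7200000 =
    60000 * 120. *)
Lemma em_sum (Z : nat -> C) (Psi phi dphi : R -> C) (c P : R) (M N : nat) :
  (1 <= M <= N)%nat -> 0 <= c -> 1 <= P ->
  (forall n, (1 <= n)%nat -> (Z (S n) - Z n = phi (INR (S n)) + Psi (INR (S n)) - Psi (INR n))%C) ->
  (forall x, 1 <= x -> is_derive (fun x => Re (Psi x)) x (- Re (phi x))) ->
  (forall x, 1 <= x -> is_derive (fun x => Im (Psi x)) x (- Im (phi x))) ->
  (forall x, 1 <= x -> is_derive (fun x => Re (phi x)) x (Re (dphi x))) ->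
  (forall x, 1 <= x -> is_derive (fun x => Im (phi x)) x (Im (dphi x))) ->
  (forall x, 1 <= x -> Cmod (phi x) <= c * (1 + ln x) ^ 2 / x) ->
  (forall x, 1 <= x -> Cmod (dphi x) <= 2 * c * P * (1 + ln x) ^ 2 / x ^ 2) ->
  Cmod (Z N - Z M)%C <= 7200000 * c * ell P * exp (- (theta / 2) * ln (INR M)).
Proof.
move=> [HM HMN] Hc HP HZ H1 H2 H3 H4 H5 H6.
set g := fun n => exp (- (1 + theta / 2) * ln (INR n)).
have Hth : 0 < theta / 2 by rewrite /theta; lra.
have HcP : 0 <= c * ell P by have := ell_ge1 P HP; nra.
have key : Cmod (Z N - Z M)%C <= 60000 * c * ell P * (rsum g (pred N) - rsum g (pred M)).
  elim: HMN => [|m Hm IH].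
    have -> : (Z M - Z M)%C = RtoC 0 by ring.
    rewrite Cmod_0 Rminus_diag; lra.
  have -> : (Z (S m) - Z M = (Z (S m) - Z m) + (Z m - Z M))%C by ring.
  apply: Rle_trans (Cmod_triangle _ _) _.
  have S1 : Cmod (Z (S m) - Z m)%C <= 60000 * c * ell P * g m.
    by rewrite HZ; [apply: (em_step_pw Psi phi dphi) => //; lia | lia].
  have -> : rsum g (pred (S m)) = rsum g (pred m) + g m by case: (m) Hm HM => [|k] //=; lia.
  lra.
have Hln : 0 <= ln (INR M) by apply/ln_ge0/INR_ge1.
have HgM : g M <= exp (- (theta / 2) * ln (INR M)) by apply: exp_le; rewrite /theta; nra.
have EM : rsum g M = rsum g (pred M) + g M by case: (M) HM => [|k] //=; lia.
have E0 := exp_pos (- (theta / 2) * ln (INR M)).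
have : rsum g (pred N) - rsum g (pred M) <= 61 * exp (- (theta / 2) * ln (INR M)).
  case: (Nat.eq_dec M N) => [->|HMN']; first by rewrite Rminus_diag; rewrite -/(INR N) in E0; have := exp_pos (- (theta / 2) * ln (INR N)); lra.
  have := pw_tail_le (theta / 2) M (pred N) Hth ltac:(lia).
  rewrite -/g; have -> : exp (- (theta / 2) * ln (INR M)) / (theta / 2) = 60 * exp (- (theta / 2) * ln (INR M)) by rewrite /theta; field.
  lra.
set E := exp _ in E0 *; move=> HE.
apply: Rle_trans key _.
have -> : 7200000 * c * ell P * E = 60000 * c * ell P * (120 * E) by ring.
apply: Rmult_le_compat_l; nra.
Qed.

(** * Limits with a rate, and Lipschitz bounds *)

Lemma is_lim_seq_pw a : 0 < a -> is_lim_seq (fun M => exp (- a * ln (INR M))) 0.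
Proof.
move=> Ha; apply is_lim_seq_spec => eps.
have [N HN] := INR_unbounded (exp (- ln eps / a)).
exists (S N) => n Hn; rewrite Rminus_0_r Rabs_pos_eq; last by left; exact: exp_pos.
rewrite -{1}(exp_ln eps); last exact: cond_pos.
apply: exp_increasing.
have H : - ln eps / a < ln (INR n).
  rewrite -(ln_exp (- ln eps / a)); apply: ln_increasing; first exact: exp_pos.
  have := le_INR (S N) n Hn; rewrite S_INR; lra.
have := Rmult_lt_compat_l a _ _ Ha H.
have -> : a * (- ln eps / a) = - ln eps by field; lra.
lra.
Qed.

Lemma le_of_vanishing (N0 : nat) (e : nat -> R) x B K : is_lim_seq e 0 ->
  (forall M, (N0 <= M)%nat -> x <= B + K * e M) -> x <= B.
Proof.
move=> He H.
have L : is_lim_seq (fun M => B + K * e M) (B + K * 0).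
  apply: is_lim_seq_plus'; first exact: is_lim_seq_const.
  exact: (is_lim_seq_scal_l e K 0).
rewrite Rmult_0_r Rplus_0_r in L.
have := is_lim_seq_le_loc (fun _ => x) (fun M => B + K * e M) x B _ (is_lim_seq_const x) L.
apply; by exists N0 => n Hn; apply: H.
Qed.

Definition Clim (z : nat -> C) : C :=
  (real (Lim_seq (fun n => Re (z n))), real (Lim_seq (fun n => Im (z n)))).

Lemma Clim_dist (z : nat -> C) (e : nat -> R) : is_lim_seq e 0 ->
  (forall M N, (1 <= M <= N)%nat -> Cmod (z N - z M)%C <= e M) ->
  forall M, (1 <= M)%nat -> Cmod (Clim z - z M)%C <= 2 * e M.
Proof.
move=> He Hz M HM.
have real_case : forall f : nat -> R, (forall M N, (1 <= M <= N)%nat -> Rabs (f N - f M) <= e M) ->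
    Rabs (real (Lim_seq f) - f M) <= e M.
  move=> f Hf.
  have Hex : ex_finite_lim_seq f.
    apply ex_lim_seq_cauchy_corr => eps.
    have [N HN] := proj2 (is_lim_seq_spec _ _) He (mkposreal (eps / 2) (is_pos_div_2 eps)).
    have HN' : forall n, (S N <= n)%nat -> Rabs (f n - f (S N)) < eps / 2.
      move=> n Hn; apply: Rle_lt_trans (Hf (S N) n ltac:(lia)) _.
      have := HN (S N) ltac:(lia); rewrite /= Rminus_0_r => H; exact: Rle_lt_trans (Rle_abs _) H.
    exists (S N) => n m Hn Hm.
    have -> : f n - f m = (f n - f (S N)) + - (f m - f (S N)) by ring.
    apply: Rle_lt_trans (Rabs_triang _ _) _; rewrite Rabs_Ropp.
    have := HN' n Hn; have := HN' m Hm; lra.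
  have HL := Lim_seq_correct' f Hex.
  have HL2 : is_lim_seq (fun n => Rabs (f n - f M)) (Rabs (real (Lim_seq f) - f M)).
    apply: (is_lim_seq_abs _ (Finite _)).
    apply: is_lim_seq_minus' HL _; exact: is_lim_seq_const.
  apply: (is_lim_seq_le_loc _ (fun _ => e M) (Rabs (real (Lim_seq f) - f M)) (e M) _ HL2 (is_lim_seq_const _)).
  by exists M => n Hn; apply: Hf.
have A := real_case (fun n => Re (z n)) (fun M N H => Rle_trans _ _ _ (re_le_Cmod (z N - z M)%C) (Hz M N H)).
have B := real_case (fun n => Im (z n)) (fun M N H => Rle_trans _ _ _ (Rabs_Im_le_Cmod (z N - z M)%C) (Hz M N H)).
have := Cmod_le_abs (Clim z - z M)%C => H.
have E1 : Re (Clim z - z M)%C = real (Lim_seq (fun n => Re (z n))) - Re (z M) by [].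
have E2 : Im (Clim z - z M)%C = real (Lim_seq (fun n => Im (z n))) - Im (z M) by [].
rewrite E1 E2 in H; lra.
Qed.

(** On the segment from [w] to [z] the real part stays nonpositive, so [cexp] has modulus at most 1
    there. The mean value theorem is applied to real and imaginary parts separately, whence the
    factor 2. *)
Lemma cexp_lip z w : Re z <= 0 -> Re w <= 0 -> Cmod (cexp z - cexp w)%C <= 2 * Cmod (z - w)%C.
Proof.
move=> Hz Hw.
set g := fun v : R => (cexp (- (w - z) * RtoC v) * (RtoC 0 * RtoC v + cexp w))%C.
set dg := fun v : R => (cexp (- (w - z) * RtoC v) * (- (w - z) * (RtoC 0 * RtoC v + cexp w) + RtoC 0))%C.
have Hg v : g v = cexp (- (w - z) * RtoC v + w)%C.
  by rewrite /g cexp_plus; ring.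
have g1 : g 1 = cexp z by rewrite Hg; congr cexp; ring.
have g0 : g 0 = cexp w by rewrite Hg; congr cexp; ring.
have Hdg v : 0 <= v <= 1 -> Cmod (dg v) <= Cmod (z - w)%C.
  move=> Hv.
  have -> : dg v = ((z - w) * cexp (- (w - z) * RtoC v + w))%C by rewrite /dg cexp_plus; ring.
  rewrite Cmod_mult Cmod_cexp.
  have : exp (Re (- (w - z) * RtoC v + w)%C) <= 1.
    rewrite -exp_0; apply: exp_le.
    have -> : Re (- (w - z) * RtoC v + w)%C = v * Re z + (1 - v) * Re w.
      by case: (z) => a b; case: (w) => c d /=; ring.
    nra.
  have := Cmod_ge_0 (z - w)%C; nra.
have HR := MVT_bound (fun v => Re (g v)) (fun v => Re (dg v)) 0 1 (Cmod (z - w)%C) ltac:(lra)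
    (fun v _ => is_derive_Re_cexp_lin (w - z)%C (RtoC 0) (cexp w) v)
    (fun v Hv => Rle_trans _ _ _ (re_le_Cmod _) (Hdg v Hv)).
have HI := MVT_bound (fun v => Im (g v)) (fun v => Im (dg v)) 0 1 (Cmod (z - w)%C) ltac:(lra)
    (fun v _ => is_derive_Im_cexp_lin (w - z)%C (RtoC 0) (cexp w) v)
    (fun v Hv => Rle_trans _ _ _ (Rabs_Im_le_Cmod _) (Hdg v Hv)).
rewrite g1 g0 in HR HI.
have H := Cmod_le_abs (cexp z - cexp w)%C.
have E1 : Re (cexp z - cexp w)%C = Re (cexp z) - Re (cexp w) by [].
have E2 : Im (cexp z - cexp w)%C = Im (cexp z) - Im (cexp w) by [].
rewrite E1 E2 in H; lra.
Qed.

Lemma cpow_lip x s s' : 1 <= x -> 0 <= Re s -> 0 <= Re s' ->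
  Cmod (cpow x s - cpow x s')%C <= 2 * Cmod (s - s')%C * ln x.
Proof.
move=> Hx Hs Hs'; have Hl := ln_ge0 x Hx.
apply: Rle_trans (cexp_lip _ _ _ _) _.
- have -> : Re (- s * RtoC (ln x))%C = - (Re s * ln x) by case: (s) => a b /=; ring.
  nra.
- have -> : Re (- s' * RtoC (ln x))%C = - (Re s' * ln x) by case: (s') => a b /=; ring.
  nra.
- have -> : (- s * RtoC (ln x) - - s' * RtoC (ln x))%C = (- (s - s') * RtoC (ln x))%C by ring.
  rewrite Cmod_mult Cmod_opp Cmod_R Rabs_pos_eq //; lra.
Qed.

Lemma one_minus_cos y : 0 <= 2 - 2 * cos y <= y ^ 2.
Proof.
split; first by have := COS_bound y; lra.
have H := cos_2a_sin (y / 2); have -> : cos y = 1 - 2 * (sin (y / 2)) ^ 2.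
  by rewrite -{1}(Rmult_1_l y) -[1 * y](_ : 2 * (y / 2) = _) ?H; [ring | field].
have := Rabs_pos (sin (y/2)).
have Hs : Rabs (sin (y / 2)) <= Rabs (y / 2).
  have := MVT_bound sin cos (Rmin 0 (y / 2)) (Rmax 0 (y / 2)) 1 (Rminmax 0 (y / 2)) (fun x _ => is_derive_sin x)
   (fun x _ => ltac:(by apply: Rabs_le; exact: COS_bound)).
  rewrite /Rmin /Rmax; case: Rle_dec => H0; rewrite sin_0.
  - rewrite !Rminus_0_r => A; rewrite (Rabs_pos_eq (y / 2)); lra.
  - rewrite Rminus_0_l Rabs_Ropp => A; rewrite (Rabs_left (y / 2)); lra.
have E1 := pow2_abs (sin (y/2)). have E2 := pow2_abs (y/2).
have : (y/2)^2 = y^2/4 by field.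
nra.
Qed.

Definition Cderiv (f : R -> C) (x : R) (l : C) :=
  is_derive (fun x => Re (f x)) x (Re l) /\ is_derive (fun x => Im (f x)) x (Im l).

Lemma Cderiv_plus f g x l m : Cderiv f x l -> Cderiv g x m ->
  Cderiv (fun x => f x + g x)%C x (l + m)%C.
Proof. by move=> [A B] [A' B']; split; apply: is_derive_plus. Qed.

Lemma Cderiv_cpow (z s : C) x : 0 < x -> Cderiv (fun x => z * cpow x s)%C x (z * (- s * cpow x (1 + s)))%C.
Proof. by split; [exact: is_derive_Re_cpow | exact: is_derive_Im_cpow]. Qed.

Lemma Cderiv_eq f g x l m : (forall x, f x = g x) -> l = m -> Cderiv f x l -> Cderiv g x m.
Proof.
by move=> E -> [A B]; split; [apply: is_derive_ext A | apply: is_derive_ext B] => t; rewrite E.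
Qed.

Lemma em_sum_C (Z : nat -> C) (Psi phi dphi : R -> C) (c P : R) (M N : nat) :
  (1 <= M <= N)%nat -> 0 <= c -> 1 <= P ->
  (forall n, (1 <= n)%nat -> (Z (S n) - Z n = phi (INR (S n)) + Psi (INR (S n)) - Psi (INR n))%C) ->
  (forall x, 1 <= x -> Cderiv Psi x (- phi x)%C) ->
  (forall x, 1 <= x -> Cderiv phi x (dphi x)) ->
  (forall x, 1 <= x -> Cmod (phi x) <= c * (1 + ln x) ^ 2 / x) ->
  (forall x, 1 <= x -> Cmod (dphi x) <= 2 * c * P * (1 + ln x) ^ 2 / x ^ 2) ->
  Cmod (Z N - Z M)%C <= 7200000 * c * ell P * exp (- (theta / 2) * ln (INR M)).
Proof.
move=> HM Hc HP HZ H1 H2 H3 H4; apply: (em_sum Z Psi phi dphi) => // x Hx.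
- by case: (H1 x Hx).
- by case: (H1 x Hx).
- by case: (H2 x Hx).
- by case: (H2 x Hx).
Qed.

(** * The regular part of zeta on the closed half-plane *)

Definition zsum (s : C) (N : nat) : C := csum (fun n => cpow (INR n) (1 + s)) N.

(* Approximations of the entire function zeta(1 + s) - 1 / s. *)
Definition AN (s : C) (N : nat) : C := (zsum s N + (cpow (INR N) s - 1) * / s)%C.

Lemma AN_1 s : AN s 1 = RtoC 1.
Proof.
rewrite /AN /zsum /= !cpow_1_l; ring. Qed.

(** [(1 - N^(-s)) / s] is the integral of [x^(-1-s)] over [[1, N]], so [AN] is a sum minus the
    corresponding integral, and its increments have the shape required by [em_sum_C]. *)
Lemma AN_step s n : (AN s (S n) - AN s n =
  cpow (INR (S n)) (1 + s) + / s * cpow (INR (S n)) s - / s * cpow (INR n) s)%C.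
Proof. rewrite /AN /zsum csum_S; ring. Qed.

Lemma cpow_S x s : 1 <= x -> cpow x (1 + s) = (RtoC (/ x) * cpow x s)%C.
Proof. by move=> Hx; rewrite cpow_plus cpow_R1 //; lra. Qed.

Lemma Cmod_inv_x x : 1 <= x -> Cmod (RtoC (/ x)) = / x.
Proof. by move=> Hx; rewrite Cmod_R Rabs_pos_eq //; left; apply: Rinv_0_lt_compat; lra. Qed.

Lemma AN_dist s M N P : s <> RtoC 0 -> 0 <= Re s -> 1 + Cmod s <= P -> (1 <= M <= N)%nat ->
  Cmod (AN s N - AN s M)%C <= 7200000 * 1 * ell P * exp (- (theta / 2) * ln (INR M)).
Proof.
move=> Hs0 Hs HP HM; have Hs1 := Cmod_ge_0 s.
apply: (em_sum_C (AN s) (fun x => / s * cpow x s)%C (fun x => 1 * cpow x (1 + s))%C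
  (fun x => - (1 + s) * (RtoC (/ x) * (RtoC (/ x) * cpow x s)))%C) => //; try lra.
- move=> n Hn; rewrite AN_step; cbv beta; ring.
- move=> x Hx; apply: (Cderiv_eq _ _ x _ _ (fun x => eq_refl) _ (Cderiv_cpow (/ s) s x ltac:(lra))).
  by field.
- move=> x Hx; apply: (Cderiv_eq _ _ x _ _ (fun x => eq_refl) _ (Cderiv_cpow 1 (1 + s) x ltac:(lra))).
  rewrite !cpow_S //; ring.
- move=> x Hx; rewrite cpow_S // !Cmod_mult Cmod_1 Cmod_inv_x //.
  have := Cmod_cpow_le1 x s Hx Hs; have := Cmod_ge_0 (cpow x s); have := ln_ge0 x Hx.
  have : 0 < / x by apply: Rinv_0_lt_compat; lra.
  move=> H1 H2 H3 H4; rewrite /Rdiv !Rmult_1_l Rmult_comm; apply: Rmult_le_compat_r; nra.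
- move=> x Hx; rewrite !Cmod_mult Cmod_opp Cmod_inv_x //.
  have := Cmod_cpow_le1 x s Hx Hs; have := Cmod_ge_0 (cpow x s); have := ln_ge0 x Hx.
  have Hi : 0 < / x by apply: Rinv_0_lt_compat; lra.
  have : Cmod (1 + s)%C <= P.
    by apply: Rle_trans (Cmod_triangle _ _) _; rewrite Cmod_1.
  have := Cmod_ge_0 (1 + s)%C.
  set i := / x in Hi *; set a := Cmod (1 + s); set b := Cmod _; set l := ln x => H1 H2 H3 H4 H5.
  have -> : 2 * 1 * P * (1 + l) ^ 2 / x ^ 2 = (P * (2 * (1 + l) ^ 2)) * (i * i) by rewrite /i; field; lra.
  have -> : a * (i * (i * b)) = (a * b) * (i * i) by ring.
  apply: Rmult_le_compat_r; first nra.
  apply: Rmult_le_compat => //; nra.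
Qed.

Lemma AN_dist_lip s s' M N P : s <> RtoC 0 -> s' <> RtoC 0 -> 0 <= Re s -> 0 <= Re s' ->
  1 + Cmod s <= P -> (1 <= M <= N)%nat ->
  Cmod ((AN s N - AN s' N) - (AN s M - AN s' M))%C
    <= 7200000 * (2 * Cmod (s - s')%C) * ell P * exp (- (theta / 2) * ln (INR M)).
Proof.
move=> Hs0 Hs0' Hs Hs' HP HM; have Hs1 := Cmod_ge_0 s; have Hd := Cmod_ge_0 (s - s')%C.
apply: (em_sum_C (fun n => AN s n - AN s' n)%C (fun x => / s * cpow x s + (- / s') * cpow x s')%C
  (fun x => 1 * cpow x (1 + s) + (- (1)) * cpow x (1 + s'))%C
  (fun x => - (RtoC (/ x) * RtoC (/ x) * ((1 + s) * (cpow x s - cpow x s') + (s - s') * cpow x s')))%C) => //; try lra.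
- move=> n Hn.
  have -> : (AN s (S n) - AN s' (S n) - (AN s n - AN s' n) = (AN s (S n) - AN s n) - (AN s' (S n) - AN s' n))%C by ring.
  rewrite !AN_step; cbv beta; ring.
- move=> x Hx; apply: (Cderiv_eq _ _ x _ _ (fun x => eq_refl) _ (Cderiv_plus _ _ _ _ _
    (Cderiv_cpow (/ s) s x ltac:(lra)) (Cderiv_cpow (- / s') s' x ltac:(lra)))).
  by field.
- move=> x Hx; apply: (Cderiv_eq _ _ x _ _ (fun x => eq_refl) _ (Cderiv_plus _ _ _ _ _
    (Cderiv_cpow 1 (1 + s) x ltac:(lra)) (Cderiv_cpow (- (1)) (1 + s') x ltac:(lra)))).
  rewrite !cpow_S //; ring.
- move=> x Hx; rewrite !cpow_S //.
  have -> : (1 * (RtoC (/ x) * cpow x s) + - (1) * (RtoC (/ x) * cpow x s') = RtoC (/ x) * (cpow x s - cpow x s'))%C by ring.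
  rewrite Cmod_mult Cmod_inv_x //.
  have := cpow_lip x s s' Hx Hs Hs'; have := ln_ge0 x Hx.
  have : 0 < / x by apply: Rinv_0_lt_compat; lra.
  move=> H1 H2 H3; rewrite /Rdiv Rmult_comm; apply: Rmult_le_compat_r; first lra.
  apply: Rle_trans H3 _; apply: Rmult_le_compat_l; nra.
- move=> x Hx; rewrite Cmod_opp !Cmod_mult Cmod_inv_x //.
  have Hi : 0 < / x by apply: Rinv_0_lt_compat; lra.
  have -> : forall t, t / x ^ 2 = / x * / x * t by move=> t; field; lra.
  apply: Rmult_le_compat_l; first nra.
  apply: Rle_trans (Cmod_triangle _ _) _; rewrite !Cmod_mult.
  have := cpow_lip x s s' Hx Hs Hs'; have := ln_ge0 x Hx.
  have := Cmod_cpow_le1 x s' Hx Hs'; have := Cmod_ge_0 (cpow x s').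
  have : Cmod (1 + s)%C <= P.
    by apply: Rle_trans (Cmod_triangle _ _) _; rewrite Cmod_1.
  have := Cmod_ge_0 (1 + s)%C; have := Cmod_ge_0 (cpow x s - cpow x s')%C.
  move: Hd; set d := Cmod (s - s'); set a := Cmod (1 + s); set b := Cmod (cpow x s'); set e := Cmod _.
  set l := ln x => Hd He Ha HaP Hb Hb1 Hl Hel.
  have H1 : a * e <= P * (2 * d * l) by apply: Rmult_le_compat.
  have H2 : d * b <= d * P by apply: Rmult_le_compat_l => //; lra.
  have : 0 <= P * d by nra.
  have : 0 <= P * d * l by have : 0 <= P * d; nra.
  have : 0 <= P * d * (l * l) by have : 0 <= P * d; nra.
  nra.
Qed.

Lemma Cmod_Ih (h : R) : 0 <= h -> Cmod (Ci * RtoC h)%C = h.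
Proof. by move=> H; rewrite Cmod_mult Cmod_Ci Cmod_R Rabs_pos_eq //; ring. Qed.

(** The left side is [|2 cos(h ln x) - 2|]: quadratic smallness in [h] costs two logarithms. *)
Lemma cpow_Ih2 x (h : R) : 1 <= x ->
  Cmod (cpow x (Ci * RtoC h) + cpow x (- (Ci * RtoC h)) - 2)%C <= h ^ 2 * ln x ^ 2.
Proof.
move=> Hx; rewrite -Rpow_mult_distr.
have -> : (cpow x (Ci * RtoC h) + cpow x (- (Ci * RtoC h)) - 2)%C = RtoC (- (2 - 2 * cos (h * ln x))).
  have E1 : (- (Ci * RtoC h) * RtoC (ln x))%C = (0, - (h * ln x)) by apply: C_eq => /=; ring.
  have E2 : (- - (Ci * RtoC h) * RtoC (ln x))%C = (0, h * ln x) by apply: C_eq => /=; ring.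
  rewrite /cpow E1 E2 /cexp /=; apply: C_eq => /=; rewrite exp_0 ?cos_neg ?sin_neg; ring.
rewrite Cmod_R Rabs_Ropp.
have := one_minus_cos (h * ln x); move=> [A B]; rewrite Rabs_pos_eq; lra.
Qed.

(** The second difference multiplies the summand [x^(-1-s)] by [2 cos(h ln x) - 2]. Since that
    factor and its derivative in [x] are controlled by powers of [h ln x], the whole Euler-Maclaurin
    estimate gains [h^2]. *)
Lemma AN_dist_d2 s (h : R) M N P : let ih := (Ci * RtoC h)%C in
  s <> RtoC 0 -> (s + ih)%C <> RtoC 0 -> (s - ih)%C <> RtoC 0 -> 0 <= Re s -> 0 <= h ->
  1 + Cmod s <= P -> (1 <= M <= N)%nat ->
  Cmod ((AN (s + ih) N + AN (s - ih) N - 2 * AN s N) - (AN (s + ih) M + AN (s - ih) M - 2 * AN s M))%C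
    <= 7200000 * (h ^ 2) * ell P * exp (- (theta / 2) * ln (INR M)).
Proof.
move=> ih Hs0 Hp Hm Hs Hh HP HM; have Hs1 := Cmod_ge_0 s.
have Eih : forall x, 1 <= x -> cpow x (s + ih) = (cpow x s * cpow x ih)%C by move=> x Hx; rewrite cpow_plus.
have Emh : forall x, 1 <= x -> cpow x (s - ih) = (cpow x s * cpow x (- ih))%C by move=> x Hx; rewrite -cpow_plus.
apply: (em_sum_C (fun n => AN (s + ih) n + AN (s - ih) n - 2 * AN s n)%C
  (fun x => / (s + ih) * cpow x (s + ih) + / (s - ih) * cpow x (s - ih) + (- (2 * / s)) * cpow x s)%C
  (fun x => 1 * cpow x (1 + (s + ih)) + 1 * cpow x (1 + (s - ih)) + (- (2)) * cpow x (1 + s))%C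
  (fun x => - (RtoC (/ x) * RtoC (/ x) * (cpow x s * ((1 + s) * (cpow x ih + cpow x (- ih) - 2) + ih * (cpow x ih - cpow x (- ih))))))%C) => //; try nra.
- move=> n Hn.
  have -> : (AN (s + ih) (S n) + AN (s - ih) (S n) - 2 * AN s (S n) - (AN (s + ih) n + AN (s - ih) n - 2 * AN s n) =
    (AN (s + ih) (S n) - AN (s + ih) n) + (AN (s - ih) (S n) - AN (s - ih) n) - 2 * (AN s (S n) - AN s n))%C by ring.
  rewrite !AN_step; cbv beta; ring.
- move=> x Hx; apply: (Cderiv_eq _ _ x _ _ (fun x => eq_refl) _ (Cderiv_plus _ _ _ _ _ (Cderiv_plus _ _ _ _ _
    (Cderiv_cpow (/ (s + ih)) (s + ih) x ltac:(lra)) (Cderiv_cpow (/ (s - ih)) (s - ih) x ltac:(lra)))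
    (Cderiv_cpow (- (2 * / s)) s x ltac:(lra)))).
  by field.
- move=> x Hx; apply: (Cderiv_eq _ _ x _ _ (fun x => eq_refl) _ (Cderiv_plus _ _ _ _ _ (Cderiv_plus _ _ _ _ _
    (Cderiv_cpow 1 (1 + (s + ih)) x ltac:(lra)) (Cderiv_cpow 1 (1 + (s - ih)) x ltac:(lra)))
    (Cderiv_cpow (- (2)) (1 + s) x ltac:(lra)))).
  rewrite !cpow_S // Eih // Emh //; ring.
- move=> x Hx; rewrite !cpow_S // Eih // Emh //.
  have -> : (1 * (RtoC (/ x) * (cpow x s * cpow x ih)) + 1 * (RtoC (/ x) * (cpow x s * cpow x (- ih))) + - (2) * (RtoC (/ x) * cpow x s)
    = RtoC (/ x) * (cpow x s * (cpow x ih + cpow x (- ih) - 2)))%C by ring.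
  rewrite !Cmod_mult Cmod_inv_x //.
  have := cpow_Ih2 x h Hx; have := ln_ge0 x Hx; have := Cmod_cpow_le1 x s Hx Hs; have := Cmod_ge_0 (cpow x s).
  have : 0 < / x by apply: Rinv_0_lt_compat; lra.
  have := Cmod_ge_0 (cpow x ih + cpow x (- ih) - 2)%C.
  rewrite -/ih; set e := Cmod (_ - 2)%C; set b := Cmod _; set l := ln x.
  move=> He Hi Hb Hb1 Hl H; rewrite /Rdiv Rmult_comm; apply: Rmult_le_compat_r; first lra.
  have : h ^ 2 * l ^ 2 <= h ^ 2 * (1 + l) ^ 2 by apply: Rmult_le_compat_l; nra.
  nra.
- move=> x Hx; rewrite Cmod_opp 2!Cmod_mult Cmod_inv_x //.
  have Hi : 0 < / x by apply: Rinv_0_lt_compat; lra.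
  have -> : forall t, t / x ^ 2 = / x * / x * t by move=> t; field; lra.
  apply: Rmult_le_compat_l; first nra.
  rewrite Cmod_mult; have Hb := Cmod_cpow_le1 x s Hx Hs; have Hb0 := Cmod_ge_0 (cpow x s).
  have Hl := ln_ge0 x Hx.
  have H1 := cpow_Ih2 x h Hx.
  have H2 : Cmod (cpow x ih - cpow x (- ih))%C <= 2 * (2 * h) * ln x.
    have R0 : Re ih = 0 by rewrite /ih /=; ring.
    have := cpow_lip x ih (- ih)%C Hx ltac:(lra) ltac:(rewrite re_opp; lra).
    have -> : (ih - - ih = RtoC 2 * ih)%C by rewrite -[RtoC 2]/(RtoC (1 + 1)) RtoC_plus; ring.
    by rewrite Cmod_mult Cmod_Ih // Cmod_R Rabs_pos_eq; lra.
  have H3 : Cmod ((1 + s) * (cpow x ih + cpow x (- ih) - 2) + ih * (cpow x ih - cpow x (- ih)))%C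
    <= P * (h ^ 2 * ln x ^ 2) + h * (2 * (2 * h) * ln x).
    apply: Rle_trans (Cmod_triangle _ _) _; rewrite (Cmod_mult (1 + s)) (Cmod_mult ih) [Cmod ih]Cmod_Ih //.
    apply: Rplus_le_compat.
      apply: Rmult_le_compat => //; try exact: Cmod_ge_0.
      by apply: Rle_trans (Cmod_triangle _ _) _; rewrite Cmod_1.
    exact: Rmult_le_compat_l.
  have H4 := Cmod_ge_0 ((1 + s) * (cpow x ih + cpow x (- ih) - 2) + ih * (cpow x ih - cpow x (- ih)))%C.
  move: H3 H4 Hb Hb0 Hl; set e := Cmod (_ + _)%C; set b := Cmod _; set l := ln x => H3 H4 Hb Hb0 Hl.
  have : 0 <= h ^ 2 by nra.
  set k := h ^ 2 in H3 * => Hk.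
  have E : h * (2 * (2 * h) * l) = 4 * k * l by rewrite /k; ring.
  rewrite E in H3.
  have A1 : 0 <= k * l by nra.
  have A2 : k * l <= P * (k * l) by nra.
  have A3 : 0 <= P * k by nra.
  have A4 : 0 <= P * (k * l ^ 2) by apply: Rmult_le_pos; nra.
  have : b * e <= e by nra.
  have -> : 2 * k * P * (1 + l) ^ 2 = 2 * (P * k) + 4 * (P * (k * l)) + 2 * (P * (k * l ^ 2)) by ring.
  nra.
Qed.

Definition KA := 7200000.

(* zeta(1 + s) - 1 / s *)
Definition zA (s : C) : C := Clim (AN s).

(* zeta(1 + s) *)
Definition zeta (s : C) : C := (/ s + zA s)%C.

Definition em_err (M : nat) := exp (- (theta / 2) * ln (INR M)).

Lemma em_err_lim : is_lim_seq em_err 0.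
Proof. apply: is_lim_seq_pw; rewrite /theta; lra. Qed.

Lemma em_err_1 : em_err 1 = 1.
Proof. by rewrite /em_err /= ln_1 Rmult_0_r exp_0. Qed.

Lemma zA_approx s M : s <> RtoC 0 -> 0 <= Re s -> (1 <= M)%nat ->
  Cmod (zA s - AN s M)%C <= 2 * KA * ell (1 + Cmod s) * em_err M.
Proof.
move=> Hs0 Hs HM.
have H := Clim_dist (AN s) (fun M => (7200000 * 1 * ell (1 + Cmod s)) * em_err M).
have -> : 2 * KA * ell (1 + Cmod s) * em_err M = 2 * (7200000 * 1 * ell (1 + Cmod s) * em_err M) by rewrite /KA; ring.
apply: H => //.
  have := is_lim_seq_scal_l em_err (7200000 * 1 * ell (1 + Cmod s)) 0 em_err_lim.
  by rewrite /= Rmult_0_r.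
by move=> M' N H; apply: AN_dist => //; lra.
Qed.

Lemma zA_bound s : s <> RtoC 0 -> 0 <= Re s -> Cmod (zA s) <= 3 * KA * ell (1 + Cmod s).
Proof.
move=> Hs0 Hs.
have := zA_approx s 1 Hs0 Hs (le_n 1); rewrite em_err_1 AN_1.
have H1 := ell_ge1 (1 + Cmod s) ltac:(have := Cmod_ge_0 s; lra).
move=> H; have -> : zA s = ((zA s - 1) + 1)%C by ring.
apply: Rle_trans (Cmod_triangle _ _) _.
rewrite Cmod_1; move: H; rewrite /KA; lra.
Qed.

(** As [AN s 1 = 1] for every [s], the bound on the increment of [AN s - AN s'] from 1 to [M] bounds
    the difference at [M] itself; then [M] tends to infinity. [zA_d2] rests on the same cancellation
    at 1. *)
Lemma zA_lip s s' : s <> RtoC 0 -> s' <> RtoC 0 -> 0 <= Re s -> 0 <= Re s' ->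
  Cmod (zA s - zA s')%C <= 2 * KA * Cmod (s - s')%C * ell (1 + Cmod s).
Proof.
move=> Hs0 Hs0' Hs Hs'.
apply: (le_of_vanishing 1 em_err _ _ (2 * KA * ell (1 + Cmod s) + 2 * KA * ell (1 + Cmod s')) em_err_lim) => M HM.
have A := zA_approx s M Hs0 Hs HM; have A' := zA_approx s' M Hs0' Hs' HM.
have := AN_dist_lip s s' 1 M (1 + Cmod s) Hs0 Hs0' Hs Hs' (Rle_refl _) ltac:(lia).
rewrite !AN_1 -/(em_err 1) em_err_1.
have -> : (AN s M - AN s' M - (1 - 1))%C = (AN s M - AN s' M)%C by ring.
have -> : (zA s - zA s' = (zA s - AN s M) + - (zA s' - AN s' M) + (AN s M - AN s' M))%C by ring.
move=> B; apply: Rle_trans (Cmod_triangle _ _) _.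
have := Cmod_triangle (zA s - AN s M)%C (- (zA s' - AN s' M))%C; rewrite Cmod_opp.
move: B A A'; rewrite /KA; lra.
Qed.

Lemma zA_d2 s (h : R) : let ih := (Ci * RtoC h)%C in
  s <> RtoC 0 -> (s + ih)%C <> RtoC 0 -> (s - ih)%C <> RtoC 0 -> 0 <= Re s -> 0 <= h ->
  Cmod (zA (s + ih) + zA (s - ih) - 2 * zA s)%C <= KA * h ^ 2 * ell (1 + Cmod s).
Proof.
move=> ih Hs0 Hp Hm Hs Hh.
have Rp : Re (s + ih)%C = Re s by rewrite re_plus /ih /=; ring.
have Rm : Re (s - ih)%C = Re s by rewrite re_plus re_opp /ih /=; ring.
apply: (le_of_vanishing 1 em_err _ _ (2 * KA * ell (1 + Cmod (s + ih)%C) +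
  2 * KA * ell (1 + Cmod (s - ih)%C) + 2 * (2 * KA * ell (1 + Cmod s))) em_err_lim) => M HM.
have A := zA_approx s M Hs0 Hs HM.
have Ap := zA_approx (s + ih)%C M Hp ltac:(lra) HM.
have Am := zA_approx (s - ih)%C M Hm ltac:(lra) HM.
have := AN_dist_d2 s h 1 M (1 + Cmod s) Hs0 Hp Hm Hs Hh (Rle_refl _) ltac:(lia).
rewrite -/ih !AN_1 -/(em_err 1) em_err_1.
have -> : (AN (s + ih) M + AN (s - ih) M - 2 * AN s M - (1 + 1 - 2 * 1) = AN (s + ih) M + AN (s - ih) M - 2 * AN s M)%C.
  have -> : RtoC 2 = (1 + 1)%C by rewrite -RtoC_plus; congr RtoC; lra.
  ring.
have -> : (zA (s + ih) + zA (s - ih) - 2 * zA s = (zA (s + ih) - AN (s + ih) M) + (zA (s - ih) - AN (s - ih) M) +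
  - (2 * (zA s - AN s M)) + (AN (s + ih) M + AN (s - ih) M - 2 * AN s M))%C by ring.
move=> B; apply: Rle_trans (Cmod_triangle _ _) _.
have := Cmod_triangle (zA (s + ih) - AN (s + ih) M + (zA (s - ih) - AN (s - ih) M))%C (- (2 * (zA s - AN s M)))%C.
have := Cmod_triangle (zA (s + ih) - AN (s + ih) M)%C (zA (s - ih) - AN (s - ih) M)%C.
rewrite Cmod_opp (Cmod_mult 2) Cmod_R (Rabs_pos_eq 2); last lra.
move: B A Ap Am; rewrite /KA; lra.
Qed.

(** * The Dirichlet series and the sieved Euler product *)

Lemma Cmod_term s n : Cmod (cpow (INR n) (1 + s)) = exp (- (1 + Re s) * ln (INR n)).
Proof. by rewrite Cmod_cpow re_plus. Qed.

Lemma csum_diff (f : nat -> C) (g : nat -> R) M N : (M <= N)%nat ->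
  (forall n, (M < n <= N)%nat -> Cmod (f n) <= g n) ->
  Cmod (csum f N - csum f M)%C <= rsum g N - rsum g M.
Proof.
elim=> [|m Hm IH] H.
  have -> : (csum f M - csum f M = 0)%C by ring.
  by rewrite Cmod_0 Rminus_diag; lra.
rewrite csum_S rsum_S.
have -> : (csum f m + f (S m) - csum f M = (csum f m - csum f M) + f (S m))%C by ring.
apply: Rle_trans (Cmod_triangle _ _) _.
have := H (S m) ltac:(lia); have := IH (fun n Hn => H n ltac:(lia)); lra.
Qed.

Lemma Re_pos_neq0 (s : C) : 0 < Re s -> s <> RtoC 0.
Proof. by move=> H E; rewrite E /= in H; lra. Qed.

(** For [Re s > 0] the term [M^(-s) / s] of [AN s M] vanishes in the limit, which identifies
    [zeta s] with the Dirichlet series; the bound is the tail of the absolute values. *)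
Lemma zeta_tail s N : 0 < Re s -> (1 <= N)%nat ->
  Cmod (zeta s - zsum s N)%C <= exp (- Re s * ln (INR N)) / Re s.
Proof.
move=> Hs HN; have Hs0 := Re_pos_neq0 s Hs.
set e := fun M => em_err M + exp (- Re s * ln (INR M)).
have He : is_lim_seq e 0.
  rewrite -(Rplus_0_r 0); apply: is_lim_seq_plus'; [exact: em_err_lim | exact: is_lim_seq_pw].
set K := 2 * KA * ell (1 + Cmod s) + Cmod (/ s)%C.
apply: (le_of_vanishing N e _ _ K He) => M HM.
have -> : (zeta s - zsum s N = (zA s - AN s M) + / s * cpow (INR M) s + (zsum s M - zsum s N))%C.
  rewrite /zeta /AN; ring.
have A := zA_approx s M Hs0 ltac:(lra) ltac:(lia).
have B : Cmod (/ s * cpow (INR M) s)%C = Cmod (/ s)%C * exp (- Re s * ln (INR M)) by rewrite Cmod_mult Cmod_cpow.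
have D : Cmod (zsum s M - zsum s N)%C <= exp (- Re s * ln (INR N)) / Re s.
  apply: Rle_trans (csum_diff _ (fun n => exp (- (1 + Re s) * ln (INR n))) N M HM _) _.
    by move=> n _; rewrite Cmod_term; right.
  by apply: pw_tail_le.
apply: Rle_trans (Cmod_triangle _ _) _.
have := Cmod_triangle (zA s - AN s M)%C (/ s * cpow (INR M) s)%C.
have H1 : 0 <= 2 * KA * ell (1 + Cmod s) by rewrite /KA /ell; have := exp_pos (theta * ln (1 + Cmod s)); lra.
have H2 := Cmod_ge_0 (/ s)%C.
have H3 := exp_pos (- Re s * ln (INR M)); have H4 : 0 < em_err M by exact: exp_pos.
rewrite /K /e; nra.
Qed.

Lemma zeta_bound s : 0 < Re s -> Cmod (zeta s) <= 1 + / Re s.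
Proof.
move=> Hs; have := zeta_tail s 1 Hs (le_n 1).
rewrite /zsum /= cpow_1_l ln_1 Rmult_0_r exp_0 /Rdiv Rmult_1_l => H.
have -> : zeta s = ((zeta s - (0 + 1)) + 1)%C by ring.
by apply: Rle_trans (Cmod_triangle _ _) _; rewrite Cmod_1; lra.
Qed.

(* [chi y n] holds when n has no divisor in [2, y]. *)
Fixpoint chi (y n : nat) : bool :=
  match y with
  | O => true
  | S y' => chi y' n && (Nat.eqb y 1 || negb (Nat.eqb (n mod y) 0))
  end.

Lemma chi_S y n :
  chi (S y) n = (chi y n && (Nat.eqb (S y) 1 || negb (Nat.eqb (n mod S y) 0)))%bool.
Proof. by []. Qed.

Lemma chiP y n : chi y n = true <-> (forall d, (2 <= d <= y)%nat -> ~ Nat.divide d n).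
Proof.
elim: y => [|y IH]; first by split => // _ d; lia.
rewrite chi_S Bool.andb_true_iff IH; split.
- move=> [H1 H2] d Hd; case: (Nat.eq_dec d (S y)) => Hdy; last by apply: H1; lia.
  subst d; move: H2; case: (Nat.eqb_spec (S y) 1) => [|_ H2]; first lia.
  by move=> /Nat.Lcm0.mod_divide E; rewrite E in H2.
- move=> H; split; first by move=> d Hd; apply: H; lia.
  case: (Nat.eqb_spec (S y) 1) => // Hy.
  case: (Nat.eqb_spec (n mod S y) 0) => // E.
  by case: (H (S y) ltac:(lia) (proj1 (Nat.Lcm0.mod_divide _ _) E)).
Qed.

Lemma chi_mul y m : chi y (S y) = true -> chi y (S y * m) = chi y m.
Proof.
move=> /chiP Hp; case E: (chi y m).
- move/chiP: E => E; apply/chiP => d Hd Hdiv.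
  apply: (E d Hd); apply: (Nat.gauss d (S y) m) => //.
  set g := Nat.gcd d (S y).
  have Hgd : Nat.divide g d by exact: Nat.gcd_divide_l.
  have Hgp : Nat.divide g (S y) by exact: Nat.gcd_divide_r.
  have Hle := Nat.divide_pos_le g d ltac:(lia) Hgd.
  have Hg0 : g <> O by move=> H0; rewrite H0 in Hgd; case: Hgd => k; lia.
  case: (Nat.eq_dec g 1) => // Hg1.
  by case: (Hp g ltac:(lia)).
- case E2: (chi y (S y * m)) => //; move/chiP: E2 => E2.
  have : chi y m = true by apply/chiP => d Hd Hdiv; apply: (E2 d Hd); exact: Nat.divide_mul_r.
  by rewrite E.
Qed.

Lemma csum_multiples (f : nat -> C) p N : (1 <= p)%nat ->
  csum (fun n => if Nat.eqb (n mod p) 0 then f n else RtoC 0) N = csum (fun m => f (p * m)%nat) (N / p).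
Proof.
move=> Hp; elim: N => [|N IH]; first by rewrite Nat.Div0.div_0_l.
rewrite csum_S IH; case: Nat.eqb_spec => H.
- have [k Hk] := proj1 (Nat.Lcm0.mod_divide (S N) p) H.
  case: k Hk => [|k] Hk; first lia.
  have -> : (S N / p = S k)%nat by rewrite Hk; apply: Nat.div_mul; lia.
  have -> : (N / p = k)%nat.
    symmetry; apply: (Nat.div_unique _ _ _ (p - 1)); first lia.
    rewrite Nat.mul_succ_l in Hk; rewrite Nat.mul_comm; lia.
  rewrite csum_S; congr (_ + f _)%C; lia.
- have -> : (S N / p = N / p)%nat; last by ring.
  symmetry; apply: (Nat.div_unique _ _ _ (S (N mod p))); last by have := Nat.div_mod_eq N p; lia.
  have H2 := Nat.mod_upper_bound N p ltac:(lia).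
  case: (Nat.eq_dec (S (N mod p)) p) => E; last lia.
  case: H; apply/Nat.Lcm0.mod_divide; exists (S (N / p)); have := Nat.div_mod_eq N p; lia.
Qed.

Definition sifted (y : nat) (s : C) (N : nat) : C :=
  csum (fun n => if chi y n then cpow (INR n) (1 + s) else RtoC 0) N.

(** The Euler product of [1 / zeta(1 + s)] over the primes up to [y]: the test says that [y >= 2]
    has no divisor in [[2, y - 1]]. *)
Fixpoint eprod (y : nat) (s : C) : C :=
  match y with
  | O => RtoC 1
  | S y' => if Nat.leb 1 y' && chi y' y then (eprod y' s * (1 - cpow (INR y) (1 + s)))%C else eprod y' s
  end.

Lemma eprod_S y s : eprod (S y) s =
  if (Nat.leb 1 y && chi y (S y))%bool then (eprod y s * (1 - cpow (INR (S y)) (1 + s)))%C else eprod y s.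
Proof. by []. Qed.

(** A composite [y + 1] has a divisor in [[2, y]], which has removed its multiples already; for
    [y = 0] nothing is sifted at all. *)
Lemma sifted_same y s N : (Nat.leb 1 y && chi y (S y))%bool = false -> sifted (S y) s N = sifted y s N.
Proof.
move=> H; apply: csum_ext => n Hn.
suff -> : chi (S y) n = chi y n by [].
case: y H => [|y] H; first by rewrite /= .
have {}H : chi (S y) (S (S y)) = false by [].
case E : (chi (S y) n); last by rewrite chi_S E.
apply/chiP => d Hd Hdiv; move/chiP: E => E.
case: (Nat.eq_dec d (S (S y))) => Hd2; last by apply: (E d) => //; lia.
subst d; suff : chi (S y) (S (S y)) = true by rewrite H.
apply/chiP => d Hd3 Hdiv2; apply: (E d Hd3); exact: Nat.divide_trans Hdiv2 Hdiv.
Qed.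

(** Eratosthenes: the terms removed by the prime [p = y + 1] are [p m] with [m <= N / p], and [p m]
    has survived the earlier sieving exactly when [m] has ([chi_mul]). *)
Lemma sifted_prime y s N : (1 <= y)%nat -> chi y (S y) = true ->
  sifted (S y) s N = (sifted y s N - cpow (INR (S y)) (1 + s) * sifted y s (N / S y))%C.
Proof.
move=> Hy Hp.
have E : (cpow (INR (S y)) (1 + s) * sifted y s (N / S y))%C =
   csum (fun n => if Nat.eqb (n mod S y) 0 then (if chi y n then cpow (INR n) (1 + s) else RtoC 0) else RtoC 0) N.
  rewrite csum_multiples; last lia.
  rewrite /sifted -csum_scal; apply: csum_ext => m Hm; rewrite chi_mul //.
  case: (chi y m); last by ring.
  rewrite mult_INR cpow_mult //; apply: lt_0_INR; lia.
rewrite E /sifted.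
have -> : forall a b : C, (a - b = a + (- (1)) * b)%C by move=> a b; ring.
rewrite -csum_scal -csum_plus; apply: csum_ext => n Hn.
have -> : chi (S y) n = (chi y n && negb (Nat.eqb (n mod S y) 0))%bool.
  rewrite chi_S; congr andb; case: (y) Hy => [|k] //; lia.
by case: (chi y n); case: (Nat.eqb _ _) => /=; ring.
Qed.

Lemma sifted_lim y s : 0 < Re s -> forall eps, 0 < eps ->
  exists N0, forall N, (N0 <= N)%nat -> Cmod (sifted y s N - zeta s * eprod y s)%C <= eps.
Proof.
move=> Hs; elim: y => [|y IH] eps Heps.
- have H := is_lim_seq_pw (Re s) Hs; apply is_lim_seq_spec in H.
  have [N HN] := H (mkposreal (eps * Re s) ltac:(nra)).
  exists (S N) => M HM; rewrite /= Cmult_1_r.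
  have -> : (sifted 0 s M - zeta s)%C = (- (zeta s - zsum s M))%C by rewrite /sifted /zsum /=; ring.
  rewrite Cmod_opp; apply: Rle_trans (zeta_tail s M Hs ltac:(lia)) _.
  have := HN M ltac:(lia); rewrite /= Rminus_0_r Rabs_pos_eq; last by left; exact: exp_pos.
  move=> H1; apply: (Rmult_le_reg_r (Re s)) => //.
  rewrite /Rdiv Rmult_assoc Rinv_l; lra.
- rewrite !eprod_S; case Ec : (Nat.leb 1 y && chi y (S y))%bool.
  + move/andb_prop: Ec => [/Nat.leb_le Hy Hc].
    have [N0 HN0] := IH (eps / 2) ltac:(lra).
    exists (S y * N0 + N0)%nat => N HN.
    rewrite (sifted_prime y s N Hy Hc).
    have HN1 : (N0 <= N / S y)%nat by apply: Nat.div_le_lower_bound; lia.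
    set q := cpow _ _.
    have -> : (sifted y s N - q * sifted y s (N / S y) - zeta s * (eprod y s * (1 - q)) =
      (sifted y s N - zeta s * eprod y s) - q * (sifted y s (N / S y) - zeta s * eprod y s))%C by ring.
    apply: Rle_trans (Cmod_triangle _ _) _; rewrite Cmod_opp Cmod_mult.
    have Hq : Cmod q <= 1 by apply: Cmod_cpow_le1; [apply: INR_ge1; lia | rewrite re_plus /=; lra].
    have := HN0 N ltac:(lia); have := HN0 _ HN1.
    have := Cmod_ge_0 (sifted y s (N / S y) - zeta s * eprod y s)%C; have := Cmod_ge_0 q; nra.
  + have [N0 HN0] := IH eps Heps; exists N0 => N HN.
    by rewrite sifted_same //; exact: HN0.
Qed.

Lemma sifted_self y s : (1 <= y)%nat -> sifted y s y = RtoC 1.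
Proof.
move=> Hy; have H : forall k, (1 <= k <= y)%nat -> csum (fun n => if chi y n then cpow (INR n) (1 + s) else RtoC 0) k = RtoC 1.
  elim=> [|k IH] Hk; first lia.
  case: (Nat.eq_dec k 0) => [->|Hk0].
    have -> : csum (fun n => if chi y n then cpow (INR n) (1 + s) else RtoC 0) 1 = (0 + if chi y 1 then cpow (INR 1) (1 + s) else RtoC 0)%C by [].
    have -> : chi y 1 = true by apply/chiP => d Hd /Nat.divide_1_r; lia.
    by rewrite /= cpow_1_l; ring.
  rewrite csum_S IH; last lia.
  have -> : chi y (S k) = false.
    case E: (chi y (S k)) => //; move/chiP: E => E.
    by case: (E (S k) ltac:(lia) (Nat.divide_refl _)).
  ring.
exact: H.
Qed.

(** The product is the sum of [n^(-1-s)] over the [n] without divisor in [[2, y]]. Among [n <= y]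
    only 1 survives, and the rest is dominated by a tail; the Euler product stays finite. *)
Lemma zeta_eprod y s : 0 < Re s -> (1 <= y)%nat ->
  Cmod (zeta s * eprod y s - 1)%C <= exp (- Re s * ln (INR y)) / Re s.
Proof.
move=> Hs Hy; apply: Rnot_lt_le => Hlt.
set b := exp _ / _ in Hlt.
have [N0 HN0] := sifted_lim y s Hs ((Cmod (zeta s * eprod y s - 1)%C - b) / 2) ltac:(lra).
have H1 := HN0 (N0 + y)%nat ltac:(lia).
have H2 : Cmod (sifted y s (N0 + y) - 1)%C <= b.
  rewrite -{1}(sifted_self y s Hy).
  apply: Rle_trans (csum_diff _ (fun n => exp (- (1 + Re s) * ln (INR n))) y (N0 + y)%nat ltac:(lia) _) _.
    move=> n _; case: (chi y n); first by rewrite Cmod_term; right.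
    by rewrite Cmod_0; left; exact: exp_pos.
  by apply: pw_tail_le => //; lia.
have : Cmod (zeta s * eprod y s - 1)%C <= Cmod (sifted y s (N0 + y) - zeta s * eprod y s)%C + Cmod (sifted y s (N0 + y) - 1)%C.
  have -> : (zeta s * eprod y s - 1 = - (sifted y s (N0 + y) - zeta s * eprod y s) + (sifted y s (N0 + y) - 1))%C by ring.
  by apply: Rle_trans (Cmod_triangle _ _) _; rewrite Cmod_opp; lra.
lra.
Qed.

(** * Lower bounds for zeta *)

Lemma Cmod_one_minus q : Cmod (1 - q)%C <= exp (- Re q + Cmod q ^ 2 / 2).
Proof.
(* The square is [1 - 2 Re q + |q|^2], and [1 + x <= exp x]; this stands in for the logarithm of an
   Euler factor. *)
have H : Cmod (1 - q)%C ^ 2 <= exp (- Re q + Cmod q ^ 2 / 2) ^ 2.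
  set A := - Re q + _; have -> : exp A ^ 2 = exp (A + A) by rewrite exp_plus; ring.
  have -> : Cmod (1 - q)%C ^ 2 = 1 + (- 2 * Re q + Cmod q ^ 2).
    have H1 := Cmod2_alt (1 - q)%C; have H2 := Cmod2_alt q.
    have H3 : Re (1 - q)%C = 1 - Re q by [].
    have H4 : Im (1 - q)%C = 0 - Im q by [].
    rewrite H3 H4 in H1; rewrite H2; lra.
  have := exp_ineq1_le (A + A); rewrite {1 2}/A; lra.
by apply: Rsqr_incr_0_var; [rewrite !Rsqr_pow2 | left; exact: exp_pos].
Qed.

(* 3 + 4 cos + cos(2 .) >= 0, applied to the Euler factors. *)
Lemma eprod_341 y (eta t : R) : 0 < eta ->
  Cmod (eprod y (eta, 0)) ^ 3 * Cmod (eprod y (eta, t)) ^ 4 * Cmod (eprod y (eta, 2 * t))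
    <= exp (4 * rsum (fun n => exp (- (1 + 1) * ln (INR n))) y).
Proof.
move=> He; elim: y => [|y IH].
  by rewrite /= Cmod_1 Rmult_0_r exp_0; lra.
rewrite rsum_S Rmult_plus_distr_l exp_plus.
set G := exp (4 * rsum _ y) in IH *.
have HG : 0 < G by exact: exp_pos.
have Hx : 1 <= INR (S y) by apply: INR_ge1; lia.
have Hl := ln_ge0 _ Hx.
rewrite !eprod_S; case: (Nat.leb 1 y && chi y (S y))%bool; last first.
  have : 1 <= exp (4 * exp (- (1 + 1) * ln (INR (S y)))).
    by rewrite -{1}exp_0; apply: exp_le; have := exp_pos (- (1 + 1) * ln (INR (S y))); lra.
  nra.
rewrite !Cmod_mult.
set x := INR (S y) in Hx Hl *; set r := exp (- (1 + eta) * ln x).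
have Er : forall b, Cmod (cpow x (1 + (eta, b))) = r by move=> b; rewrite Cmod_cpow.
have ER : forall b, Re (cpow x (1 + (eta, b))) = r * cos (b * ln x).
  move=> b; rewrite /cpow /cexp /= /r; congr (exp _ * _); first ring.
  by rewrite -cos_neg; congr cos; ring.
have B : forall b, Cmod (1 - cpow x (1 + (eta, b)))%C <= exp (- (r * cos (b * ln x)) + r ^ 2 / 2).
  by move=> b; rewrite -ER -(Er b); exact: Cmod_one_minus.
have Hr : 0 < r by exact: exp_pos.
have Hr2 : r ^ 2 <= exp (- (1 + 1) * ln x).
  by rewrite /r /= Rmult_1_r -exp_plus; apply: exp_le; nra.
clearbody r.
have P0 := B 0; have P1 := B t; have P2 := B (2 * t).
rewrite Rmult_0_l cos_0 in P0.
set c := cos (t * ln x) in P1.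
have E2 : cos (2 * t * ln x) = 2 * c ^ 2 - 1.
  by rewrite Rmult_assoc cos_2a_cos /c; ring.
rewrite E2 in P2.
have key : Cmod (1 - cpow x (1 + (eta, 0)))%C ^ 3 * Cmod (1 - cpow x (1 + (eta, t)))%C ^ 4 * Cmod (1 - cpow x (1 + (eta, (2 * t)%R)))%C
   <= exp (4 * exp (- (1 + 1) * ln x)).
  apply: (Rle_trans _ (exp (- (r * 1) + r ^ 2 / 2) ^ 3 * exp (- (r * c) + r ^ 2 / 2) ^ 4 * exp (- (r * (2 * c ^ 2 - 1)) + r ^ 2 / 2))).
    apply: Rmult_le_compat => //; try exact: Cmod_ge_0.
      by apply: Rmult_le_pos; apply: pow_le; exact: Cmod_ge_0.
    apply: Rmult_le_compat; try (by apply: pow_le; exact: Cmod_ge_0).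
    - by apply: pow_incr; split => //; exact: Cmod_ge_0.
    - by apply: pow_incr; split => //; exact: Cmod_ge_0.
  (* [3 + 4 c + (2 c^2 - 1) = 2 (1 + c)^2], and the eight terms [r^2 / 2] add up to [4 r^2]. *)
  rewrite /pow !Rmult_1_r -!exp_plus; apply: exp_le.
  have : 0 <= r * (1 + c) ^ 2 by have := pow2_ge_0 (1 + c); nra.
  move: Hr2; rewrite /pow !Rmult_1_r; lra.
move: IH key.
set a0 := Cmod (eprod y (eta, 0)); set a1 := Cmod (eprod y (eta, t)); set a2 := Cmod (eprod y (eta, 2 * t)).
set b0 := Cmod (1 - _)%C; set b1 := Cmod (1 - _)%C; set b2 := Cmod (1 - _)%C => IH key.
have -> : (a0 * b0) ^ 3 * (a1 * b1) ^ 4 * (a2 * b2) = (a0 ^ 3 * a1 ^ 4 * a2) * (b0 ^ 3 * b1 ^ 4 * b2) by ring.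
apply: Rmult_le_compat => //.
- by apply: Rmult_le_pos; [apply: Rmult_le_pos; apply: pow_le | ]; exact: Cmod_ge_0.
- by apply: Rmult_le_pos; [apply: Rmult_le_pos; apply: pow_le | ]; exact: Cmod_ge_0.
Qed.

(** The exponent 8 is 4 times the bound 2 for the sum of [n^(-2)]; 256 = 2^8 comes from the
    [3 + 4 + 1] factors [|zeta * eprod| >= 1 / 2]. *)
Definition c341 := exp (- 8) / 256.

Lemma zeta_341 (eta t : R) : 0 < eta ->
  c341 <= Cmod (zeta (eta, 0)) ^ 3 * Cmod (zeta (eta, t)) ^ 4 * Cmod (zeta (eta, 2 * t)).
Proof.
move=> He.
(* The length [y] of the Euler product depends on [eta]; it leaves no trace, since the sum in the
   exponent of [eprod_341] is bounded uniformly in [y]. *)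
have [N HN] : exists N, forall n, (N <= n)%nat -> exp (- eta * ln (INR n)) <= eta / 2.
  have H := is_lim_seq_pw eta He; apply is_lim_seq_spec in H.
  have [N HN] := H (mkposreal (eta / 2) ltac:(lra)).
  exists N => n Hn; have := HN n Hn; rewrite /= Rminus_0_r => H2.
  exact: Rle_trans (Rle_abs _) (Rlt_le _ _ H2).
set y := S N.
have half : forall b, 1 / 2 <= Cmod (zeta (eta, b)) * Cmod (eprod y (eta, b)).
  move=> b; rewrite -Cmod_mult.
  have := zeta_eprod y (eta, b) He ltac:(rewrite /y; lia).
  have : exp (- Re (eta, b) * ln (INR y)) / Re (eta, b) <= 1 / 2.
    rewrite -[Re (eta, b)]/eta; apply: (Rmult_le_reg_r eta) => //; rewrite /Rdiv Rmult_assoc Rinv_l; last lra.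
    have := HN y ltac:(rewrite /y; lia); lra.
  have := Cmod_triangle (zeta (eta, b) * eprod y (eta, b))%C (- (zeta (eta, b) * eprod y (eta, b) - 1))%C.
  rewrite Cmod_opp.
  have -> : (zeta (eta, b) * eprod y (eta, b) + - (zeta (eta, b) * eprod y (eta, b) - 1) = 1)%C by ring.
  rewrite Cmod_1; lra.
have E := eprod_341 y eta t He.
have E2 : exp (4 * rsum (fun n => exp (- (1 + 1) * ln (INR n))) y) <= exp 8.
  apply: exp_le; have := pw_sum_le 1 y Rlt_0_1; rewrite Rinv_1; lra.
have H0 := half 0; have H1 := half t; have H2 := half (2 * t).
move: E E2 H0 H1 H2.
set a0 := Cmod (zeta (eta, 0)); set a1 := Cmod (zeta (eta, t)); set a2 := Cmod (zeta (eta, 2 * t)).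
set b0 := Cmod (eprod y (eta, 0)); set b1 := Cmod (eprod y (eta, t)); set b2 := Cmod (eprod y (eta, 2 * t)).
set W := exp _ => E E2 H0 H1 H2.
have A0 : 0 <= a0 by exact: Cmod_ge_0. have A1 : 0 <= a1 by exact: Cmod_ge_0. have A2 : 0 <= a2 by exact: Cmod_ge_0.
have P0 : (1 / 2) ^ 3 <= (a0 * b0) ^ 3 by apply: pow_incr; lra.
have P1 : (1 / 2) ^ 4 <= (a1 * b1) ^ 4 by apply: pow_incr; lra.
have P : (1 / 2) ^ 3 * (1 / 2) ^ 4 * (1 / 2) <= (a0 * b0) ^ 3 * (a1 * b1) ^ 4 * (a2 * b2).
  apply: Rmult_le_compat; try lra; apply: Rmult_le_compat; lra.
have EQ : (a0 * b0) ^ 3 * (a1 * b1) ^ 4 * (a2 * b2) = (a0 ^ 3 * a1 ^ 4 * a2) * (b0 ^ 3 * b1 ^ 4 * b2) by ring.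
rewrite EQ in P.
have A : 0 <= a0 ^ 3 * a1 ^ 4 * a2.
  by apply: Rmult_le_pos => //; apply: Rmult_le_pos; apply: pow_le.
have F : a0 ^ 3 * a1 ^ 4 * a2 * (b0 ^ 3 * b1 ^ 4 * b2) <= a0 ^ 3 * a1 ^ 4 * a2 * exp 8.
  apply: Rmult_le_compat_l => //; lra.
rewrite /c341 exp_Ropp.
have H8 := exp_pos 8.
apply: (Rmult_le_reg_r (exp 8)) => //.
have -> : / exp 8 / 256 * exp 8 = 1 / 256 by field; lra.
have : (1 / 2) ^ 3 * (1 / 2) ^ 4 * (1 / 2) = 1 / 256 by field.
lra.
Qed.

(** The unit in which losses at height [t] are counted. The 5 leaves room for [Re s <= 1] and for
    moving [t] by 1. *)
Definition lt (t : R) : R := ell (5 + Rabs t).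

Lemma lt_ge1 t : 1 <= lt t.
Proof. by apply: ell_ge1; have := Rabs_pos t; lra. Qed.

Lemma ell_double P : 1 <= P -> ell (2 * P) <= 2 * ell P.
Proof.
move=> HP; rewrite /ell ln_mult; try lra.
rewrite Rmult_plus_distr_l exp_plus.
have : exp (theta * ln 2) <= 2.
  rewrite -{2}(exp_ln 2); last lra.
  by apply: exp_le; have := ln_ge0 2 ltac:(lra); rewrite /theta; lra.
have := exp_pos (theta * ln P); nra.
Qed.

Lemma Cmod_le_pair (a b : R) : Cmod (a, b) <= Rabs a + Rabs b.
Proof. exact: Cmod_le_abs (a, b). Qed.

Lemma Cmod_inv_le (s : C) (d : R) : 0 < d -> d <= Cmod s -> Cmod (/ s)%C <= / d.
Proof.
move=> Hd Hs; rewrite Cmod_inv; last by apply Cmod_gt_0; lra.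
by apply: Rinv_le_contravar.
Qed.

(** For [sigma <= t0] and [|t| < t0] this gives [|s zA s| <= 2 t0 * 6 KA = 1 / 2], so
    [s zeta(1 + s)] stays away from 0. For [|t| >= t0] the pole is at distance at least [t0]. *)
Definition t0 := / (24 * KA).

Lemma t0_pos : 0 < t0.
Proof. by apply: Rinv_0_lt_compat; rewrite /KA; lra. Qed.

Lemma Im_le_Cmod (a b : R) : Rabs b <= Cmod (a, b).
Proof. exact: (Rabs_Im_le_Cmod (a, b)). Qed.

(** Constants of [zeta_lower]. In [c1], 8 comes from [(2 / eta)^3] and [18 KA lt t] bounds zeta at
    height [2 t]. [C2] is a Lipschitz constant, with one term for [1 / s] and one for [zA]. [kappa]
    solves [c1 kappa^3 = (2 C2 kappa)^4]: at [eta0 = kappa / lt^5] the lower bound is then twice the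
    Lipschitz loss down to the line. *)
Definition c1 := c341 / (8 * (18 * KA)).
Definition C2 := / t0 ^ 2 + 2 * KA.
Definition kappa := c1 / (16 * C2 ^ 4).
Definition czeta := C2 * kappa.

Lemma C2_ge1 : 1 <= C2.
Proof.
rewrite /C2; have : 0 < / t0 ^ 2 by apply: Rinv_0_lt_compat; have := t0_pos; nra.
rewrite /KA; lra.
Qed.

Lemma c1_bounds : 0 < c1 <= 1.
Proof.
have H8 : 0 < exp (- 8) <= 1.
  split; first exact: exp_pos. by rewrite -exp_0; apply: exp_le; lra.
have -> : c1 = exp (- 8) * / (256 * (8 * (18 * 7200000))) by rewrite /c1 /c341 /KA; field.
have : 0 < / (256 * (8 * (18 * 7200000))) <= 1.
  split; first by apply: Rinv_0_lt_compat; lra.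
  by rewrite -Rinv_1; apply: Rinv_le_contravar; lra.
nra.
Qed.

Lemma kappa_bounds : 0 < kappa <= 1.
Proof.
have H2 : 1 <= C2 ^ 4 by apply: pow_R1_Rle; exact: C2_ge1.
have := c1_bounds => H1; rewrite /kappa; split.
  by apply: Rdiv_lt_0_compat; lra.
apply: (Rmult_le_reg_r (16 * C2 ^ 4)); first lra.
rewrite /Rdiv Rmult_assoc Rinv_l; lra.
Qed.

Lemma czeta_pos : 0 < czeta.
Proof. rewrite /czeta; have := C2_ge1; have := kappa_bounds; nra. Qed.

Lemma zeta_fourth (eta t : R) : 0 < eta <= 1 -> t0 <= Rabs t ->
  c1 * eta ^ 3 / lt t <= Cmod (zeta (eta, t)) ^ 4.
Proof.
move=> He Ht; have Ht0 := t0_pos; have H := zeta_341 eta t (proj1 He).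
have Hl := lt_ge1 t.
have B0 : Cmod (zeta (eta, 0)) <= 2 / eta.
  apply: Rle_trans (zeta_bound (eta, 0) (proj1 He)) _; rewrite [Re _]/=.
  apply: (Rmult_le_reg_r eta); first lra.
  rewrite /Rdiv Rmult_plus_distr_r Rmult_assoc Rinv_l; lra.
have H2t : 2 * t0 <= Cmod (eta, 2 * t).
  apply: Rle_trans (Im_le_Cmod eta (2 * t)); rewrite Rabs_mult (Rabs_pos_eq 2); lra.
have B2 : Cmod (zeta (eta, 2 * t)) <= 18 * KA * lt t.
  rewrite /zeta; apply: Rle_trans (Cmod_triangle _ _) _.
  have := Cmod_inv_le (eta, 2 * t) (2 * t0) ltac:(lra) H2t.
  have := zA_bound (eta, 2 * t) (Re_pos_neq0 (eta, 2 * t) (proj1 He)) (Rlt_le _ _ (proj1 He)).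
  have -> : / (2 * t0) = 12 * KA by rewrite /t0 /KA; field.
  have : ell (1 + Cmod (eta, 2 * t)) <= 2 * lt t.
    apply: Rle_trans (ell_double _ _); last by have := Rabs_pos t; lra.
    apply: ell_le; first by have := Cmod_ge_0 (eta, 2 * t); lra.
    have := Cmod_le_pair eta (2 * t); rewrite Rabs_mult (Rabs_pos_eq 2); last lra.
    rewrite (Rabs_pos_eq eta); lra.
  rewrite /KA; lra.
have HK : 0 < KA by rewrite /KA; lra.
move: H B0 B2; set a0 := Cmod (zeta (eta, 0)); set a1 := Cmod (zeta (eta, t)); set a2 := Cmod (zeta (eta, 2 * t)) => H B0 B2.
have A0 : 0 <= a0 by exact: Cmod_ge_0. have A1 : 0 <= a1 ^ 4 by apply: pow_le; exact: Cmod_ge_0. have A2 : 0 <= a2 by exact: Cmod_ge_0.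
have U : a0 ^ 3 * a1 ^ 4 * a2 <= (2 / eta) ^ 3 * a1 ^ 4 * (18 * KA * lt t).
  apply: Rmult_le_compat => //.
    by apply: Rmult_le_pos => //; apply: pow_le.
  by apply: Rmult_le_compat_r => //; apply: pow_incr.
have He3 : 0 < eta ^ 3 by apply: pow_lt; lra.
have Hpos : 0 < eta ^ 3 / (8 * (18 * KA)) / lt t by apply: Rdiv_lt_0_compat; [apply: Rdiv_lt_0_compat => //; lra | lra].
have : c341 * (eta ^ 3 / (8 * (18 * KA)) / lt t) <= (2 / eta) ^ 3 * a1 ^ 4 * (18 * KA * lt t) * (eta ^ 3 / (8 * (18 * KA)) / lt t).
  apply: Rmult_le_compat_r; lra.
have -> : (2 / eta) ^ 3 * a1 ^ 4 * (18 * KA * lt t) * (eta ^ 3 / (8 * (18 * KA)) / lt t) = a1 ^ 4.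
  field; repeat split; lra.
have -> : c1 * eta ^ 3 / lt t = c341 * (eta ^ 3 / (8 * (18 * KA)) / lt t).
  rewrite /c1; field; lra.
by [].
Qed.

Lemma pow4_le x y : 0 <= x -> 0 <= y -> x ^ 4 <= y ^ 4 -> x <= y.
Proof.
move=> Hx Hy H; apply: Rnot_lt_le => Hlt.
have H2 : y ^ 2 < x ^ 2 by nra.
have : (y ^ 2) ^ 2 < (x ^ 2) ^ 2 by have := pow2_ge_0 y; nra.
have -> : (y ^ 2) ^ 2 = y ^ 4 by ring.
have -> : (x ^ 2) ^ 2 = x ^ 4 by ring.
lra.
Qed.

(** The bound of [zeta_fourth] degenerates as [eta] tends to 0. At [eta0] of order [lt^(-5)] it
    still gives [lt^(-4)], and for smaller [sigma] the Lipschitz bound carries half of this from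
    [eta0] to [sigma]. *)
Lemma zeta_lower (sigma t : R) : 0 < sigma <= 1 -> t0 <= Rabs t ->
  czeta / lt t ^ 4 <= Cmod (zeta (sigma, t)).
Proof.
move=> Hs Ht; have Hl := lt_ge1 t; have [K0 K1] := kappa_bounds; have HC := C2_ge1; have Ht0 := t0_pos.
have Hl4 : 1 <= lt t ^ 4 by apply: pow_R1_Rle.
have Hl5 : 1 <= lt t ^ 5 by apply: pow_R1_Rle.
set eta0 := kappa / lt t ^ 5.
have He0 : 0 < eta0 by apply: Rdiv_lt_0_compat; lra.
have He1 : eta0 <= 1.
  apply: (Rmult_le_reg_r (lt t ^ 5)); first lra.
  rewrite /eta0 /Rdiv Rmult_assoc Rinv_l; lra.
have big : forall eta, eta0 <= eta <= 1 -> 2 * czeta / lt t ^ 4 <= Cmod (zeta (eta, t)).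
  move=> eta He; apply: pow4_le; last 1 first.
  - apply: Rle_trans (zeta_fourth eta t ltac:(lra) Ht).
    have -> : (2 * czeta / lt t ^ 4) ^ 4 = c1 * eta0 ^ 3 / lt t.
      have -> : c1 = kappa * (16 * C2 ^ 4) by rewrite /kappa; field; lra.
      rewrite /czeta /eta0; field; lra.
    apply: Rmult_le_compat_r; first by left; apply: Rinv_0_lt_compat; lra.
    apply: Rmult_le_compat_l; first by have := c1_bounds; lra.
    by apply: pow_incr; lra.
  - have := czeta_pos => Hc; apply: Rdiv_le_0_compat; lra.
  - exact: Cmod_ge_0.
have Hc := czeta_pos.
have Hcl : 0 < czeta / lt t ^ 4 by apply: Rdiv_lt_0_compat; lra.
case: (Rle_dec eta0 sigma) => Hcase.
  have := big sigma ltac:(lra); have -> : 2 * czeta / lt t ^ 4 = 2 * (czeta / lt t ^ 4) by field; lra.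
  lra.
have Hb := big eta0 ltac:(lra).
have -> : czeta / lt t ^ 4 = 2 * czeta / lt t ^ 4 - C2 * eta0 * lt t by rewrite /czeta /eta0; field; lra.
have Hd : Cmod ((eta0, t) - (sigma, t))%C <= eta0.
  have -> : ((eta0, t) - (sigma, t))%C = RtoC (eta0 - sigma) by apply: C_eq => /=; ring.
  by rewrite Cmod_R Rabs_pos_eq; lra.
have N1 : (eta0, t) <> RtoC 0 by apply: Re_pos_neq0.
have N2 : (sigma, t) <> RtoC 0 by apply: Re_pos_neq0 => /=; lra.
have D : Cmod (zeta (eta0, t) - zeta (sigma, t))%C <= C2 * eta0 * lt t.
  have -> : (zeta (eta0, t) - zeta (sigma, t) = - (((eta0, t) - (sigma, t)) * (/ (eta0, t) * / (sigma, t))) + (zA (eta0, t) - zA (sigma, t)))%C.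
    by rewrite /zeta; field.
  apply: Rle_trans (Cmod_triangle _ _) _; rewrite Cmod_opp !Cmod_mult.
  have A := Cmod_inv_le (eta0, t) t0 Ht0 (Rle_trans _ _ _ Ht (Im_le_Cmod _ _)).
  have B := Cmod_inv_le (sigma, t) t0 Ht0 (Rle_trans _ _ _ Ht (Im_le_Cmod _ _)).
  have L := zA_lip _ _ N1 N2 (Rlt_le _ _ He0) (Rlt_le _ _ (proj1 Hs)).
  have Ll : ell (1 + Cmod (eta0, t)) <= lt t.
    apply: ell_le; first by have := Cmod_ge_0 (eta0, t); lra.
    have := Cmod_le_pair eta0 t; rewrite (Rabs_pos_eq eta0); lra.
  have L0 : 1 <= ell (1 + Cmod (eta0, t)) by apply: ell_ge1; have := Cmod_ge_0 (eta0, t); lra.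
  move: A B L Hd L0 Ll (Cmod_ge_0 ((eta0, t) - (sigma, t))%C) (Cmod_ge_0 (/ (eta0, t))%C) (Cmod_ge_0 (/ (sigma, t))%C).
  set z := Cmod (_ - _)%C; set a := Cmod (/ _)%C; set b := Cmod (/ _)%C; set l := ell _; set d := Cmod (_ - _)%C.
  move=> A B L Hd L0 Ll d0 a0 b0.
  have HT : t0 <> 0 by lra.
  have -> : C2 * eta0 * lt t = eta0 * (/ t0 * / t0) * lt t + 2 * KA * eta0 * lt t by rewrite /C2; field; lra.
  have Hi : 0 < / t0 by apply: Rinv_0_lt_compat.
  have X1 : a * b <= / t0 * / t0 by apply: Rmult_le_compat.
  have X2 : d * (a * b) <= eta0 * (/ t0 * / t0) by apply: Rmult_le_compat => //; apply: Rmult_le_pos.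
  have X3 : eta0 * (/ t0 * / t0) <= eta0 * (/ t0 * / t0) * lt t.
    have X0 : 0 <= eta0 * (/ t0 * / t0) by apply: Rmult_le_pos; [lra | apply: Rmult_le_pos; lra].
    by rewrite -{1}(Rmult_1_r (eta0 * _)); apply: Rmult_le_compat_l.
  have X4 : d * l <= eta0 * lt t by apply: Rmult_le_compat; lra.
  have : 0 < KA by rewrite /KA; lra.
  nra.
have := Cmod_triangle (zeta (eta0, t) - zeta (sigma, t))%C (zeta (sigma, t)).
have -> : (zeta (eta0, t) - zeta (sigma, t) + zeta (sigma, t) = zeta (eta0, t))%C by ring.
lra.
Qed.

(** * The transform of the error and its second differences *)

Definition Zf (s : C) : C := (1 + s * zA s)%C.

Lemma Zf_zeta s : s <> RtoC 0 -> Zf s = (s * zeta s)%C.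
Proof. by move=> H; rewrite /Zf /zeta; field. Qed.

(** The two entries belong to the cases [|t| < t0] and [|t| >= t0] of [Zf_lower]. *)
Definition cZ := Rmin (/ 4) (czeta * (t0 / 2)).

Lemma cZ_pos : 0 < cZ.
Proof.
apply: Rmin_glb_lt; first lra.
have := czeta_pos; have := t0_pos; nra.
Qed.

Lemma t0_le1 : t0 <= 1.
Proof. by rewrite /t0 -Rinv_1; apply: Rinv_le_contravar; rewrite /KA; lra. Qed.

Lemma Zf_lower (sigma t : R) : 0 < sigma <= t0 -> cZ * (1 + Rabs t) / lt t ^ 4 <= Cmod (Zf (sigma, t)).
Proof.
move=> Hs; have Ht0 := t0_pos; have Hl := lt_ge1 t; have Hl4 : 1 <= lt t ^ 4 by apply: pow_R1_Rle.
have Ht1 := t0_le1; have HA := Rabs_pos t.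
have Hi : 0 < / lt t ^ 4 <= 1.
  split; first by apply: Rinv_0_lt_compat; lra.
  by rewrite -Rinv_1; apply: Rinv_le_contravar; lra.
have HS : (sigma, t) <> RtoC 0 by apply: Re_pos_neq0 => /=; lra.
case: (Rlt_dec (Rabs t) t0) => Ht.
- have H2 : cZ * (1 + Rabs t) / lt t ^ 4 <= 1 / 2.
    have H1 : cZ <= / 4 by exact: Rmin_l.
    have := cZ_pos => H0; rewrite /Rdiv.
    have : cZ * (1 + Rabs t) <= / 4 * 2 by apply: Rmult_le_compat; lra.
    have : 0 <= cZ * (1 + Rabs t) by nra.
    nra.
  apply: Rle_trans H2 _; rewrite /Zf.
  have B := zA_bound (sigma, t) HS ltac:(rewrite /=; lra).
  have C0 := Cmod_le_pair sigma t; rewrite (Rabs_pos_eq sigma) in C0; last lra.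
  have E1 : ell 1 = 1 by rewrite /ell ln_1 Rmult_0_r exp_0.
  have E2 : ell (1 + Cmod (sigma, t)) <= 2.
    have := ell_double 1 (Rle_refl _); rewrite E1 => H3.
    have : ell (1 + Cmod (sigma, t)) <= ell (2 * 1).
      have H12 : t0 <= 1 / 2 by rewrite /t0 /KA; lra.
      by apply: ell_le; have := Cmod_ge_0 (sigma, t); lra.
    lra.
  have : Cmod ((sigma, t) * zA (sigma, t))%C <= 1 / 2.
    rewrite Cmod_mult.
    apply: (Rle_trans _ (2 * t0 * (3 * KA * 2))).
      apply: Rmult_le_compat; try exact: Cmod_ge_0; try lra.
      apply: Rle_trans B _; apply: Rmult_le_compat_l => //; rewrite /KA; lra.
    rewrite /t0 /KA; lra.
  have := Cmod_triangle (1 + (sigma, t) * zA (sigma, t))%C (- ((sigma, t) * zA (sigma, t)))%C.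
  rewrite Cmod_opp.
  have -> : (1 + (sigma, t) * zA (sigma, t) + - ((sigma, t) * zA (sigma, t)) = 1)%C by ring.
  rewrite Cmod_1; lra.
- rewrite Zf_zeta // Cmod_mult.
  have := zeta_lower sigma t ltac:(lra) ltac:(lra) => H.
  apply: (Rle_trans _ (Rabs t * (czeta / lt t ^ 4))).
    have -> : Rabs t * (czeta / lt t ^ 4) = Rabs t * czeta / lt t ^ 4 by rewrite /Rdiv; ring.
    apply: Rmult_le_compat_r; first lra.
    apply: (Rle_trans _ (czeta * (t0 / 2) * (1 + Rabs t))).
      by apply: Rmult_le_compat_r; [lra | exact: Rmin_r].
    have := czeta_pos; have : t0 / 2 * (1 + Rabs t) <= Rabs t by nra.
    nra.
  apply: Rmult_le_compat => //; last exact: Im_le_Cmod.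
  by have := czeta_pos => Hc; apply: Rdiv_le_0_compat; lra.
Qed.

(** The Laplace transform [1 / (s^2 zeta(1 + s)) - 1 / s] of [smoothed], written with
    [s zeta(1 + s) = 1 + s zA s] so that the powers of [1 / s] cancel. *)
Definition ehat (s : C) : C := (- zA s / Zf s)%C.

(** Arranged so that each term is visibly of second order: a second difference of [zA], or a product
    of two factors that each contain [ih] or a first difference. *)
Lemma ehat_d2_eq (s ih : C) : Zf s <> RtoC 0 -> Zf (s + ih)%C <> RtoC 0 -> Zf (s - ih)%C <> RtoC 0 ->
  let A := zA s in let Ap := zA (s + ih)%C in let Am := zA (s - ih)%C in
  (ehat (s + ih) + ehat (s - ih) - 2 * ehat s)%C =
  (- ((Ap + Am - 2 * A - ih * A * (Ap - Am)) * (/ Zf (s + ih) * / Zf s) +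
      (A - Am - ih * A * Am) * (s * (Am - Ap) - ih * (Am + Ap)) * (/ Zf (s + ih) * / Zf s * / Zf (s - ih))))%C.
Proof.
rewrite /ehat /Zf /=; move: (zA s) (zA (s + ih)%C) (zA (s - ih)%C) => A Ap Am H0 Hp Hm.
field; repeat split => //.
Qed.

(** 32 = 2 * 16 is the cost of using [Zf_lower] at heights within 1 of [t]; 13 and 110 = 11 * 10
    come from the numerators in [ehat_d2_eq], and the final 3 bounds [5^(1/2)]. *)
Definition Kd2 := (13 * KA ^ 2 * (32 / cZ) ^ 2 + 110 * KA ^ 3 * (32 / cZ) ^ 3) * 3.

Lemma Kd2_pos : 0 < Kd2.
Proof.
have H : 0 < 32 / cZ by apply: Rdiv_lt_0_compat; [lra | exact: cZ_pos].
have H2 := pow_lt _ 2 H; have H3 := pow_lt _ 3 H; rewrite /Kd2 /KA; nra.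
Qed.

Lemma ehat_d2 (sigma t h : R) : 0 < sigma <= t0 -> 0 <= h <= 1 ->
  Cmod (ehat (sigma, (t + h)%R) + ehat (sigma, (t - h)%R) - 2 * ehat (sigma, t))%C
    <= Kd2 * h ^ 2 * exp (- (3 / 2) * ln (1 + Rabs t)).
Proof.
move=> Hs Hh; set s : C := (sigma, t); set ih := (Ci * RtoC h)%C.
have Ep : (sigma, t + h) = (s + ih)%C by apply: C_eq => /=; ring.
have Em : (sigma, t - h) = (s - ih)%C by apply: C_eq => /=; ring.
have HA := Rabs_pos t; have Hl := lt_ge1 t; have Ht0 := t0_pos; have Ht1 := t0_le1; have HcZ := cZ_pos.
set l := lt t in Hl *; set y := 1 + Rabs t.
have Hl4 : 1 <= l ^ 4 by apply: pow_R1_Rle.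
set w := cZ / 32 * y / l ^ 4.
have Hw : 0 < w by apply: Rdiv_lt_0_compat; [rewrite /y; nra | lra].
have low : forall t', Rabs (t' - t) <= 1 -> w <= Cmod (Zf (sigma, t')).
  move=> t' Ht'; apply: Rle_trans (Zf_lower sigma t' Hs).
  have A1 : Rabs t' <= Rabs t + 1.
    have := Rabs_triang (t' - t) t; rewrite (_ : t' - t + t = t'); [lra | ring].
  have A2 : Rabs t <= Rabs t' + 1.
    have := Rabs_triang (t - t') t'; rewrite (_ : t - t' + t' = t); [rewrite Rabs_minus_sym; lra | ring].
  have L1 : lt t' <= 2 * l.
    apply: Rle_trans (ell_double _ _); last lra.
    by apply: ell_le; have := Rabs_pos t'; lra.
  have L0 := lt_ge1 t'.
  have L4 : lt t' ^ 4 <= 16 * l ^ 4.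
    have -> : 16 * l ^ 4 = (2 * l) ^ 4 by ring.
    by apply: pow_incr; lra.
  have L40 : 1 <= lt t' ^ 4 by apply: pow_R1_Rle.
  have -> : w = cZ * (y / 2) * / (16 * l ^ 4) by rewrite /w; field; lra.
  apply: Rmult_le_compat.
  - rewrite /y; nra.
  - by left; apply: Rinv_0_lt_compat; lra.
  - by apply: Rmult_le_compat_l; rewrite /y; have := Rabs_pos t'; lra.
  - by apply: Rinv_le_contravar; lra.
have Z0 := low t ltac:(rewrite Rminus_diag Rabs_R0; lra).
have Zp := low (t + h) ltac:(rewrite Rabs_pos_eq; lra).
have Zm := low (t - h) ltac:(rewrite Rabs_left1; lra).
have Ns : s <> RtoC 0 by apply: Re_pos_neq0 => /=; lra.
have Np : (s + ih)%C <> RtoC 0 by rewrite -Ep; apply: Re_pos_neq0 => /=; lra.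
have Nm : (s - ih)%C <> RtoC 0 by rewrite -Em; apply: Re_pos_neq0 => /=; lra.
have Rs : 0 <= Re s by rewrite /=; lra.
have Rp : 0 <= Re (s + ih)%C by rewrite -Ep /=; lra.
have Rm : 0 <= Re (s - ih)%C by rewrite -Em /=; lra.
rewrite Ep Em in Zp Zm *.
have lb : forall t', Rabs t' <= Rabs t + 1 -> ell (1 + Cmod (sigma, t')) <= l.
  move=> t' Ht'; apply: ell_le; first by have := Cmod_ge_0 (sigma, t'); lra.
  have := Cmod_le_pair sigma t'; rewrite (Rabs_pos_eq sigma); lra.
have l0 := lb t ltac:(lra).
have lp := lb (t + h) ltac:(apply: Rle_trans (Rabs_triang _ _) _; rewrite (Rabs_pos_eq h); lra).
have lm := lb (t - h) ltac:(apply: Rle_trans (Rabs_triang _ _) _; rewrite Rabs_Ropp (Rabs_pos_eq h); lra).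
rewrite Ep in lp; rewrite Em in lm; rewrite -/s in l0.
have B0 := zA_bound s Ns Rs; have Bp := zA_bound _ Np Rp; have Bm := zA_bound _ Nm Rm.
have D0 := zA_lip s (s - ih)%C Ns Nm Rs Rm.
have Dp := zA_lip s (s + ih)%C Ns Np Rs Rp.
have D2 := zA_d2 s h Ns Np Nm Rs (proj1 Hh); rewrite -/ih in D2.
have Eh : Cmod ih = h by apply: Cmod_Ih; lra.
have E1 : (s - (s - ih) = ih)%C by ring.
have E2 : (s - (s + ih) = - ih)%C by ring.
rewrite E1 Eh in D0; rewrite E2 Cmod_opp Eh in Dp.
have Nz : forall z, w <= Cmod z -> z <> RtoC 0 by move=> z Hz; apply Cmod_gt_0; lra.
rewrite (ehat_d2_eq s ih (Nz _ Z0) (Nz _ Zp) (Nz _ Zm)) Cmod_opp.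
have I0 := Cmod_inv_le _ _ Hw Z0; have Ip := Cmod_inv_le _ _ Hw Zp; have Im := Cmod_inv_le _ _ Hw Zm.
have Es : Cmod s <= y.
  by apply: Rle_trans (Cmod_le_pair _ _) _; rewrite Rabs_pos_eq /y; lra.
move: B0 Bp Bm D0 Dp D2 I0 Ip Im.
set A := zA s; set Ap := zA (s + ih); set Am := zA (s - ih).
set i0 := Cmod (/ Zf s)%C; set ip := Cmod (/ Zf (s + ih))%C; set im := Cmod (/ Zf (s - ih))%C.
move=> B0 Bp Bm D0 Dp D2 I0 Ip Im.
have HK : 1 <= KA by rewrite /KA; lra.
have bnd : forall a b c, 0 <= c -> b <= l -> a <= c * b -> a <= c * l.
  by move=> a b c Hc Hb Ha; apply: Rle_trans Ha _; apply: Rmult_le_compat_l.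
have {}B0 := bnd _ _ (3 * KA) ltac:(lra) l0 B0. have {}Bp := bnd _ _ (3 * KA) ltac:(lra) lp Bp. have {}Bm := bnd _ _ (3 * KA) ltac:(lra) lm Bm.
have {}D0 := bnd _ _ (2 * KA * h) ltac:(nra) l0 D0. have {}Dp := bnd _ _ (2 * KA * h) ltac:(nra) l0 Dp.
have {}D2 := bnd _ _ (KA * h ^ 2) ltac:(nra) l0 D2.
have P0 := Cmod_ge_0 A; have Pp := Cmod_ge_0 Ap; have Pm := Cmod_ge_0 Am.
have Dpm : Cmod (Ap - Am)%C <= 4 * KA * h * l.
  have -> : (Ap - Am = - (A - Ap) + (A - Am))%C by ring.
  apply: Rle_trans (Cmod_triangle _ _) _; rewrite Cmod_opp; lra.
have Dmp : Cmod (Am - Ap)%C <= 4 * KA * h * l.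
  by have -> : (Am - Ap = - (Ap - Am))%C; [ring | rewrite Cmod_opp].
have ll : l <= l ^ 2 by nra.
have KK : KA <= KA ^ 2 by nra.
have F1 : Cmod (Ap + Am - 2 * A - ih * A * (Ap - Am))%C <= 13 * KA ^ 2 * h ^ 2 * l ^ 2.
  apply: Rle_trans (Cmod_triangle _ _) _; rewrite Cmod_opp (Cmod_mult (ih * A)) (Cmod_mult ih) Eh.
  have X : h * Cmod A * Cmod (Ap - Am)%C <= h * (3 * KA * l) * (4 * KA * h * l).
    apply: Rmult_le_compat => //; [nra | exact: Cmod_ge_0 | apply: Rmult_le_compat_l; lra].
  have : KA * h ^ 2 * l <= KA ^ 2 * h ^ 2 * l ^ 2.
    apply: Rmult_le_compat; try nra.
  nra.
have F2 : Cmod (A - Am - ih * A * Am)%C <= 11 * KA ^ 2 * h * l ^ 2.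
  apply: Rle_trans (Cmod_triangle _ _) _; rewrite Cmod_opp (Cmod_mult (ih * A)) (Cmod_mult ih) Eh.
  have X : h * Cmod A * Cmod Am <= h * (3 * KA * l) * (3 * KA * l).
    apply: Rmult_le_compat => //; [nra | apply: Rmult_le_compat_l; lra].
  have : KA * h * l <= KA ^ 2 * h * l ^ 2.
    apply: Rmult_le_compat; nra.
  nra.
have Hy : 1 <= y by rewrite /y; lra.
have F3 : Cmod (s * (Am - Ap) - ih * (Am + Ap))%C <= 10 * KA * h * l * y.
  apply: Rle_trans (Cmod_triangle _ _) _; rewrite Cmod_opp (Cmod_mult s) (Cmod_mult ih) Eh.
  have X : Cmod s * Cmod (Am - Ap)%C <= y * (4 * KA * h * l).
    apply: Rmult_le_compat => //; exact: Cmod_ge_0.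
  have X2 : h * Cmod (Am + Ap)%C <= h * (6 * KA * l).
    by apply: Rmult_le_compat_l; [lra | apply: Rle_trans (Cmod_triangle _ _) _; lra].
  have X3 : h * (6 * KA * l) <= h * (6 * KA * l) * y.
    have : 0 <= h * (6 * KA * l) by apply: Rmult_le_pos; nra.
    nra.
  lra.
have Hwi : 0 < / w by apply: Rinv_0_lt_compat.
have i00 : 0 <= i0 by exact: Cmod_ge_0. have ip0 : 0 <= ip by exact: Cmod_ge_0. have im0 : 0 <= im by exact: Cmod_ge_0.
have J2 : ip * i0 <= / w * / w by apply: Rmult_le_compat.
have J3 : ip * i0 * im <= / w * / w * / w by apply: Rmult_le_compat => //; apply: Rmult_le_pos.
have G : Cmod ((Ap + Am - 2 * A - ih * A * (Ap - Am)) * (/ Zf (s + ih) * / Zf s) +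
   (A - Am - ih * A * Am) * (s * (Am - Ap) - ih * (Am + Ap)) * (/ Zf (s + ih) * / Zf s * / Zf (s - ih)))%C
   <= 13 * KA ^ 2 * h ^ 2 * l ^ 2 * (/ w * / w) + (11 * KA ^ 2 * h * l ^ 2) * (10 * KA * h * l * y) * (/ w * / w * / w).
  apply: Rle_trans (Cmod_triangle _ _) _; rewrite (Cmod_mult (_ - _ - _)) (Cmod_mult (_ * _)) (Cmod_mult (_ - _ - _)) (Cmod_mult (_ * _) (/ Zf (s - ih))) (Cmod_mult (/ _)).
  apply: Rplus_le_compat.
    by apply: Rmult_le_compat => //; [exact: Cmod_ge_0 | apply: Rmult_le_pos].
  apply: Rmult_le_compat => //.
  - by apply: Rmult_le_pos; exact: Cmod_ge_0.
  - by apply: Rmult_le_pos => //; apply: Rmult_le_pos.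
  - by apply: Rmult_le_compat => //; exact: Cmod_ge_0.
apply: Rle_trans G _.
set c := 32 / cZ.
have Hc0 : 0 < c by apply: Rdiv_lt_0_compat; lra.
have Ewi : / w = c * l ^ 4 / y by rewrite /w /c; field; repeat split; lra.
(* [15 theta = 1 / 2]; this fixes the value of [theta]. *)
have E15 : l ^ 15 <= 3 * exp (1 / 2 * ln y).
  have -> : l ^ 15 = exp (1 / 2 * ln (5 + Rabs t)).
    rewrite /l /lt /ell; set q := theta * _.
    have -> : 1 / 2 * ln (5 + Rabs t) = INR 15 * q by rewrite /q /theta /=; lra.
    elim: (15%nat) => [|k IH]; first by rewrite /= Rmult_0_l exp_0.
    by rewrite S_INR Rmult_plus_distr_r exp_plus -IH Rmult_1_l /=; ring.
  have H5 : exp (1 / 2 * ln 5) <= 3.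
    have H9 : exp (1 / 2 * ln 9) = 3.
      have -> : 9 = 3 * 3 by lra.
      rewrite ln_mult; try lra. have -> : 1 / 2 * (ln 3 + ln 3) = ln 3 by field. apply: exp_ln; lra.
    rewrite -H9; apply: exp_le; have := ln_le 5 9; lra.
  have : ln (5 + Rabs t) <= ln 5 + ln y.
    by rewrite -ln_mult; [apply: ln_le | |]; rewrite /y; lra.
  move=> H; apply: (Rle_trans _ (exp (1 / 2 * ln 5) * exp (1 / 2 * ln y))).
    by rewrite -exp_plus; apply: exp_le; lra.
  by apply: Rmult_le_compat_r => //; left; exact: exp_pos.
have E32 : exp (- (3 / 2) * ln y) = exp (1 / 2 * ln y) / (y * y).
  have -> : - (3 / 2) * ln y = 1 / 2 * ln y + (- ln y + - ln y) by field.
  rewrite !exp_plus !exp_Ropp !exp_ln; last lra. by field; lra.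
have L10 : l ^ 10 <= l ^ 15 by apply: Rle_pow => //; lia.
rewrite E32 Ewi.
have -> : 13 * KA ^ 2 * h ^ 2 * l ^ 2 * (c * l ^ 4 / y * (c * l ^ 4 / y)) +
   11 * KA ^ 2 * h * l ^ 2 * (10 * KA * h * l * y) * (c * l ^ 4 / y * (c * l ^ 4 / y) * (c * l ^ 4 / y)) =
   (13 * KA ^ 2 * c ^ 2 * l ^ 10 + 110 * KA ^ 3 * c ^ 3 * l ^ 15) * (h ^ 2 / (y * y)) by field; lra.
have -> : Kd2 * h ^ 2 * (exp (1 / 2 * ln y) / (y * y)) =
  (13 * KA ^ 2 * c ^ 2 + 110 * KA ^ 3 * c ^ 3) * (3 * exp (1 / 2 * ln y)) * (h ^ 2 / (y * y)) by rewrite /Kd2 -/c; field; lra.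
apply: Rmult_le_compat_r.
  by apply: Rdiv_le_0_compat; nra.
rewrite Rmult_plus_distr_r; apply: Rplus_le_compat.
  apply: Rmult_le_compat_l; last lra. by have := pow_lt _ 2 Hc0; have : 0 < KA ^ 2; nra.
apply: Rmult_le_compat_l => //. have := pow_lt _ 3 Hc0; have : 0 < KA ^ 3 by apply: pow_lt; lra. nra.
Qed.

(** * Fourier inversion with the Fejer kernel *)

Lemma RInt_scalR (f : R -> R) (k a b : R) : ex_RInt f a b -> RInt (fun x => k * f x) a b = k * RInt f a b.
Proof. exact: (RInt_scal (V := R_CompleteNormedModule)). Qed.

Lemma RInt_ChaslesR (f : R -> R) a b c : ex_RInt f a b -> ex_RInt f b c ->
  RInt f a b + RInt f b c = RInt f a c.
Proof. exact: (RInt_Chasles (V := R_CompleteNormedModule)). Qed.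

Lemma RInt_minusR (f g : R -> R) a b : ex_RInt f a b -> ex_RInt g a b ->
  RInt (fun x => f x - g x) a b = RInt f a b - RInt g a b.
Proof. exact: (RInt_minus (V := R_CompleteNormedModule)). Qed.

Lemma RInt_constR k a b : RInt (fun _ => k) a b = k * (b - a).
Proof. by rewrite RInt_const /scal /= /mult /= Rmult_comm. Qed.

Lemma ex_RInt_cont (f : R -> R) a b : (forall x, continuous f x) -> ex_RInt f a b.
Proof. by move=> H; apply: (ex_RInt_continuous (V := R_CompleteNormedModule)). Qed.

Lemma continuous_2d_mult_cos (p q : R -> R) (c : R -> R) x t :
  continuity c -> (forall t, continuous p t) -> (forall t, continuous q t) ->
  continuity_2d_pt (fun y t => p t * c (y * q t)) x t.
Proof.
move=> Hc Hp Hq; apply: continuity_2d_pt_mult.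
  apply: (continuity_1d_2d_pt_comp p (fun _ t => t)); last exact: continuity_2d_pt_id2.
  by apply/continuity_pt_filterlim; exact: Hp.
apply: (continuity_1d_2d_pt_comp c (fun y t => y * q t)); first exact: Hc.
apply: continuity_2d_pt_mult; first exact: continuity_2d_pt_id1.
apply: (continuity_1d_2d_pt_comp q (fun _ t => t)); last exact: continuity_2d_pt_id2.
by apply/continuity_pt_filterlim; exact: Hq.
Qed.

Lemma continuous_cos_comp (q : R -> R) t : continuous q t -> continuous (fun t => cos (q t)) t.
Proof.
move=> H; apply: (continuous_comp q cos) => //.
by apply/continuity_pt_filterlim; exact: continuity_cos.
Qed.

Lemma continuous_pcos (p q : R -> R) y t : (forall t, continuous p t) -> (forall t, continuous q t) ->
  continuous (fun t => p t * cos (y * q t)) t.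
Proof.
move=> Hp Hq; apply: (continuous_mult (K := R_AbsRing) p (fun t => cos (y * q t))) => //.
apply: (continuous_cos_comp (fun t => y * q t)).
by apply: (continuous_mult (K := R_AbsRing) (fun _ => y) q) => //; exact: continuous_const.
Qed.

Lemma ex_RInt_pcos (p q : R -> R) a b y : (forall t, continuous p t) -> (forall t, continuous q t) ->
  ex_RInt (fun t => p t * cos (y * q t)) a b.
Proof.
by move=> Hp Hq; apply: (ex_RInt_continuous (V := R_CompleteNormedModule)) => t _; exact: continuous_pcos.
Qed.

Lemma continuous_RInt_cos (p q : R -> R) a b y :
  (forall t, continuous p t) -> (forall t, continuous q t) ->
  continuous (fun y => RInt (fun t => p t * cos (y * q t)) a b) y.
Proof.
move=> Hp Hq; apply: (ex_derive_continuous (V := R_NormedModule)).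
eexists; apply: (is_derive_RInt_param (fun y t => p t * cos (y * q t))).
- by exists (mkposreal 1 Rlt_0_1) => z _ t _; auto_derive.
- move=> t _; apply: (continuity_2d_pt_ext (fun y t => (- (p t * q t)) * sin (y * q t))).
    move=> z v; symmetry; apply: is_derive_unique; auto_derive => //; ring.
  apply: (continuous_2d_mult_cos (fun t => - (p t * q t)) q sin) => //; first exact: continuity_sin.
  move=> v; apply: (continuous_opp (V := R_NormedModule) (fun t => p t * q t)).
  exact: (continuous_mult (K := R_AbsRing) p q).
- by exists (mkposreal 1 Rlt_0_1) => z _; exact: ex_RInt_pcos.
Qed.

Lemma continuous_minus_l u v : continuous (fun v : R => u - v) v.
Proof. by apply: (ex_derive_continuous (V := R_NormedModule)); auto_derive. Qed.

(** Fubini by differentiation: as functions of the upper limit [T], both sides vanish at 0 and have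
    the same derivative. *)
Lemma RInt_swap_cos (f w : R -> R) u V T :
  (forall v, continuous f v) -> (forall t, continuous w t) ->
  RInt (fun v => f v * RInt (fun t => w t * cos ((u - v) * t)) 0 T) 0 V =
  RInt (fun t => w t * RInt (fun v => f v * cos (t * (u - v))) 0 V) 0 T.
Proof.
move=> Hf Hw.
have Hid : forall t, continuous (fun t : R => t) t by move=> t; exact: continuous_id.
have HJ : forall b v, continuous (fun v => RInt (fun t => w t * cos ((u - v) * t)) 0 b) v.
  move=> b v.
  apply: (continuous_comp (fun v => u - v) (fun y => RInt (fun t => w t * cos (y * t)) 0 b)).
    exact: continuous_minus_l.
  exact: (continuous_RInt_cos w (fun t => t)).
have HG : forall t, continuous (fun t => RInt (fun v => f v * cos (t * (u - v))) 0 V) t.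
  by move=> t; apply: (continuous_RInt_cos f (fun v => u - v)) => // v; exact: continuous_minus_l.
set Phi := fun b => RInt (fun v => f v * RInt (fun t => w t * cos ((u - v) * t)) 0 b) 0 V.
have HPhi : forall b, is_derive Phi b (w b * RInt (fun v => f v * cos (b * (u - v))) 0 V).
  move=> b.
  have HD : forall b v, is_derive (fun b => f v * RInt (fun t => w t * cos ((u - v) * t)) 0 b) b (f v * (w b * cos ((u - v) * b))).
    move=> b' v; apply: (is_derive_scal (fun b => RInt (fun t => w t * cos ((u - v) * t)) 0 b) b' (f v)).
    apply: (is_derive_RInt (fun t => w t * cos ((u - v) * t))).
      exists (mkposreal 1 Rlt_0_1) => z _; apply: RInt_correct; exact: (ex_RInt_pcos w (fun t => t)).
    exact: (continuous_pcos w (fun t => t)).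
  have -> : w b * RInt (fun v => f v * cos (b * (u - v))) 0 V =
     RInt (fun v => Derive (fun b => f v * RInt (fun t => w t * cos ((u - v) * t)) 0 b) b) 0 V.
    rewrite -(RInt_scalR (fun v => f v * cos (b * (u - v)))); last first.
      by apply: (ex_RInt_pcos f (fun v => u - v)) => // v; exact: continuous_minus_l.
    apply: RInt_ext => v _; rewrite (is_derive_unique _ _ _ (HD b v)).
    by rewrite (Rmult_comm (u - v) b) -!Rmult_assoc (Rmult_comm (w b)).
  apply: (is_derive_RInt_param (fun b v => f v * RInt (fun t => w t * cos ((u - v) * t)) 0 b)).
  - by exists (mkposreal 1 Rlt_0_1) => z _ v _; eexists; exact: HD.
  - move=> v _; apply: (continuity_2d_pt_ext (fun b v => w b * (f v * cos (b * (u - v))))).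
      move=> z y; rewrite (is_derive_unique _ _ _ (HD z y)) (Rmult_comm (u - y) z); ring.
    apply: continuity_2d_pt_mult.
      apply: (continuity_1d_2d_pt_comp w (fun b _ => b)); last exact: continuity_2d_pt_id1.
      by apply/continuity_pt_filterlim; exact: Hw.
    apply: (continuous_2d_mult_cos f (fun v => u - v) cos) => //; first exact: continuity_cos.
    exact: continuous_minus_l.
  - exists (mkposreal 1 Rlt_0_1) => z _; apply: (ex_RInt_continuous (V := R_CompleteNormedModule)) => v _.
    exact: (continuous_mult (K := R_AbsRing) f).
have H : is_RInt (fun t => w t * RInt (fun v => f v * cos (t * (u - v))) 0 V) 0 T (minus (Phi T) (Phi 0)).
  apply: is_RInt_derive => t _; first exact: HPhi.
  exact: (continuous_mult (K := R_AbsRing) w).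
rewrite (is_RInt_unique _ _ _ _ H).
have -> : Phi 0 = 0.
  rewrite /Phi (RInt_ext _ (fun _ => 0)).
    by rewrite RInt_constR Rmult_0_l.
  by move=> v _; rewrite RInt_point /zero /= Rmult_0_r.
by rewrite /minus /plus /opp /= Ropp_0 Rplus_0_r.
Qed.

Definition fejer (T y : R) : R := RInt (fun t => (1 - t / T) * cos (y * t)) 0 T.

Lemma continuous_fejer_weight T t : T <> 0 -> continuous (fun t => 1 - t / T) t.
Proof. by move=> HT; apply: (ex_derive_continuous (V := R_NormedModule)); auto_derive. Qed.

Lemma fejer_formula T y : 0 < T -> y <> 0 -> fejer T y = (1 - cos (y * T)) / (T * y ^ 2).
Proof.
move=> HT Hy; apply: is_RInt_unique.
have -> : (1 - cos (y * T)) / (T * y ^ 2) =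
  minus ((1 - T / T) * sin (y * T) / y - cos (y * T) / (T * y ^ 2)) ((1 - 0 / T) * sin (y * 0) / y - cos (y * 0) / (T * y ^ 2)).
  rewrite /minus /plus /opp /= Rmult_0_r sin_0 cos_0; field; lra.
apply: (is_RInt_derive (fun t => (1 - t / T) * sin (y * t) / y - cos (y * t) / (T * y ^ 2))) => t _.
  auto_derive; first by repeat split; lra. field; lra.
apply: (continuous_pcos (fun t => 1 - t / T) (fun t => t)) => v; [apply: continuous_fejer_weight; lra | exact: continuous_id].
Qed.

Lemma RInt_fejer_weight T : 0 < T -> RInt (fun t => (1 - t / T) / 2) 0 T = T / 4.
Proof.
move=> HT; apply: is_RInt_unique.
have -> : T / 4 = minus (T / 2 - T ^ 2 / (4 * T)) (0 / 2 - 0 ^ 2 / (4 * T)) by rewrite /minus /plus /opp /=; field; lra.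
apply: (is_RInt_derive (fun t => t / 2 - t ^ 2 / (4 * T))) => t _.
  auto_derive; first lra. field; lra.
by apply: (ex_derive_continuous (V := R_NormedModule)); auto_derive; lra.
Qed.

Lemma fejer_near T y : 0 < T -> Rabs (y * T) <= 1 -> T / 4 <= fejer T y.
Proof.
move=> HT Hy; rewrite -(RInt_fejer_weight T HT); apply: RInt_le; first lra.
- apply: (ex_RInt_continuous (V := R_CompleteNormedModule)) => t _.
  by apply: (ex_derive_continuous (V := R_NormedModule)); auto_derive; lra.
- apply: (ex_RInt_pcos (fun t => 1 - t / T) (fun t => t)) => v; [apply: continuous_fejer_weight; lra | exact: continuous_id].
- move=> t Ht.
  have H1 : 0 <= 1 - t / T.
    have : t / T <= 1 by apply: (Rmult_le_reg_r T) => //; rewrite /Rdiv Rmult_assoc Rinv_l; lra.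
    lra.
  have H2 : / 2 <= cos (y * t).
    have := one_minus_cos (y * t).
    have : (y * t) ^ 2 <= 1.
      rewrite -(pow2_abs (y * t)) Rabs_mult (Rabs_pos_eq t); last lra.
      rewrite Rabs_mult (Rabs_pos_eq T) in Hy; last lra.
      have := Rabs_pos y => H0; have : Rabs y * t <= Rabs y * T by apply: Rmult_le_compat_l; lra.
      have : 0 <= Rabs y * t by nra.
      nra.
    lra.
  by rewrite /Rdiv; apply: Rmult_le_compat_l.
Qed.

Lemma fejer_ge0 T y : 0 < T -> 0 <= fejer T y.
Proof.
move=> HT; case: (Req_dec y 0) => [->|Hy].
  apply: (Rle_trans _ (T / 4)); first lra.
  by apply: fejer_near => //; rewrite Rmult_0_l Rabs_R0; lra.
rewrite fejer_formula //; apply: Rdiv_le_0_compat; first by have := COS_bound (y * T); lra.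
by apply: Rmult_lt_0_compat => //; apply: pow2_gt_0.
Qed.

Lemma fejer_far T y d : 0 < T -> 0 < d -> d <= Rabs y -> fejer T y <= 2 / (T * d ^ 2).
Proof.
move=> HT Hd Hy.
have Hy0 : y <> 0 by move=> H; rewrite H Rabs_R0 in Hy; lra.
rewrite fejer_formula //.
have H2 : d ^ 2 <= y ^ 2 by rewrite -(pow2_abs y); apply: pow_incr; lra.
have Hd2 : 0 < d ^ 2 by apply: pow_lt.
apply: Rmult_le_compat.
- by have := COS_bound (y * T); lra.
- by left; apply: Rinv_0_lt_compat; nra.
- by have := COS_bound (y * T); lra.
- by apply: Rinv_le_contravar; nra.
Qed.

Lemma continuous_fejer_shift T u v : T <> 0 -> continuous (fun v => fejer T (u - v)) v.
Proof.
move=> HT; apply: (continuous_comp (fun v => u - v) (fejer T)); first exact: continuous_minus_l.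
apply: (continuous_RInt_cos (fun t => 1 - t / T) (fun t => t)) => t; [exact: continuous_fejer_weight | exact: continuous_id].
Qed.

(* A pointwise bound on f by the L^1 norm of its Fourier transform. *)
Lemma fejer_inversion (f m g : R -> R) (u d V T M I : R) :
  (forall v, continuous f v) -> (forall v, continuous m v) -> (forall v, continuous g v) ->
  0 < d -> 0 < T -> 1 / T <= d -> d <= u -> u + d <= V ->
  (forall v, 0 <= v <= V -> Rabs (f v) <= m v) -> RInt m 0 V <= M ->
  (forall v, Rabs (v - u) <= d -> Rabs (f v - f u) <= Rabs (f u) / 2) ->
  (forall t, 0 <= t <= T -> Rabs (RInt (fun v => f v * cos (t * (u - v))) 0 V) <= g t) ->
  RInt g 0 T <= I ->
  Rabs (f u) / 4 <= I + 2 / (T * d ^ 2) * M.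
Proof.
move=> Hf Hm Hg Hd HT HTd Hdu HuV Hfm HM Hfu Hfg HI.
set c := 2 / (T * d ^ 2).
have Hc : 0 < c by apply: Rdiv_lt_0_compat; [lra | apply: Rmult_lt_0_compat => //; apply: pow_lt].
have [sg [Hsg Hsg1]] : exists sg, sg * f u = Rabs (f u) /\ Rabs sg <= 1.
  case: (Rle_dec 0 (f u)) => H; [exists 1 | exists (- 1)]; rewrite ?Rabs_Ropp Rabs_R1.
    by rewrite Rabs_pos_eq; lra.
  by rewrite Rabs_left; lra.
have sg_le : forall x, sg * x <= Rabs x /\ - Rabs x <= sg * x.
  move=> x; have : Rabs (sg * x) <= Rabs x.
    by rewrite Rabs_mult; have := Rabs_pos x; nra.
  by move/Rabs_le_between; lra.
have Hw : forall t, continuous (fun t => 1 - t / T) t by move=> t; apply: continuous_fejer_weight; lra.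
have HK : forall v, continuous (fun v => f v * fejer T (u - v)) v.
  by move=> v; apply: (continuous_mult (K := R_AbsRing) f) => //; apply: continuous_fejer_shift; lra.
have exK : forall a b, ex_RInt (fun v => sg * (f v * fejer T (u - v))) a b.
  move=> a b; apply: (ex_RInt_continuous (V := R_CompleteNormedModule)) => v _.
  by apply: (continuous_mult (K := R_AbsRing) (fun _ => sg)) => //; exact: continuous_const.
have exm : forall a b, ex_RInt (fun v => c * m v) a b.
  move=> a b; apply: (ex_RInt_continuous (V := R_CompleteNormedModule)) => v _.
  by apply: (continuous_mult (K := R_AbsRing) (fun _ => c)) => //; exact: continuous_const.
have exM : forall k a b, ex_RInt (fun v => k - c * m v) a b.
  move=> k a b; apply: (ex_RInt_minus (V := R_NormedModule) (fun _ => k)) => //; exact: ex_RInt_const.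
have Hup : Rabs (RInt (fun v => f v * fejer T (u - v)) 0 V) <= I.
  rewrite (RInt_swap_cos f (fun t => 1 - t / T) u V T Hf Hw).
  apply: Rle_trans HI.
  have HG : forall t, continuous (fun t => (1 - t / T) * RInt (fun v => f v * cos (t * (u - v))) 0 V) t.
    move=> t; apply: (continuous_mult (K := R_AbsRing) (fun t => 1 - t / T)) => //.
    by apply: (continuous_RInt_cos f (fun v => u - v)) => // v; exact: continuous_minus_l.
  apply: Rle_trans (abs_RInt_le _ _ _ _ _) _; first lra.
    by apply: (ex_RInt_continuous (V := R_CompleteNormedModule)) => t _.
  apply: RInt_le; first lra.
  - apply: (ex_RInt_continuous (V := R_CompleteNormedModule)) => t _.
    by apply: (continuous_comp _ Rabs) => //; exact: continuous_Rabs.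
  - by apply: (ex_RInt_continuous (V := R_CompleteNormedModule)) => t _.
  move=> t Ht; rewrite Rabs_mult.
  have H1 : 0 <= t / T <= 1.
    split; first by apply: Rdiv_le_0_compat; lra.
    by apply: (Rmult_le_reg_r T) => //; rewrite /Rdiv Rmult_assoc Rinv_l; lra.
  rewrite (Rabs_pos_eq (1 - t / T)); last lra.
  have := Hfg t ltac:(lra).
  have := Rabs_pos (RInt (fun v => f v * cos (t * (u - v))) 0 V); nra.
(* Within [d] of [u] the integrand has the sign of [f u], the kernel being nonnegative; farther away
   the kernel is at most [c], so no more than [c * m v] is lost. *)
have lo : forall v, 0 <= v <= V -> 0 - c * m v <= sg * (f v * fejer T (u - v)).
  move=> v Hv; have HK0 := fejer_ge0 T (u - v) HT.
  have Hmv := Hfm v Hv; have Hfv := Rabs_pos (f v).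
  rewrite -Rmult_assoc; case: (Rle_dec (Rabs (v - u)) d) => Hvu.
    have [A B] := sg_le (f v - f u).
    have := Hfu v Hvu; have := Rabs_pos (f u); have : 0 <= c * m v by nra.
    have : 0 <= sg * f v -> 0 <= sg * f v * fejer T (u - v) by move=> H; apply: Rmult_le_pos.
    lra.
  have K1 : fejer T (u - v) <= c by apply: fejer_far => //; rewrite Rabs_minus_sym; lra.
  have [A B] := sg_le (f v); nra.
(* On this window of length [2 / T] the kernel is at least [T / 4] and [f] keeps half of [f u],
   which contributes [|f u| / 4] up to the same loss. *)
have mid : forall v, u - 1 / T <= v <= u + 1 / T -> Rabs (f u) * T / 8 - c * m v <= sg * (f v * fejer T (u - v)).
  move=> v Hv.
  have Hv1 : Rabs (v - u) <= 1 / T by apply: Rabs_le; lra.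
  have K1 : T / 4 <= fejer T (u - v).
    apply: fejer_near => //; rewrite Rabs_mult (Rabs_pos_eq T); last lra.
    rewrite Rabs_minus_sym; have := Rmult_le_compat_r T _ _ (Rlt_le _ _ HT) Hv1.
    have -> : 1 / T * T = 1 by field; lra. by [].
  have [A B] := sg_le (f v - f u).
  have := Hfu v ltac:(lra); have Hp := Rabs_pos (f u).
  have Hmv : 0 <= c * m v.
    have Hv2 : 0 <= v <= V by lra.
    by have := Hfm v Hv2; have := Rabs_pos (f v); nra.
  move=> H; have : Rabs (f u) / 2 <= sg * f v by lra.
  rewrite -Rmult_assoc => H2; have : Rabs (f u) / 2 * (T / 4) <= sg * f v * fejer T (u - v).
    by apply: Rmult_le_compat; lra.
  lra.
have HT1 : 0 < 1 / T by apply: Rdiv_lt_0_compat; lra.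
have Hlow : Rabs (f u) / 4 - c * M <= RInt (fun v => sg * (f v * fejer T (u - v))) 0 V.
  rewrite -(RInt_ChaslesR _ 0 (u - 1 / T) V) //.
  rewrite -(RInt_ChaslesR _ (u - 1 / T) (u + 1 / T) V) //.
  have L1 : RInt (fun v => 0 - c * m v) 0 (u - 1 / T) <= RInt (fun v => sg * (f v * fejer T (u - v))) 0 (u - 1 / T).
    by apply: RInt_le => //; [lra | move=> v Hv; apply: lo; lra].
  have L2 : RInt (fun v => Rabs (f u) * T / 8 - c * m v) (u - 1 / T) (u + 1 / T) <= RInt (fun v => sg * (f v * fejer T (u - v))) (u - 1 / T) (u + 1 / T).
    by apply: RInt_le => //; [lra | move=> v Hv; apply: mid; lra].
  have L3 : RInt (fun v => 0 - c * m v) (u + 1 / T) V <= RInt (fun v => sg * (f v * fejer T (u - v))) (u + 1 / T) V.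
    by apply: RInt_le => //; [lra | move=> v Hv; apply: lo; lra].
  have E : forall k a b, RInt (fun v => k - c * m v) a b = k * (b - a) - RInt (fun v => c * m v) a b.
    by move=> k a b; rewrite (RInt_minusR (fun _ => k)) ?RInt_constR //; exact: ex_RInt_const.
  rewrite !E in L1 L2 L3.
  have S : RInt (fun v => c * m v) 0 (u - 1 / T) + (RInt (fun v => c * m v) (u - 1 / T) (u + 1 / T) + RInt (fun v => c * m v) (u + 1 / T) V) = c * RInt m 0 V.
    rewrite -(RInt_scalR m); last exact: ex_RInt_cont.
    by rewrite -(RInt_ChaslesR (fun v => c * m v) 0 (u - 1 / T) V) // -(RInt_ChaslesR _ (u - 1 / T) (u + 1 / T) V).
  have E4 : Rabs (f u) * T / 8 * (u + 1 / T - (u - 1 / T)) = Rabs (f u) / 4 by field; lra.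
  rewrite E4 in L2.
  have : c * RInt m 0 V <= c * M by apply: Rmult_le_compat_l; lra.
  lra.
have : RInt (fun v => sg * (f v * fejer T (u - v))) 0 V = sg * RInt (fun v => f v * fejer T (u - v)) 0 V.
  by apply: RInt_scalR; exact: ex_RInt_cont.
have [A _] := sg_le (RInt (fun v => f v * fejer T (u - v)) 0 V).
rewrite -/c; lra.
Qed.

(** * Laplace transforms of smoothed Moebius sums *)

(** All that the analysis uses of the Moebius function: the trivial bound, and, in summed form, that
    its Dirichlet convolution with 1 is the unit. *)
Definition mobius_like (mu : nat -> R) : Prop :=
  (forall n, Rabs (mu n) <= 1) /\
  (forall (f : nat -> R) N, (1 <= N)%nat ->
    rsum (fun n => mu n * rsum (fun k => f (n * k)%nat) (N / n)) N = f 1%nat).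

Definition Fsum (mu : nat -> R) (s : C) (N : nat) : C :=
  csum (fun n => RtoC (mu n) * cpow (INR n) (1 + s))%C N.

Lemma Fsum_conv mu s N : mobius_like mu -> (1 <= N)%nat ->
  csum (fun n => RtoC (mu n) * cpow (INR n) (1 + s) * zsum s (N / n))%C N = RtoC 1.
Proof.
move=> [_ H] HN.
have E : csum (fun n => RtoC (mu n) * cpow (INR n) (1 + s) * zsum s (N / n))%C N =
  csum (fun n => RtoC (mu n) * csum (fun k => cpow (INR (n * k)) (1 + s)) (N / n))%C N.
  apply: csum_ext => n Hn; rewrite -Cmult_assoc; congr (_ * _)%C.
  rewrite /zsum -csum_scal; apply: csum_ext => k Hk.
  by rewrite mult_INR cpow_mult //; apply: lt_0_INR; lia.
rewrite E csum_scal_RtoC.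
rewrite (rsum_ext _ (fun n => mu n * rsum (fun k => Re (cpow (INR (n * k)) (1 + s))) (N / n))); last first.
  by move=> n _; rewrite Re_csum.
rewrite (rsum_ext (fun n => mu n * Im _) (fun n => mu n * rsum (fun k => Im (cpow (INR (n * k)) (1 + s))) (N / n))); last first.
  by move=> n _; rewrite Im_csum.
rewrite (H (fun m => Re (cpow (INR m) (1 + s))) N HN) (H (fun m => Im (cpow (INR m) (1 + s))) N HN).
by rewrite [INR 1]/= cpow_1_l.
Qed.

Lemma harmonic_le N : (1 <= N)%nat -> rsum (fun n => / INR n) N <= 1 + ln (INR N).
Proof.
elim=> [|m Hm IH]; first by rewrite /= ln_1; lra.
rewrite rsum_S; have Hm1 := INR_ge1 m Hm.
have : / INR (S m) <= ln (INR (S m)) - ln (INR m); last lra.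
rewrite S_INR.
have := exp_ineq1_le (ln (INR m) - ln (INR m + 1)).
rewrite exp_plus exp_Ropp !exp_ln; try lra.
have -> : INR m * / (INR m + 1) = 1 - / (INR m + 1) by field; lra.
lra.
Qed.

(** By [Fsum_conv] the difference is the sum of [mu(n) n^(-1-s)] times the zeta tail beyond [N / n].
    Each term is of order [N^(-Re s) / n], so the harmonic sum gives the logarithm; the 2 allows for
    the rounding in [N <= 2 n (N / n)]. *)
Lemma Fsum_zeta mu s N : mobius_like mu -> 0 < Re s <= 1 -> (1 <= N)%nat ->
  Cmod (Fsum mu s N * zeta s - 1)%C <= 2 / Re s * exp (- Re s * ln (INR N)) * (1 + ln (INR N)).
Proof.
move=> Hmu Hs HN.
have -> : (Fsum mu s N * zeta s - 1 = csum (fun n => RtoC (mu n) * cpow (INR n) (1 + s) * (zeta s - zsum s (N / n)))%C N)%C.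
  have -> : (Fsum mu s N * zeta s - 1 = zeta s * Fsum mu s N +
    (- (1)) * csum (fun n => RtoC (mu n) * cpow (INR n) (1 + s) * zsum s (N / n))%C N)%C by rewrite Fsum_conv //; ring.
  rewrite /Fsum -!csum_scal -csum_plus; apply: csum_ext => n _; ring.
have HN1 := INR_ge1 N HN; have Hl := ln_ge0 _ HN1.
apply: (Rle_trans _ (rsum (fun n => (2 / Re s * exp (- Re s * ln (INR N))) * / INR n) N)); last first.
  rewrite rsum_scal; apply: Rmult_le_compat_l; last exact: harmonic_le.
  by apply: Rmult_le_pos; [apply: Rdiv_le_0_compat; lra | left; exact: exp_pos].
apply: Cmod_csum => n Hn; rewrite !Cmod_mult Cmod_R.
have Hn1 := INR_ge1 n (proj1 Hn).
set k := (N / n)%nat.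
have Hk : (1 <= k)%nat by apply: Nat.div_le_lower_bound; lia.
have Hk1 := INR_ge1 k Hk.
have T := zeta_tail s k (proj1 Hs) Hk.
have HNk : INR N <= 2 * (INR n * INR k).
  rewrite -mult_INR -[2]/(INR 2) -mult_INR; apply: le_INR.
  have := Nat.div_mod_eq N n; have := Nat.mod_upper_bound N n ltac:(lia); rewrite -/k; nia.
have E1 : Cmod (cpow (INR n) (1 + s)) = / INR n * exp (- Re s * ln (INR n)).
  rewrite Cmod_term -{2}(exp_ln (INR n)); last lra. rewrite -exp_Ropp -exp_plus; congr exp; ring.
rewrite E1.
have E2 : exp (- Re s * ln (INR n)) * exp (- Re s * ln (INR k)) <= 2 * exp (- Re s * ln (INR N)).
  rewrite -{1}(exp_ln 2); last lra. rewrite -!exp_plus; apply: exp_le.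
  have : ln (INR N) <= ln 2 + (ln (INR n) + ln (INR k)).
    rewrite -(ln_mult (INR n) (INR k)); try lra. rewrite -ln_mult; try nra. apply: ln_le; lra.
  have := ln_ge0 2 ltac:(lra); nra.
have Hi : 0 < / INR n by apply: Rinv_0_lt_compat; lra.
have Hsi : 0 < / Re s by apply: Rinv_0_lt_compat; lra.
have Hmun := proj1 Hmu n; have Hm0 := Rabs_pos (mu n).
have P1 := exp_pos (- Re s * ln (INR n)).
apply: (Rle_trans _ (1 * (/ INR n * exp (- Re s * ln (INR n))) * (exp (- Re s * ln (INR k)) / Re s))).
  apply: Rmult_le_compat => //.
  - by apply: Rmult_le_pos => //; apply: Rmult_le_pos; lra.
  - exact: Cmod_ge_0.
  - apply: Rmult_le_compat_r => //; apply: Rmult_le_pos; lra.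
have -> : 1 * (/ INR n * exp (- Re s * ln (INR n))) * (exp (- Re s * ln (INR k)) / Re s) =
  (exp (- Re s * ln (INR n)) * exp (- Re s * ln (INR k))) * (/ Re s * / INR n) by rewrite /Rdiv; ring.
have -> : 2 / Re s * exp (- Re s * ln (INR N)) * / INR n = 2 * exp (- Re s * ln (INR N)) * (/ Re s * / INR n) by rewrite /Rdiv; ring.
by apply: Rmult_le_compat_r => //; nra.
Qed.

(** The Laplace transform of [phi] at [s], cut off at [V]. *)
Definition Cint (phi : R -> R) (s : C) (V : R) : C :=
  (RInt (fun v => phi v * Re (cexp (- s * RtoC v)%C)) 0 V, RInt (fun v => phi v * Im (cexp (- s * RtoC v)%C)) 0 V).

Lemma continuous_Re_cexp s v : continuous (fun v : R => Re (cexp (- s * RtoC v)%C)) v.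
Proof.
case: s => a b; apply: (ex_derive_continuous (V := R_NormedModule)); rewrite /cexp /=.
by auto_derive.
Qed.

Lemma continuous_Im_cexp s v : continuous (fun v : R => Im (cexp (- s * RtoC v)%C)) v.
Proof.
case: s => a b; apply: (ex_derive_continuous (V := R_NormedModule)); rewrite /cexp /=.
by auto_derive.
Qed.

Lemma continuous_phi_Re phi s v : (forall v, continuous phi v) -> continuous (fun v => phi v * Re (cexp (- s * RtoC v)%C)) v.
Proof. move=> H; apply: (continuous_mult (K := R_AbsRing) phi) => //; exact: continuous_Re_cexp. Qed.

Lemma continuous_phi_Im phi s v : (forall v, continuous phi v) -> continuous (fun v => phi v * Im (cexp (- s * RtoC v)%C)) v.
Proof. move=> H; apply: (continuous_mult (K := R_AbsRing) phi) => //; exact: continuous_Im_cexp. Qed.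

Lemma RInt_plusR (f g : R -> R) a b : ex_RInt f a b -> ex_RInt g a b ->
  RInt (fun x => f x + g x) a b = RInt f a b + RInt g a b.
Proof. exact: (RInt_plus (V := R_CompleteNormedModule)). Qed.

Lemma Cint_plus phi psi s V : (forall v, continuous phi v) -> (forall v, continuous psi v) ->
  Cint (fun v => phi v + psi v) s V = (Cint phi s V + Cint psi s V)%C.
Proof.
move=> H1 H2; apply: C_eq => /=; rewrite -RInt_plusR;
  try (by apply: ex_RInt_cont => v; apply: continuous_phi_Re);
  try (by apply: ex_RInt_cont => v; apply: continuous_phi_Im);
  apply: RInt_ext => v _; exact: Rmult_plus_distr_r.
Qed.

Lemma Cint_scal k phi s V : (forall v, continuous phi v) ->
  Cint (fun v => k * phi v) s V = (RtoC k * Cint phi s V)%C.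
Proof.
move=> H.
have E1 : RInt (fun v => k * phi v * Re (cexp (- s * RtoC v)%C)) 0 V = k * RInt (fun v => phi v * Re (cexp (- s * RtoC v)%C)) 0 V.
  rewrite -RInt_scalR; last by apply: ex_RInt_cont => v; apply: continuous_phi_Re.
  by apply: RInt_ext => v _; exact: Rmult_assoc.
have E2 : RInt (fun v => k * phi v * Im (cexp (- s * RtoC v)%C)) 0 V = k * RInt (fun v => phi v * Im (cexp (- s * RtoC v)%C)) 0 V.
  rewrite -RInt_scalR; last by apply: ex_RInt_cont => v; apply: continuous_phi_Im.
  by apply: RInt_ext => v _; exact: Rmult_assoc.
by rewrite /Cint E1 E2; apply: C_eq => /=; ring.
Qed.

Lemma Im_scal_r (z : C) (r : R) : Im (z * RtoC r)%C = Im z * r.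
Proof. case: z => a b /=; ring. Qed.

Lemma is_RInt_cexp_lin (s : C) (a b c : R) : s <> RtoC 0 ->
  let G v := (cexp (- s * RtoC v) * (- / s * RtoC v + (RtoC c * / s - / s * / s)))%C in
  is_RInt (fun v => (v - c) * Re (cexp (- s * RtoC v)%C)) a b (Re (G b) - Re (G a)) /\
  is_RInt (fun v => (v - c) * Im (cexp (- s * RtoC v)%C)) a b (Im (G b) - Im (G a)).
Proof.
move=> Hs G.
have E : forall v : R, (- s * (- / s * RtoC v + (RtoC c * / s - / s * / s)) + - / s)%C = RtoC (v - c).
  move=> v; rewrite RtoC_minus; field => //.
split.
- apply: (is_RInt_derive (fun v => Re (G v))) => v _.
    have := is_derive_Re_cexp_lin s (- / s) (RtoC c * / s - / s * / s)%C v; rewrite E.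
    by rewrite re_scal_r Rmult_comm.
  by apply: continuous_phi_Re => w; apply: (ex_derive_continuous (V := R_NormedModule)); auto_derive.
- apply: (is_RInt_derive (fun v => Im (G v))) => v _.
    have := is_derive_Im_cexp_lin s (- / s) (RtoC c * / s - / s * / s)%C v; rewrite E.
    by rewrite Im_scal_r Rmult_comm.
  by apply: continuous_phi_Im => w; apply: (ex_derive_continuous (V := R_NormedModule)); auto_derive.
Qed.

Lemma continuous_ramp a v : continuous (fun v => Rmax 0 (v - a)) v.
Proof.
have E : forall v, Rmax 0 (v - a) = (v - a + Rabs (v - a)) / 2.
  move=> w; rewrite /Rmax; case: Rle_dec => H; [rewrite Rabs_pos_eq | rewrite Rabs_left]; lra.
apply: (continuous_ext (fun v => / 2 * ((v - a) + Rabs (v - a)))).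
  by move=> w; rewrite E /Rdiv Rmult_comm.
have Hm : continuous (fun v : R => v - a) v by apply: (ex_derive_continuous (V := R_NormedModule)); auto_derive.
apply: (continuous_mult (K := R_AbsRing) (fun _ => / 2)); first exact: continuous_const.
apply: (continuous_plus (V := R_NormedModule) (fun v => v - a)) => //.
by apply: (continuous_comp (fun v => v - a) Rabs) => //; exact: continuous_Rabs.
Qed.

Lemma Cint_ramp (s : C) (a V : R) : s <> RtoC 0 -> 0 <= a <= V ->
  Cint (fun v => Rmax 0 (v - a)) s V =
  (cexp (- s * RtoC a) * (/ s * / s) - cexp (- s * RtoC V) * (RtoC (V - a) * / s + / s * / s))%C.
Proof.
move=> Hs Ha; have [H1 H2] := is_RInt_cexp_lin s a V a Hs.
have E0 : RInt (fun v => Rmax 0 (v - a) * Re (cexp (- s * RtoC v)%C)) 0 V = RInt (fun v => (v - a) * Re (cexp (- s * RtoC v)%C)) a V.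
  rewrite -(RInt_ChaslesR _ 0 a V); try (by apply: ex_RInt_cont => v; apply: continuous_phi_Re => w; exact: continuous_ramp).
  rewrite (RInt_ext _ (fun _ => 0)); last first.
    move=> v; rewrite Rmin_left ?(Rmax_right 0 a); try lra. by move=> Hv; rewrite Rmax_left; lra.
  rewrite RInt_constR Rmult_0_l Rplus_0_l; apply: RInt_ext => v.
  by rewrite Rmin_left ?(Rmax_right a V); try lra; move=> Hv; rewrite Rmax_right; lra.
have E1 : RInt (fun v => Rmax 0 (v - a) * Im (cexp (- s * RtoC v)%C)) 0 V = RInt (fun v => (v - a) * Im (cexp (- s * RtoC v)%C)) a V.
  rewrite -(RInt_ChaslesR _ 0 a V); try (by apply: ex_RInt_cont => v; apply: continuous_phi_Im => w; exact: continuous_ramp).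
  rewrite (RInt_ext _ (fun _ => 0)); last first.
    move=> v; rewrite Rmin_left ?(Rmax_right 0 a); try lra. by move=> Hv; rewrite Rmax_left; lra.
  rewrite RInt_constR Rmult_0_l Rplus_0_l; apply: RInt_ext => v.
  by rewrite Rmin_left ?(Rmax_right a V); try lra; move=> Hv; rewrite Rmax_right; lra.
rewrite /Cint E0 E1 (is_RInt_unique _ _ _ _ H1) (is_RInt_unique _ _ _ _ H2).
set G := fun v : R => (cexp (- s * RtoC v) * (- / s * RtoC v + (RtoC a * / s - / s * / s)))%C.
have -> : (Re (G V) - Re (G a), Im (G V) - Im (G a)) = (G V - G a)%C by [].
rewrite /G RtoC_minus; ring.
Qed.

Lemma Cint_one (s : C) (V : R) : s <> RtoC 0 ->
  Cint (fun _ => 1) s V = ((1 - cexp (- s * RtoC V)) * / s)%C.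
Proof.
move=> Hs.
set G := fun v : R => (cexp (- s * RtoC v) * (0 * RtoC v + - / s))%C.
have E : forall v : R, (- s * (0 * RtoC v + - / s) + 0)%C = RtoC 1 by move=> v; field.
have H1 : is_RInt (fun v => 1 * Re (cexp (- s * RtoC v)%C)) 0 V (Re (G V) - Re (G 0)).
  apply: (is_RInt_derive (fun v => Re (G v))) => v _.
    by have := is_derive_Re_cexp_lin s 0 (- / s)%C v; rewrite E Cmult_1_r Rmult_1_l.
  by apply: continuous_phi_Re => w; exact: continuous_const.
have H2 : is_RInt (fun v => 1 * Im (cexp (- s * RtoC v)%C)) 0 V (Im (G V) - Im (G 0)).
  apply: (is_RInt_derive (fun v => Im (G v))) => v _.
    by have := is_derive_Im_cexp_lin s 0 (- / s)%C v; rewrite E Cmult_1_r Rmult_1_l.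
  by apply: continuous_phi_Im => w; exact: continuous_const.
rewrite /Cint (is_RInt_unique _ _ _ _ H1) (is_RInt_unique _ _ _ _ H2).
have -> : (Re (G V) - Re (G 0), Im (G V) - Im (G 0)) = (G V - G 0)%C by [].
have E0 : (- s * 0 = 0)%C by ring.
rewrite /G E0 cexp_0; ring.
Qed.

(** [G_1(e^v) - 1] for [v <= ln N]. Ramps, in place of indicators of [n <= e^v], make the function
    continuous and give its transform one more factor [1 / s]. *)
Definition smoothed (mu : nat -> R) (N : nat) (v : R) : R :=
  rsum (fun n => mu n / INR n * Rmax 0 (v - ln (INR n))) N - 1.

Lemma continuous_rsum (f : nat -> R -> R) N v : (forall n v, continuous (f n) v) ->
  continuous (fun v => rsum (fun n => f n v) N) v.
Proof.
move=> H; elim: N => [|N IH] /=; first exact: continuous_const.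
by apply: (continuous_plus (V := R_NormedModule) (fun v => rsum (fun n => f n v) N)).
Qed.

Lemma continuous_smoothed_sum mu N v :
  continuous (fun v => rsum (fun n => mu n / INR n * Rmax 0 (v - ln (INR n))) N) v.
Proof.
apply: (continuous_rsum (fun n v => mu n / INR n * Rmax 0 (v - ln (INR n)))) => n w.
apply: (continuous_mult (K := R_AbsRing) (fun _ => mu n / INR n)); [exact: continuous_const | exact: continuous_ramp].
Qed.

Lemma continuous_smoothed mu N v : continuous (smoothed mu N) v.
Proof.
apply: (continuous_minus (V := R_NormedModule) _ (fun _ => 1)); [exact: continuous_smoothed_sum | exact: continuous_const].
Qed.

Lemma Cint_rsum (c : nat -> R) (f : nat -> R -> R) s V N : (forall n v, continuous (f n) v) ->
  Cint (fun v => rsum (fun n => c n * f n v) N) s V = csum (fun n => RtoC (c n) * Cint (f n) s V)%C N.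
Proof.
move=> H; elim: N => [|N IH].
  rewrite /Cint /=; rewrite !(RInt_ext _ (fun _ => 0)) ?RInt_constR ?Rmult_0_l //; move=> v _; exact: Rmult_0_l.
have Hc : forall n v, continuous (fun v => c n * f n v) v.
  by move=> n v; apply: (continuous_mult (K := R_AbsRing) (fun _ => c n)) => //; exact: continuous_const.
rewrite csum_S -IH -Cint_scal // -Cint_plus //.
by move=> v; exact: (continuous_rsum (fun n v => c n * f n v)).
Qed.

(** A ramp has transform [n^(-s) / s^2] up to a boundary term at [V], and all boundary terms carry
    the factor [exp(- V Re s)]. *)
Lemma Cint_smoothed mu s N : mobius_like mu -> 0 < Re s <= 1 -> (1 <= N)%nat ->
  let V := ln (INR N) in
  Cmod (Cint (smoothed mu N) s V - (Fsum mu s N * (/ s * / s) - / s))%C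
    <= 3 / Re s ^ 2 * exp (- Re s * V) * (1 + V) ^ 2.
Proof.
move=> Hmu Hs HN V; have Hs0 := Re_pos_neq0 s (proj1 Hs).
have HV : 0 <= V by apply/ln_ge0/INR_ge1.
have E1 : Cint (smoothed mu N) s V =
  (csum (fun n => RtoC (mu n / INR n) * (cexp (- s * RtoC (ln (INR n))) * (/ s * / s) - cexp (- s * RtoC V) * (RtoC (V - ln (INR n)) * / s + / s * / s))) N
   - (1 - cexp (- s * RtoC V)) * / s)%C.
  have E v : smoothed mu N v = rsum (fun n => mu n / INR n * Rmax 0 (v - ln (INR n))) N + (- 1) * 1 by rewrite /smoothed; ring.
  have -> : Cint (smoothed mu N) s V = Cint (fun v => rsum (fun n => mu n / INR n * Rmax 0 (v - ln (INR n))) N + (- 1) * 1) s V.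
    by rewrite /Cint; congr (_, _); apply: RInt_ext => v _; rewrite E.
  rewrite (Cint_plus _ (fun _ => - 1 * 1)); [ | by move=> v; exact: continuous_smoothed_sum | by move=> v; exact: continuous_const].
  rewrite (Cint_scal (- 1) (fun _ => 1)); last by move=> v; exact: continuous_const.
  rewrite Cint_one // Cint_rsum; last by move=> n v; exact: continuous_ramp.
  have -> : RtoC (- 1) = (- (1))%C by rewrite -RtoC_opp.
  rewrite (csum_ext _ (fun n => RtoC (mu n / INR n) * (cexp (- s * RtoC (ln (INR n))) * (/ s * / s) - cexp (- s * RtoC V) * (RtoC (V - ln (INR n)) * / s + / s * / s)))%C); first ring.
  move=> n Hn; rewrite Cint_ramp //.
  have Hn1 := INR_ge1 n (proj1 Hn); split; first exact: ln_ge0.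
  by apply: ln_le; [lra | apply: le_INR; lia].
rewrite E1.
set b := fun n => (RtoC (mu n / INR n) * (RtoC (V - ln (INR n)) * / s + / s * / s))%C.
have -> : (csum (fun n => RtoC (mu n / INR n) * (cexp (- s * RtoC (ln (INR n))) * (/ s * / s) - cexp (- s * RtoC V) * (RtoC (V - ln (INR n)) * / s + / s * / s))) N
   - (1 - cexp (- s * RtoC V)) * / s - (Fsum mu s N * (/ s * / s) - / s) = cexp (- s * RtoC V) * (/ s - csum b N))%C.
  have -> : csum (fun n => RtoC (mu n / INR n) * (cexp (- s * RtoC (ln (INR n))) * (/ s * / s) - cexp (- s * RtoC V) * (RtoC (V - ln (INR n)) * / s + / s * / s)))%C N =
    ((/ s * / s) * Fsum mu s N + (- cexp (- s * RtoC V)) * csum b N)%C.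
    rewrite /Fsum -!csum_scal -csum_plus; apply: csum_ext => n Hn.
    rewrite cpow_S; last by apply: INR_ge1; lia.
    rewrite /b /cpow /Rdiv RtoC_mult; ring.
  ring.
rewrite Cmod_mult Cmod_cexp.
have -> : Re (- s * RtoC V)%C = - Re s * V by case: (s) => p q /=; ring.
have HI : Cmod (/ s)%C <= / Re s.
  by apply: Cmod_inv_le; [lra | apply: Rle_trans (re_le_Cmod s); rewrite Rabs_pos_eq; lra].
have HR1 : 1 <= / Re s by rewrite -Rinv_1; apply: Rinv_le_contravar; lra.
have HI0 := Cmod_ge_0 (/ s)%C.
set r := / Re s in HI HR1 *.
have Hb : Cmod (csum b N) <= (V * r + r * r) * (1 + V).
  apply: (Rle_trans _ (rsum (fun n => (V * r + r * r) * / INR n) N)); last first.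
    by rewrite rsum_scal; apply: Rmult_le_compat_l; [nra | exact: harmonic_le].
  apply: Cmod_csum => n Hn; rewrite /b Cmod_mult Cmod_R.
  have Hn1 := INR_ge1 n (proj1 Hn).
  have Hi : 0 < / INR n by apply: Rinv_0_lt_compat; lra.
  have B1 : Rabs (mu n / INR n) <= / INR n.
    rewrite /Rdiv Rabs_mult (Rabs_pos_eq (/ INR n)); last lra.
    by have := proj1 Hmu n; nra.
  have Hln := ln_ge0 _ Hn1.
  have HlV : ln (INR n) <= V by apply: ln_le; [lra | apply: le_INR; lia].
  have B2 : Cmod (RtoC (V - ln (INR n)) * / s + / s * / s)%C <= V * r + r * r.
    apply: Rle_trans (Cmod_triangle _ _) _; rewrite !Cmod_mult Cmod_R Rabs_pos_eq; last lra.
    by apply: Rplus_le_compat; apply: Rmult_le_compat; lra.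
  rewrite Rmult_comm; apply: Rmult_le_compat => //; [exact: Cmod_ge_0 | exact: Rabs_pos].
have Hd : Cmod (/ s - csum b N)%C <= 3 * r ^ 2 * (1 + V) ^ 2.
  apply: Rle_trans (Cmod_triangle _ _) _; rewrite Cmod_opp.
  have r2 : r <= r ^ 2 by nra.
  have : (V * r + r * r) * (1 + V) <= 2 * r ^ 2 * (1 + V) ^ 2.
    have : V * r + r * r <= 2 * r ^ 2 * (1 + V) by nra.
    nra.
  have : r <= r ^ 2 * (1 + V) ^ 2 by nra.
  nra.
have -> : 3 / Re s ^ 2 * exp (- Re s * V) * (1 + V) ^ 2 = exp (- Re s * V) * (3 * r ^ 2 * (1 + V) ^ 2) by rewrite /r; field; lra.
by apply: Rmult_le_compat_l => //; left; exact: exp_pos.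
Qed.

(** [4 theta <= 1], so the factor [1 + |t|] in [Zf_lower] outweighs the loss [lt^4]. *)
Lemma inv_Zf_bound (sigma t : R) : 0 < sigma <= t0 -> Cmod (/ Zf (sigma, t))%C <= 5 / cZ.
Proof.
move=> Hs; have Hc := cZ_pos; have Hl := lt_ge1 t; have HA := Rabs_pos t.
have L4 : lt t ^ 4 <= 5 * (1 + Rabs t).
  apply: (Rle_trans _ (5 + Rabs t)); last lra.
  rewrite -{1}(exp_ln (5 + Rabs t)); last lra.
  have -> : lt t ^ 4 = exp (4 * theta * ln (5 + Rabs t)).
    rewrite /lt /ell; set q := theta * _.
    have -> : 4 * theta * ln (5 + Rabs t) = q + (q + (q + q)) by rewrite /q; ring.
    rewrite !exp_plus; ring.
  apply: exp_le; have := ln_ge0 (5 + Rabs t) ltac:(lra); rewrite /theta; lra.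
have Hl4 : 1 <= lt t ^ 4 by apply: pow_R1_Rle.
apply: Rle_trans (Cmod_inv_le _ (cZ / 5) _ _) _; first lra; last by right; field; lra.
apply: Rle_trans (Zf_lower sigma t Hs).
apply: (Rmult_le_reg_r (lt t ^ 4)); first lra.
have -> : cZ * (1 + Rabs t) / lt t ^ 4 * lt t ^ 4 = cZ * (1 + Rabs t) by field; lra.
have : cZ / 5 * lt t ^ 4 <= cZ / 5 * (5 * (1 + Rabs t)) by apply: Rmult_le_compat_l; lra.
lra.
Qed.

Definition Kint (sigma : R) := (3 / sigma ^ 2 + 2 / sigma * (/ sigma * (5 / cZ))) * (1 + 4 / sigma) ^ 2.

(** Half of the exponent absorbs [(1 + V)^2]. [Kint] blows up as [sigma] tends to 0, but [sigma] is
    kept fixed while [N] tends to infinity. *)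
Lemma Cint_ehat mu sigma t N : mobius_like mu -> 0 < sigma <= t0 -> (1 <= N)%nat ->
  let V := ln (INR N) in
  Cmod (Cint (smoothed mu N) (sigma, t) V - ehat (sigma, t))%C <= Kint sigma * exp (- (sigma / 2) * V).
Proof.
move=> Hmu Hs HN V; have Ht1 := t0_le1; have Hs1 : 0 < Re (sigma, t) <= 1 by rewrite /=; lra.
have HV : 0 <= V by apply/ln_ge0/INR_ge1.
set s : C := (sigma, t) in Hs1 *; have Hs0 := Re_pos_neq0 s (proj1 Hs1).
have HZ : Zf s <> RtoC 0.
  have := Zf_lower sigma t Hs => H H0; rewrite -/s H0 Cmod_0 in H.
  have := cZ_pos => Hc; have Hl := lt_ge1 t; have Hl4 : 1 <= lt t ^ 4 by apply: pow_R1_Rle.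
  have : 0 < cZ * (1 + Rabs t) / lt t ^ 4; last lra.
  by apply: Rdiv_lt_0_compat; [have := Rabs_pos t; nra | lra].
have B1 := Cint_smoothed mu s N Hmu Hs1 HN.
have B2 := Fsum_zeta mu s N Hmu Hs1 HN.
rewrite -/V -[Re s]/sigma in B1 B2.
have E : (Cint (smoothed mu N) s V - ehat s = (Cint (smoothed mu N) s V - (Fsum mu s N * (/ s * / s) - / s)) +
  (Fsum mu s N * zeta s - 1) * (/ s * / Zf s))%C.
  have HZ' := HZ; rewrite Zf_zeta // in HZ'.
  have Hz : zeta s <> RtoC 0 by move=> H; apply: HZ'; rewrite H; ring.
  have EA : zA s = (zeta s - / s)%C by rewrite /zeta; ring.
  rewrite /ehat Zf_zeta // EA; field => //.
rewrite E; apply: Rle_trans (Cmod_triangle _ _) _; rewrite !(Cmod_mult (_ - 1)) (Cmod_mult (/ s)).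
have I1 : Cmod (/ s)%C <= / sigma.
  by apply: Cmod_inv_le; [lra | apply: Rle_trans (re_le_Cmod s); rewrite /= Rabs_pos_eq; lra].
have I2 := inv_Zf_bound sigma t Hs; rewrite -/s in I2.
have I3 : Cmod (/ s)%C * Cmod (/ Zf s)%C <= / sigma * (5 / cZ) by apply: Rmult_le_compat => //; exact: Cmod_ge_0.
have Hsi : 0 < / sigma by apply: Rinv_0_lt_compat; lra.
have H5c : 0 < 5 / cZ by apply: Rdiv_lt_0_compat; [lra | exact: cZ_pos].
have E0 := exp_pos (- sigma * V).
have H2s : 0 < 2 / sigma by apply: Rdiv_lt_0_compat; lra.
have P : Cmod (Fsum mu s N * zeta s - 1)%C * (Cmod (/ s)%C * Cmod (/ Zf s)%C) <=
   (2 / sigma * exp (- sigma * V) * (1 + V) ^ 2) * (/ sigma * (5 / cZ)).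
  apply: Rmult_le_compat => //; first exact: Cmod_ge_0.
    by apply: Rmult_le_pos; exact: Cmod_ge_0.
  apply: Rle_trans B2 _; apply: Rmult_le_compat_l; first nra. nra.
have HVb : (1 + V) ^ 2 * exp (- sigma * V) <= (1 + 4 / sigma) ^ 2 * exp (- (sigma / 2) * V).
  have HV1 : V <= / (sigma / 4) * exp (sigma / 4 * V).
    by apply: ln_le_exp; [lra | exact: INR_ge1].
  have -> : exp (- sigma * V) = exp (- (sigma / 2) * V) * exp (- (sigma / 4) * V) * exp (- (sigma / 4) * V).
    by rewrite -!exp_plus; congr exp; field.
  set e4 := exp (- (sigma / 4) * V).
  have He4 : 0 < e4 <= 1.
    by split; [exact: exp_pos | rewrite -exp_0; apply: exp_le; nra].
  have Ee : exp (sigma / 4 * V) * e4 = 1.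
    by rewrite -exp_plus -exp_0; congr exp; ring.
  have HVe : V * e4 <= 4 / sigma.
    have -> : 4 / sigma = / (sigma / 4) * (exp (sigma / 4 * V) * e4) by rewrite Ee; field; lra.
    by rewrite -Rmult_assoc; apply: Rmult_le_compat_r; lra.
  have H4 : (1 + V) * e4 <= 1 + 4 / sigma by lra.
  have -> : (1 + V) ^ 2 * (exp (- (sigma / 2) * V) * e4 * e4) = ((1 + V) * e4) ^ 2 * exp (- (sigma / 2) * V) by ring.
  apply: Rmult_le_compat_r; first by left; exact: exp_pos.
  by apply: pow_incr; split => //; nra.
rewrite /Kint; set k1 := 3 / sigma ^ 2 in B1 *; set k2 := 2 / sigma * (/ sigma * (5 / cZ)).
have Hk1 : 0 < k1 by apply: Rdiv_lt_0_compat; [lra | apply: pow_lt; lra].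
have Hk2 : 0 < k2 by apply: Rmult_lt_0_compat => //; exact: Rmult_lt_0_compat.
apply: (Rle_trans _ ((k1 + k2) * ((1 + V) ^ 2 * exp (- sigma * V)))).
  have -> : (k1 + k2) * ((1 + V) ^ 2 * exp (- sigma * V)) = k1 * exp (- sigma * V) * (1 + V) ^ 2 +
    (2 / sigma * exp (- sigma * V) * (1 + V) ^ 2) * (/ sigma * (5 / cZ)) by rewrite /k2; ring.
  exact: Rplus_le_compat.
rewrite Rmult_assoc; apply: Rmult_le_compat_l; lra.
Qed.

Lemma smoothed_stable mu N M v : (1 <= N <= M)%nat -> v <= ln (INR N) -> smoothed mu M v = smoothed mu N v.
Proof.
move=> [HN HM] Hv; congr (_ - _); elim: HM => [|m Hm IH] //.
rewrite rsum_S IH Rmax_left; first ring.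
have : ln (INR N) <= ln (INR (S m)); last lra.
by apply: ln_le; [have := INR_ge1 N HN; lra | apply: le_INR; lia].
Qed.

(** Without cancellation in [mu]: a ramp is at most [exp(d (v - ln n)) / d]. Being uniform in [N],
    the bound dominates the twisted error in the inversion; it also settles bounded [v]. *)
Lemma smoothed_crude mu N d v : mobius_like mu -> 0 < d ->
  Rabs (smoothed mu N v) <= 1 + / d * (1 + / d) * exp (d * v).
Proof.
move=> [Hmu _] Hd; rewrite /smoothed; apply: Rle_trans (Rabs_triang _ _) _.
rewrite Rabs_Ropp Rabs_R1 Rplus_comm; apply: Rplus_le_compat_l.
have Hdi : 0 < / d by apply: Rinv_0_lt_compat.
have E0 := exp_pos (d * v).
apply: (Rle_trans _ (rsum (fun n => (/ d * exp (d * v)) * exp (- (1 + d) * ln (INR n))) N)); last first.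
  have -> : / d * (1 + / d) * exp (d * v) = (/ d * exp (d * v)) * (1 + / d) by ring.
  by rewrite rsum_scal; apply: Rmult_le_compat_l; [nra | exact: pw_sum_le].
apply: Rabs_rsum => n Hn; have Hn1 := INR_ge1 n (proj1 Hn).
have Hi : 0 < / INR n by apply: Rinv_0_lt_compat; lra.
have H0 := Rmax_l 0 (v - ln (INR n)).
rewrite Rabs_mult (Rabs_pos_eq (Rmax _ _)) //.
have B1 : Rabs (mu n / INR n) <= / INR n.
  rewrite /Rdiv Rabs_mult (Rabs_pos_eq (/ INR n)); last lra. by have := Hmu n; nra.
have B2 : Rmax 0 (v - ln (INR n)) <= / d * exp (d * (v - ln (INR n))).
  have := exp_pos (d * (v - ln (INR n))) => H.
  apply: Rmax_lub; first nra.
  apply: (Rmult_le_reg_l d) => //; rewrite -Rmult_assoc Rinv_r; last lra.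
  have := exp_ineq1_le (d * (v - ln (INR n))); lra.
have -> : / d * exp (d * v) * exp (- (1 + d) * ln (INR n)) = / INR n * (/ d * exp (d * (v - ln (INR n)))).
  have -> : / INR n = exp (- ln (INR n)) by rewrite exp_Ropp exp_ln; lra.
  rewrite !Rmult_assoc -exp_plus -[exp _ * (/ d * _)]Rmult_assoc (Rmult_comm (exp _)) Rmult_assoc -exp_plus.
  by congr (_ * exp _); ring.
by apply: Rmult_le_compat => //; exact: Rabs_pos.
Qed.

Lemma RInt_cos_Cint phi (sigma a b V : R) : (forall v, continuous phi v) ->
  RInt (fun v => phi v * exp (- sigma * v) * cos (a - b * v)) 0 V = Re (cexp (0, a) * Cint phi (sigma, b) V)%C.
Proof.
move=> H.
have ER v : Re (cexp (- (sigma, b) * RtoC v)%C) = exp (- sigma * v) * cos (b * v).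
  by rewrite /cexp /=; congr (exp _ * _); [ring | rewrite -cos_neg; congr cos; ring].
have EI v : Im (cexp (- (sigma, b) * RtoC v)%C) = - (exp (- sigma * v) * sin (b * v)).
  rewrite /cexp /=; have -> : - sigma * 0 + - b * v = - (b * v) by ring.
  rewrite sin_neg -Ropp_mult_distr_r; congr (- (exp _ * _)); ring.
have -> : Re (cexp (0, a) * Cint phi (sigma, b) V)%C =
  cos a * RInt (fun v => phi v * Re (cexp (- (sigma, b) * RtoC v)%C)) 0 V +
  (- sin a) * RInt (fun v => phi v * Im (cexp (- (sigma, b) * RtoC v)%C)) 0 V.
  by rewrite /Cint /cexp /= exp_0; ring.
have e1 : ex_RInt (fun v => phi v * Re (cexp (- (sigma, b) * RtoC v)%C)) 0 V.
  by apply: ex_RInt_cont => v; exact: continuous_phi_Re.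
have e2 : ex_RInt (fun v => phi v * Im (cexp (- (sigma, b) * RtoC v)%C)) 0 V.
  by apply: ex_RInt_cont => v; exact: continuous_phi_Im.
rewrite -!RInt_scalR // -RInt_plusR; try exact: (ex_RInt_scal (V := R_NormedModule)).
apply: RInt_ext => v _; rewrite ER EI cos_minus.
have -> : forall p q r s x y : R, p * q * (r * x + s * y) = r * (p * (q * x)) + (- s) * (p * (- (q * y))) by move=> *; ring.
by [].
Qed.

(** * The twisted error and its pointwise bound *)

Definition twisted (mu : nat -> R) (N : nat) (sigma h v : R) : R :=
  smoothed mu N v * exp (- sigma * v) * (2 * cos (h * v) - 2).

Lemma continuous_exp_lin sigma v : continuous (fun v => exp (- sigma * v)) v.
Proof. by apply: (ex_derive_continuous (V := R_NormedModule)); auto_derive. Qed.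

Lemma continuous_twisted mu N sigma h v : continuous (twisted mu N sigma h) v.
Proof.
apply: (continuous_mult (K := R_AbsRing) (fun v => smoothed mu N v * exp (- sigma * v))).
  apply: (continuous_mult (K := R_AbsRing) (smoothed mu N)); [exact: continuous_smoothed | exact: continuous_exp_lin].
by apply: (ex_derive_continuous (V := R_NormedModule)); auto_derive.
Qed.

Lemma twisted_transform mu N sigma h t u V :
  RInt (fun v => twisted mu N sigma h v * cos (t * (u - v))) 0 V =
  Re (cexp (0, t * u)%R * (Cint (smoothed mu N) (sigma, t + h)%R V + Cint (smoothed mu N) (sigma, t - h)%R V
      - 2 * Cint (smoothed mu N) (sigma, t) V))%C.
Proof.
have Hc v : continuous (smoothed mu N) v by exact: continuous_smoothed.
have -> : Re (cexp (0, t * u)%R * (Cint (smoothed mu N) (sigma, t + h)%R V + Cint (smoothed mu N) (sigma, t - h)%R V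
      - 2 * Cint (smoothed mu N) (sigma, t) V))%C =
  Re (cexp (0, t * u)%R * Cint (smoothed mu N) (sigma, t + h)%R V)%C +
  (Re (cexp (0, t * u)%R * Cint (smoothed mu N) (sigma, t - h)%R V)%C +
  (- 2) * Re (cexp (0, t * u)%R * Cint (smoothed mu N) (sigma, t) V)%C).
  move: (cexp _) (Cint _ _ _) (Cint _ _ _) (Cint _ _ _) => [a1 a2] [b1 b2] [c1 c2] [d1 d2] /=; ring.
rewrite -!RInt_cos_Cint //.
have ex b : ex_RInt (fun v => smoothed mu N v * exp (- sigma * v) * cos (t * u - b * v)) 0 V.
  apply: ex_RInt_cont => v.
  apply: (continuous_mult (K := R_AbsRing) (fun v => smoothed mu N v * exp (- sigma * v))).
    by apply: (continuous_mult (K := R_AbsRing) (smoothed mu N)) => //; exact: continuous_exp_lin.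
  by apply: (ex_derive_continuous (V := R_NormedModule)); auto_derive.
rewrite -RInt_scalR // -RInt_plusR //; last exact: (ex_RInt_scal (V := R_NormedModule)).
rewrite -RInt_plusR //; last first.
  by apply: (ex_RInt_plus (V := R_NormedModule)) => //; exact: (ex_RInt_scal (V := R_NormedModule)).
apply: RInt_ext => v _; rewrite /twisted.
have -> : t * (u - v) = t * u - t * v by ring.
have -> : t * u - (t + h) * v = (t * u - t * v) - h * v by ring.
have -> : t * u - (t - h) * v = (t * u - t * v) + h * v by ring.
set w := t * u - t * v; clearbody w; rewrite cos_minus cos_plus.
have E : forall e c x y s, e * (2 * y - 2) * c = e * (c * y + s * x) + (e * (c * y - s * x) + (- 2) * (e * c)) by move=> *; ring.
by rewrite (E _ _ (sin (h * v)) _ (sin w)).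
Qed.

Lemma Cmod_cexp_i (a : R) : Cmod (cexp (0, a)) = 1.
Proof. by rewrite Cmod_cexp /= exp_0. Qed.

Lemma twisted_transform_bound mu N sigma h t u : mobius_like mu -> 0 < sigma <= t0 -> 0 <= h <= 1 -> (1 <= N)%nat ->
  let V := ln (INR N) in
  Rabs (RInt (fun v => twisted mu N sigma h v * cos (t * (u - v))) 0 V)
   <= Kd2 * h ^ 2 * exp (- (3 / 2) * ln (1 + Rabs t)) + 4 * (Kint sigma * exp (- (sigma / 2) * V)).
Proof.
move=> Hmu Hs Hh HN V; rewrite twisted_transform.
apply: Rle_trans (re_le_Cmod _) _; rewrite Cmod_mult Cmod_cexp_i Rmult_1_l.
have A := Cint_ehat mu sigma t N Hmu Hs HN.
have Ap := Cint_ehat mu sigma (t + h) N Hmu Hs HN.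
have Am := Cint_ehat mu sigma (t - h) N Hmu Hs HN.
have D := ehat_d2 sigma t h Hs Hh.
move: A Ap Am D; cbv zeta; rewrite -/V; set e := Kint sigma * _.
set X := Cint _ _ _; set Y := Cint _ _ _; set Z := Cint _ _ _.
set x := ehat _; set y := ehat _; set z := ehat _ => A Ap Am D.
have -> : (Y + Z - 2 * X = (Y - y) + (Z - z) + - (2 * (X - x)) + (y + z - 2 * x))%C by ring.
apply: Rle_trans (Cmod_triangle _ _) _.
have := Cmod_triangle ((Y - y) + (Z - z))%C (- (2 * (X - x)))%C.
have := Cmod_triangle (Y - y)%C (Z - z)%C.
rewrite Cmod_opp (Cmod_mult 2) Cmod_R (Rabs_pos_eq 2); lra.
Qed.

Lemma RInt_decay T : 0 <= T -> RInt (fun t => exp (- (3 / 2) * ln (1 + Rabs t))) 0 T <= 2.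
Proof.
move=> HT.
have H : is_RInt (fun t => exp (- (3 / 2) * ln (1 + t))) 0 T
   (minus (- 2 * exp (- (1 / 2) * ln (1 + T))) (- 2 * exp (- (1 / 2) * ln (1 + 0)))).
  apply: (is_RInt_derive (fun t => - 2 * exp (- (1 / 2) * ln (1 + t)))) => t; rewrite Rmin_left // Rmax_right // => Ht.
    auto_derive; first lra.
    have -> : - (3 / 2) * ln (1 + t) = - (1 / 2) * ln (1 + t) + - ln (1 + t) by field.
    rewrite exp_plus exp_Ropp exp_ln; last lra. field; lra.
  by apply: (ex_derive_continuous (V := R_NormedModule)); auto_derive; lra.
rewrite (RInt_ext _ (fun t => exp (- (3 / 2) * ln (1 + t)))); last first.
  by move=> t; rewrite Rmin_left // => Ht; rewrite Rabs_pos_eq //; lra.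
rewrite (is_RInt_unique _ _ _ _ H) /minus /plus /opp /= Rplus_0_r ln_1 Rmult_0_r exp_0.
have := exp_pos (- (1 / 2) * ln (1 + T)); lra.
Qed.

Lemma RInt_exp_decay (B s V : R) : 0 <= B -> 0 < s -> 0 <= V -> RInt (fun v => B * exp (- s * v)) 0 V <= B / s.
Proof.
move=> HB Hs HV.
have H : is_RInt (fun v => B * exp (- s * v)) 0 V (minus (- (B / s) * exp (- s * V)) (- (B / s) * exp (- s * 0))).
  apply: (is_RInt_derive (fun v => - (B / s) * exp (- s * v))) => v _.
    auto_derive => //; field; lra.
  by apply: (ex_derive_continuous (V := R_NormedModule)); auto_derive.
rewrite (is_RInt_unique _ _ _ _ H) /minus /plus /opp /= Rmult_0_r exp_0.
have : 0 <= B / s * exp (- s * V).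
  by apply: Rmult_le_pos; [apply: Rdiv_le_0_compat | left; exact: exp_pos].
lra.
Qed.

Lemma continuous_decay (k : R) t : continuous (fun t => k * exp (- (3 / 2) * ln (1 + Rabs t))) t.
Proof.
apply: (continuous_mult (K := R_AbsRing) (fun _ => k)); first exact: continuous_const.
apply: (continuous_comp Rabs (fun y => exp (- (3 / 2) * ln (1 + y)))); first exact: continuous_Rabs.
by apply: (ex_derive_continuous (V := R_NormedModule)); auto_derive; have := Rabs_pos t; lra.
Qed.

(** The continuity radius, [T] and the tail may depend on [u] and on the value [F] to be bounded,
    because they are fixed before [M] tends to infinity. What survives is
    [F / 4 <= 2 Kd2 h^2 + F / 16], and 32 / 3 <= 11. *)
Lemma twisted_bound mu sigma h u N1 : mobius_like mu -> 0 < sigma <= t0 -> 0 <= h <= 1 -> 0 < u ->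
  (1 <= N1)%nat -> u <= ln (INR N1) ->
  Rabs (twisted mu N1 sigma h u) <= 11 * Kd2 * h ^ 2.
Proof.
move=> Hmu Hs Hh Hu HN1 HuN1; have HK := Kd2_pos.
have Hh2 : 0 <= h ^ 2 by exact: pow2_ge_0.
set F := Rabs _; case: (Req_dec F 0) => HF0; first by rewrite HF0; nra.
have HF : 0 < F by have := Rabs_pos (twisted mu N1 sigma h u); rewrite -/F; lra.
have [K HKN] := INR_unbounded (exp (u + 1)).
set N0 := (K + N1)%nat.
have HN0 : (1 <= N0)%nat by rewrite /N0; lia.
have HN0u : u + 1 <= ln (INR N0).
  rewrite -(ln_exp (u + 1)); apply: ln_le; first exact: exp_pos.
  by have := le_INR K N0 ltac:(rewrite /N0; lia); lra.
(* Terms with [n > N0] vanish up to [u + 1], so the function does not change near [u] while [M]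
   grows. *)
have stab M v : (N0 <= M)%nat -> v <= u + 1 -> twisted mu M sigma h v = twisted mu N0 sigma h v.
  by move=> HM Hv; rewrite /twisted (smoothed_stable mu N0 M) //; lra.
have EF : F = Rabs (twisted mu N0 sigma h u).
  by rewrite /F /twisted (smoothed_stable mu N1 N0) //; rewrite /N0; lia.
have [d [Hd Hdc]] : exists d, 0 < d /\ forall v, Rabs (v - u) <= d -> Rabs (twisted mu N0 sigma h v - twisted mu N0 sigma h u) <= F / 2.
  have := continuous_twisted mu N0 sigma h u => /continuity_pt_filterlim H.
  have [a [Ha Ha2]] := H (F / 2) ltac:(lra).
  exists (a / 2); split; first lra.
  move=> v Hv; case: (Req_dec v u) => [->|Hne]; first by rewrite Rminus_diag Rabs_R0; lra.
  left; apply: (Ha2 v); split; last by rewrite /R_dist /=; rewrite /Rdist; lra.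
  by split => // E; apply: Hne.
set d' := Rmin d (Rmin 1 u).
have Hd' : 0 < d' by do 2?apply: Rmin_glb_lt; lra.
have [Hd'd [Hd'1 Hd'u]] : d' <= d /\ d' <= 1 /\ d' <= u.
  by rewrite /d'; have := Rmin_l d (Rmin 1 u); have := Rmin_r d (Rmin 1 u); have := Rmin_l 1 u; have := Rmin_r 1 u; lra.
set B := 4 * (1 + / (sigma / 2) * (1 + / (sigma / 2))).
have Hsi : 0 < / (sigma / 2) by apply: Rinv_0_lt_compat; lra.
have HB : 0 < B by rewrite /B; nra.
set Mm := B / (sigma / 2).
have HMm : 0 < Mm by apply: Rdiv_lt_0_compat; lra.
have Hd2 : 0 < d' ^ 2 by apply: pow_lt.
(* The first entry puts the kernel's window inside the continuity radius, the second makes the far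
   contribution at most [F / 16]. *)
set T := Rmax (1 / d') (32 * Mm / (F * d' ^ 2)).
have HT1 : 1 / d' <= T by exact: Rmax_l.
have HT2 : 32 * Mm / (F * d' ^ 2) <= T by exact: Rmax_r.
have HT : 0 < T by apply: Rlt_le_trans HT1; apply: Rdiv_lt_0_compat; lra.
have tail : 2 / (T * d' ^ 2) * Mm <= F / 16.
  apply: (Rmult_le_reg_r (T * d' ^ 2)); first nra.
  have -> : 2 / (T * d' ^ 2) * Mm * (T * d' ^ 2) = 2 * Mm by field; lra.
  have -> : F / 16 * (T * d' ^ 2) = T * (F * d' ^ 2) / 16 by field.
  have : 32 * Mm / (F * d' ^ 2) * (F * d' ^ 2) <= T * (F * d' ^ 2) by apply: Rmult_le_compat_r; nra.
  have -> : 32 * Mm / (F * d' ^ 2) * (F * d' ^ 2) = 32 * Mm by field; lra.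
  lra.
have key M : (N0 <= M)%nat -> F / 4 <= (2 * Kd2 * h ^ 2 + F / 16) + (4 * Kint sigma * T) * exp (- (sigma / 2) * ln (INR M)).
  move=> HM; set V := ln (INR M).
  have HV : u + 1 <= V.
    apply: Rle_trans HN0u _; apply: ln_le; [have := INR_ge1 N0 HN0; lra | exact: le_INR].
  set err := 4 * (Kint sigma * exp (- (sigma / 2) * V)).
  have := fejer_inversion (twisted mu M sigma h) (fun v => B * exp (- (sigma / 2) * v))
    (fun t => Kd2 * h ^ 2 * exp (- (3 / 2) * ln (1 + Rabs t)) + err) u d' V T Mm (2 * Kd2 * h ^ 2 + T * err).
  rewrite (stab M u HM ltac:(lra)) -EF => FI.
  have : F / 4 <= 2 * Kd2 * h ^ 2 + T * err + 2 / (T * d' ^ 2) * Mm; last by rewrite /err; lra.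
  apply: FI => //.
  - by move=> v; exact: continuous_twisted.
  - move=> v; apply: (continuous_mult (K := R_AbsRing) (fun _ => B)); [exact: continuous_const | exact: continuous_exp_lin].
  - move=> t; apply: (continuous_plus (V := R_NormedModule) (fun t => Kd2 * h ^ 2 * _)); [exact: continuous_decay | exact: continuous_const].
  - apply: (Rmult_le_reg_r T) => //; have -> : 1 / T * T = 1 by field; lra.
    have := Rmult_le_compat_l d' _ _ (Rlt_le _ _ Hd') HT1.
    have -> : d' * (1 / d') = 1 by field; lra. by [].
  - lra.
  - move=> v Hv; rewrite /twisted.
    have C := smoothed_crude mu M (sigma / 2) v Hmu ltac:(lra).
    rewrite !Rabs_mult (Rabs_pos_eq (exp _)); last by left; exact: exp_pos.
    have B4 : Rabs (2 * cos (h * v) - 2) <= 4 by apply: Rabs_le; have := COS_bound (h * v); lra.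
    have E1 : 1 <= exp (sigma / 2 * v) by rewrite -{1}exp_0; apply: exp_le; nra.
    have E2 : exp (- sigma * v) = exp (- (sigma / 2) * v) * exp (- (sigma / 2) * v) by rewrite -exp_plus; congr exp; field.
    have E3 : exp (sigma / 2 * v) * exp (- (sigma / 2) * v) = 1 by rewrite -exp_plus -exp_0; congr exp; ring.
    have E4 := exp_pos (- (sigma / 2) * v).
    rewrite E2; move: C E1 E3 E4; set e1 := exp (sigma / 2 * v); set e2 := exp (- (sigma / 2) * v) => C E1 E3 E4.
    set k := / (sigma / 2) * (1 + / (sigma / 2)) in C *.
    have Hk : 0 < k by rewrite /k; nra.
    have C2 : Rabs (smoothed mu M v) <= (1 + k) * e1 by nra.
    have S0 := Rabs_pos (smoothed mu M v); have W0 := Rabs_pos (2 * cos (h * v) - 2).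
    apply: (Rle_trans _ ((1 + k) * e1 * (e2 * e2) * 4)).
      apply: Rmult_le_compat => //; first by apply: Rmult_le_pos => //; nra.
      by apply: Rmult_le_compat_r => //; nra.
    have -> : (1 + k) * e1 * (e2 * e2) * 4 = 4 * (1 + k) * e2 * (e1 * e2) by ring.
    by rewrite E3 /B /k; lra.
  - by apply: RInt_exp_decay; lra.
  - move=> v Hv; rewrite (stab M v HM); last by have := Rle_abs (v - u); lra.
    by apply: Hdc; lra.
  - move=> t _; apply: twisted_transform_bound => //; lia.
  - have ec : ex_RInt (fun t => Kd2 * h ^ 2 * exp (- (3 / 2) * ln (1 + Rabs t))) 0 T.
      by apply: ex_RInt_cont => t; exact: continuous_decay.
    rewrite (RInt_plusR (fun t => Kd2 * h ^ 2 * _)) //; last exact: ex_RInt_const.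
    rewrite RInt_constR RInt_scalR.
      have := RInt_decay T (Rlt_le _ _ HT); have : 0 <= Kd2 * h ^ 2 by nra.
      nra.
    apply: (ex_RInt_ext (fun t => 1 * exp (- (3 / 2) * ln (1 + Rabs t)))).
      by move=> t _; rewrite Rmult_1_l.
    by apply: ex_RInt_cont => t; exact: continuous_decay.
have Hlim := is_lim_seq_pw (sigma / 2) ltac:(lra).
have := le_of_vanishing N0 _ (F / 4) _ _ Hlim key.
have : 0 <= Kd2 * h ^ 2 by nra.
lra.
Qed.

(* The prime number theorem in the form sum_{n <= x} mu(n)/n log(x/n) = 1 + O(1 / (1 + log x)^2). *)
Theorem smoothed_bound : exists C, 0 < C /\ forall mu, mobius_like mu ->
  forall N x, (1 <= N)%nat -> 1 <= x <= INR N -> Rabs (smoothed mu N (ln x)) <= C / (1 + ln x) ^ 2.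
Proof.
have Ht0 := t0_pos; have HK := Kd2_pos.
(* From [u0] on, [sigma = 1 / u] is at most [t0], and [h = PI / u] is at most 1 because
   [PI <= 4 <= u0]. *)
set u0 := / t0.
have Hu0 : 4 <= u0 by rewrite /u0 /t0 Rinv_inv /KA; lra.
set C1 := (1 + 2 * exp u0) * (1 + u0) ^ 2.
set C2 := 4 * (9 * (11 * Kd2 * 16)).
have HC1 : 0 < C1 by apply: Rmult_lt_0_compat; [have := exp_pos u0; lra | apply: pow_lt; lra].
exists (C1 + C2); split; first by rewrite /C2; lra.
move=> mu Hmu N x HN Hx; set u := ln x.
have Hu : 0 <= u by apply: ln_ge0; lra.
have H1u : 0 < (1 + u) ^ 2 by apply: pow_lt; lra.
case: (Rlt_dec u u0) => Hc.
- have := smoothed_crude mu N 1 u Hmu Rlt_0_1; rewrite Rinv_1 !Rmult_1_l => H.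
  apply: Rle_trans H _; apply: (Rmult_le_reg_r ((1 + u) ^ 2)) => //.
  have -> : (C1 + C2) / (1 + u) ^ 2 * (1 + u) ^ 2 = C1 + C2 by field; lra.
  have E1 : exp u <= exp u0 by apply: exp_le; lra.
  have P0 := exp_pos u.
  have : (1 + (1 + 1) * exp u) * (1 + u) ^ 2 <= C1.
    apply: Rmult_le_compat; try lra. apply: pow_incr; lra.
  rewrite /C2; lra.
- have Hupos : 0 < u by lra.
  have Hs : 0 < / u <= t0.
    split; first exact: Rinv_0_lt_compat.
    by rewrite -(Rinv_inv t0); apply: Rinv_le_contravar; rewrite -/u0; lra.
  have HPI := PI_4; have HPI0 := PI_RGT_0.
  (* At [u] the twist is then -4, while the damping [exp(- sigma u) = exp(-1)] costs only a
     constant. *)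
  set h := PI / u.
  have Hh : 0 <= h <= 1.
    split; first by apply: Rdiv_le_0_compat; lra.
    by apply: (Rmult_le_reg_r u) => //; rewrite /h /Rdiv Rmult_assoc Rinv_l; lra.
  have HuN : u <= ln (INR N) by apply: ln_le; lra.
  have := twisted_bound mu (/ u) h u N Hmu Hs Hh Hupos HN HuN.
  rewrite /twisted.
  have -> : h * u = PI by rewrite /h; field; lra.
  have -> : - / u * u = - (1) by field; lra.
  rewrite cos_PI !Rabs_mult (Rabs_pos_eq (exp _)); last by left; exact: exp_pos.
  have -> : Rabs (2 * -1 - 2) = 4 by rewrite Rabs_left; lra.
  move=> H.
  have He : / 3 <= exp (- (1)).
    by rewrite exp_Ropp; apply: Rinv_le_contravar; [exact: exp_pos | exact: exp_le_3].
  have S0 := Rabs_pos (smoothed mu N u).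
  have H2 : Rabs (smoothed mu N u) * (4 / 3) <= 11 * Kd2 * h ^ 2.
    by apply: Rle_trans H; rewrite Rmult_assoc; apply: Rmult_le_compat_l; lra.
  have H3 : h ^ 2 * u ^ 2 <= 16.
    have -> : h ^ 2 * u ^ 2 = PI ^ 2 by rewrite /h; field; lra.
    nra.
  apply: (Rmult_le_reg_r ((1 + u) ^ 2)) => //.
  have -> : (C1 + C2) / (1 + u) ^ 2 * (1 + u) ^ 2 = C1 + C2 by field; lra.
  have H4 : (1 + u) ^ 2 <= 4 * u ^ 2 by nra.
  have H5 : Rabs (smoothed mu N u) * (1 + u) ^ 2 <= (11 * Kd2 * h ^ 2) * (4 * u ^ 2).
    by apply: Rmult_le_compat => //; lra.
  have : 11 * Kd2 * (h ^ 2 * u ^ 2) <= 11 * Kd2 * 16 by apply: Rmult_le_compat_l; lra.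
  rewrite /C2; nra.
Qed.

End Zeta.

From HB Require Import structures.
From mathcomp Require Import all_boot all_order all_algebra.
From mathcomp Require Import all_classical all_reals all_analysis.
From mathcomp Require Import Rstruct Rstruct_topology.
From mathcomp Require Import measurable_realfun ring lra zify.
Import numFieldNormedType.Exports.
Import Order.TTheory GRing.Theory Num.Theory.
Set Implicit Arguments.
Unset Strict Implicit.
Unset Printing Implicit Defensive.
Local Open Scope classical_set_scope.
Local Open Scope ring_scope.

(** * The bilinear form with logarithmic weights *)

Lemma sum_multiples (G : nat -> R) d M : (0 < d)%N ->
  \sum_(1 <= n < M.+1 | (d %| n)%N) G n = \sum_(1 <= k < (M %/ d).+1) G (d * k)%N.
Proof.
move=> d0; elim: M => [|M IH]; first by rewrite div0n !big_geq.
rewrite big_mkcond big_nat_recr //= -big_mkcond /= {}IH.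
have [dM|dM] := boolP (d %| M.+1)%N.
  have E : (M.+1 %/ d = (M %/ d).+1)%N by rewrite divnS // dM add1n.
  rewrite E [RHS]big_nat_recr //=; congr (_ + G _).
  by rewrite -E mulnC divnK.
by rewrite addr0 divnS // (negbTE dM) add0n.
Qed.

Lemma sum_divisors_reindex (F : nat -> nat -> R) M :
  \sum_(1 <= n < M.+1) \sum_(1 <= d < M.+1 | (d %| n)%N) F d n =
  \sum_(1 <= d < M.+1) \sum_(1 <= k < (M %/ d).+1) F d (d * k)%N.
Proof.
rewrite (exchange_big_dep xpredT) //=; apply: eq_big_nat => d /andP[d0 _].
exact: sum_multiples.
Qed.

Lemma sum_widen (G : nat -> R) M M' : (M <= M')%N ->
  (forall n, (M < n <= M')%N -> G n = 0) ->
  \sum_(1 <= n < M'.+1) G n = \sum_(1 <= n < M.+1) G n.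
Proof.
move=> MM' H; rewrite (big_cat_nat _ _ (n := M.+1)) //=.
have -> : \sum_(M.+1 <= n < M'.+1) G n = 0 by rewrite big_nat; apply: big1 => n; exact: H.
exact: addr0.
Qed.

(** * Moebius function and totient: sums over divisors *)

Definition sqfree n := all (fun p => logn p n == 1%N) (primes n).

Lemma mobiusE n : (0 < n)%N -> mobius n = if sqfree n then (-1) ^+ size (primes n) else 0.
Proof.
move=> n0; rewrite /mobius gtn_eqF // prime_decompE all_map size_map.
by congr (if _ then _ else _); apply: eq_all.
Qed.

Lemma mobius1 : mobius 1 = 1. Proof. by rewrite mobiusE. Qed.

Lemma perm_primesM m n : (0 < m)%N -> (0 < n)%N -> coprime m n ->
  perm_eq (primes (m * n)) (primes m ++ primes n).
Proof.
move=> m0 n0 co; apply: uniq_perm; first exact: primes_uniq.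
  rewrite cat_uniq !primes_uniq /= andbT -coprime_has_primes //.
by move=> p; rewrite primesM // mem_cat.
Qed.

Lemma logn_coprime_eq0 m n p : coprime m n -> p \in primes m -> logn p n = 0%N.
Proof.
move=> co; rewrite mem_primes => /and3P[pp m0 pm].
have [->|n0] := posnP n; first by rewrite logn0.
apply/eqP; rewrite -leqn0 leqNgt logn_gt0 mem_primes pp n0 /=; apply/negP => pn.
have : (p %| gcdn m n)%N by rewrite dvdn_gcd pm.
by rewrite (eqP co) dvdn1 => /eqP p1; rewrite p1 in pp.
Qed.

Lemma sqfree_coprimeM m n : (0 < m)%N -> (0 < n)%N -> coprime m n ->
  sqfree (m * n) = sqfree m && sqfree n.
Proof.
move=> m0 n0 co; rewrite /sqfree (perm_all _ (perm_primesM m0 n0 co)) all_cat.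
have con : coprime n m by rewrite coprime_sym.
congr (_ && _); apply: eq_in_all => p pin; rewrite lognM //.
  by rewrite (logn_coprime_eq0 co pin) addn0.
by rewrite (logn_coprime_eq0 con pin) add0n.
Qed.

Lemma sqfree_dvd m n : (0 < n)%N -> (m %| n)%N -> sqfree n -> sqfree m.
Proof.
move=> n0 mn /allP H; have m0 := dvdn_gt0 n0 mn; apply/allP => p pm.
have pn : p \in primes n.
  by move: pm; rewrite !mem_primes => /and3P[-> _ /dvdn_trans -> //]; rewrite n0.
have := H p pn; have := dvdn_leq_log p n0 mn.
by move: pm; rewrite -logn_gt0 => lp le /eqP le1; rewrite le1 in le; rewrite eqn_leq le lp.
Qed.

Lemma sqfree_gcd_eq1 m n : (0 < m)%N -> (0 < n)%N -> sqfree (m * n) -> coprime m n.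
Proof.
move=> m0 n0 /allP H; rewrite coprime_has_primes //; apply/hasPn => p pn; apply/negP => pm.
have := H p; rewrite primesM // pn orbT => /(_ isT).
rewrite lognM //; move: pm pn; rewrite -!logn_gt0; lia.
Qed.

Lemma mobiusM m n : (0 < m)%N -> (0 < n)%N ->
  mobius (m * n) = if coprime m n then mobius m * mobius n else 0.
Proof.
move=> m0 n0; rewrite (@mobiusE (m * n)) ?muln_gt0 ?m0 //.
have [co|nco] := boolP (coprime m n); last first.
  by case: ifP => // /(sqfree_gcd_eq1 m0 n0) co; rewrite co in nco.
rewrite !mobiusE // sqfree_coprimeM // (perm_size (perm_primesM m0 n0 co)) size_cat exprD.
by case: (sqfree m); case: (sqfree n) => /=; rewrite ?mul0r ?mulr0.
Qed.

Lemma mobius_prime p : prime p -> mobius p = -1.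
Proof.
move=> pp; rewrite mobiusE ?prime_gt0 // /sqfree primes_prime //= andbT.
by rewrite (pfactorK 1 pp) expr1.
Qed.

Lemma mobius_pM p n : prime p -> (0 < n)%N -> mobius (p * n) = if (p %| n)%N then 0 else - mobius n.
Proof.
move=> pp n0; rewrite mobiusM ?(prime_gt0 pp) //. rewrite prime_coprime // mobius_prime //.
by case: (p %| n)%N => //=; rewrite mulN1r.
Qed.

Lemma normr_mobius n : `|mobius n| <= 1.
Proof.
have [->|n0] := posnP n; first by rewrite /mobius eqxx normr0.
by rewrite mobiusE //; case: ifP => _; rewrite ?normr0 // normrX normrN1 expr1n.
Qed.

Lemma sqfree_pM p n : prime p -> (0 < n)%N -> sqfree (p * n) = ~~ (p %| n)%N && sqfree n.
Proof.
move=> pp n0; have [pn|pn] := boolP (p %| n)%N => /=.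
  by apply/negP => sq; have := sqfree_gcd_eq1 (prime_gt0 pp) n0 sq; rewrite prime_coprime // pn.
rewrite sqfree_coprimeM ?(prime_gt0 pp) ?prime_coprime //.
by rewrite /sqfree primes_prime //= (pfactorK 1 pp) andbT.
Qed.

Lemma mobius_sqr r : (0 < r)%N -> mobius r ^+ 2 = (sqfree r)%:R.
Proof.
by move=> r0; rewrite mobiusE //; case: ifP => _; rewrite ?expr0n // sqrr_sign.
Qed.

(** The induction step for multiplicative statements: one prime is removed, which may still divide
    the cofactor. *)
Lemma split_prime n : (1 < n)%N -> exists p m, [/\ prime p, (0 < m)%N, (m < n)%N & n = (p * m)%N].
Proof.
move=> n1; exists (pdiv n), (n %/ pdiv n)%N; have pp := pdiv_prime n1.
have E : n = (pdiv n * (n %/ pdiv n))%N by rewrite mulnC divnK // pdiv_dvd.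
have m0 : (0 < n %/ pdiv n)%N by rewrite divn_gt0 ?pdiv_gt0 // pdiv_leq // ltnW.
by split => //; rewrite ltn_Pdiv ?prime_gt1 // ltnW.
Qed.

Lemma sum_divisors_pM (F : nat -> R) p m M : prime p -> (0 < m)%N -> (p * m <= M)%N ->
  \sum_(1 <= d < M.+1 | (d %| p * m)%N) F d =
  \sum_(1 <= d < M.+1 | (d %| p * m)%N && ~~ (p %| d)%N) F d + \sum_(1 <= d < M.+1 | (d %| m)%N) F (p * d)%N.
Proof.
move=> pp m0 pmM; have p0 := prime_gt0 pp.
rewrite (bigID (fun d => p %| d)%N) /= addrC; congr (_ + _).
rewrite (eq_bigl (fun d => (p %| d)%N && (d %| p * m)%N)); last by move=> d; rewrite andbC.
rewrite big_mkcondr /= sum_multiples //.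
rewrite [LHS](eq_bigr (fun k => if (k %| m)%N then F (p * k)%N else 0)); last first.
  by move=> k _; rewrite dvdn_pmul2l.
rewrite [RHS]big_mkcond /=; apply/esym.
have mM : (m <= M %/ p)%N by rewrite leq_divRL // mulnC.
apply: sum_widen; first exact: leq_div.
move=> n /andP[n1 _]; case: ifP => // /(dvdn_leq m0) nm; lia.
Qed.

Lemma coprime_dvd_pM p m d : prime p -> ~~ (p %| d)%N -> (d %| p * m)%N = (d %| m)%N.
Proof. by move=> pp pd; rewrite Gauss_dvdr // coprime_sym prime_coprime. Qed.

(** For [n = p m], the terms at [d] and [p d] cancel, [d] running over the divisors of [m] prime to
    [p]. *)
Lemma sum_mobius_dvd n M : (0 < n <= M)%N ->
  \sum_(1 <= d < M.+1 | (d %| n)%N) mobius d = (n == 1%N)%:R.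
Proof.
move=> /andP[n0 nM]; have [n1|n1] := leqP n 1.
  have -> : n = 1%N by apply/eqP; rewrite eqn_leq n1.
  have M0 : (1 < M.+1)%N by lia.
  rewrite big_ltn_cond //= mobius1 big_nat_cond big1 ?addr0 // => d.
  by rewrite dvdn1; lia.
have [p [m [pp m0 mn E]]] := split_prime n1; rewrite gtn_eqF // E sum_divisors_pM -?E //.
rewrite (eq_bigl (fun d => (d %| m)%N && ~~ (p %| d)%N)); last first.
  by move=> d; have [//|pd] := boolP (p %| d)%N; rewrite ?andbF // E coprime_dvd_pM.
rewrite [X in _ + X]big_nat_cond.
rewrite [X in _ + X](eq_bigr (fun d => if (p %| d)%N then 0 else - mobius d)); last first.
  by move=> d /andP[/andP[d0 _] _]; rewrite mobius_pM.
rewrite -big_nat_cond big_mkcondr -big_split /= big1 // => d _.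
by case: (p %| d)%N => /=; rewrite ?addr0 ?subrr.
Qed.

(** For squarefree [p m] the two halves of the divisor sum are the sum for [m] and [p - 1] times
    that sum. *)
Lemma sum_totient_dvd_sqfree n M : sqfree n -> (0 < n <= M)%N ->
  \sum_(1 <= d < M.+1 | (d %| n)%N) (totient d)%:R = n%:R :> R.
Proof.
have [k] := ubnP n; elim: k n => // k IH n nk sq /andP[n0 nM]; have [n1|n1] := leqP n 1.
  have -> : n = 1%N by apply/eqP; rewrite eqn_leq n1.
  have M0 : (1 < M.+1)%N by lia.
  rewrite big_ltn_cond //= big_nat_cond big1 ?addr0 // => d.
  by rewrite dvdn1; lia.
have [p [m [pp m0 mn E]]] := split_prime n1; have p0 := prime_gt0 pp.
move: sq; rewrite E sqfree_pM // => /andP[pm sq].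
rewrite sum_divisors_pM -?E //.
rewrite (eq_bigl (fun d => (d %| m)%N)); last first.
  move=> d; have [pd|pd] /= := boolP (p %| d)%N; last by rewrite andbT E coprime_dvd_pM.
  by rewrite andbF; apply/esym/negP => /(dvdn_trans pd); rewrite (negbTE pm).
rewrite [X in _ + X](eq_bigr (fun d => (p.-1)%:R * (totient d)%:R)); last first.
  move=> d dm; have co : coprime p d.
    by rewrite prime_coprime //; apply: contra pm => pd; exact: dvdn_trans dm.
  by rewrite totient_coprime // totient_prime // natrM.
have mk : (m < k)%N by lia.
have mM : (0 < m <= M)%N by rewrite m0 /=; lia.
rewrite -big_distrr /= (IH m mk sq mM).
rewrite E natrM -[in RHS](prednK p0) -[p.-1.+1%:R]natr1; ring.
Qed.

(** * Weighted sums over r *)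

Definition rsq (n : nat) : R := (Num.sqrt n%:R)^-1.

(** The dependence on [r] conceded to error terms is a power of this product. It is harmless on
    average against [1 / r], because the sum of [d^(-3/2)] converges. *)
Definition sw (r : nat) : R := \prod_(p <- primes r) (1 + rsq p).

(** The square makes [sum_wt_trunc] bounded. The 4 gives [(1 + (ln p) / 4)^2 <= p^(1/2)], so that a
    shift of [v] by [ln p] costs at most [p^(1/2)] ([wt_shift]). *)
Definition wt (v : R) : R := (1 + Num.max 0 v / 4) ^- 2.

Lemma rsqM m n : rsq (m * n) = rsq m * rsq n.
Proof. by rewrite /rsq natrM sqrtrM ?ler0n // invfM. Qed.

Lemma rsq_ge0 n : 0 <= rsq n.
Proof. by rewrite invr_ge0 sqrtr_ge0. Qed.

Lemma rsq1 : rsq 1 = 1.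
Proof. by rewrite /rsq sqrtr1 invr1. Qed.

Lemma rsq_le1 n : (0 < n)%N -> rsq n <= 1.
Proof.
move=> n0; rewrite invf_le1 ?sqrtr_gt0 ?ltr0n //.
by rewrite -[X in X <= _]sqrtr1 ler_sqrt ?ltr0n // ler1n.
Qed.

Lemma sw1 : sw 1 = 1. Proof. by rewrite /sw big_nil. Qed.

Lemma sw_ge1 r : 1 <= sw r.
Proof.
rewrite /sw; elim: (primes r) => [|p s IH]; first by rewrite big_nil.
by rewrite big_cons; have := rsq_ge0 p; nra.
Qed.

Lemma sw_pM p n : prime p -> (0 < n)%N -> sw (p * n) = if (p %| n)%N then sw n else (1 + rsq p) * sw n.
Proof.
move=> pp n0; have [pn|pn] := boolP (p %| n)%N.
  apply: perm_big; apply: uniq_perm; rewrite ?primes_uniq // => q.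
  rewrite primesM ?(prime_gt0 pp) // primes_prime // inE; case: eqP => [->|] //=.
  by rewrite mem_primes pp n0.
have -> : (1 + rsq p) * sw n = \prod_(q <- p :: primes n) (1 + rsq q) by rewrite big_cons.
apply: perm_big.
have := @perm_primesM p n (prime_gt0 pp) n0; rewrite prime_coprime // pn => /(_ isT).
by rewrite (primes_prime pp) cat1s.
Qed.

Lemma sw_leM a b : (0 < a)%N -> (0 < b)%N -> sw (a * b) <= sw a * sw b.
Proof.
have [k] := ubnP a; elim: k a => // k IH a ak a0 b0; have [a1|a1] := leqP a 1.
  have -> : a = 1%N by lia.
  by rewrite mul1n sw1 mul1r.
have [p [m [pp m0 ma E]]] := split_prime a1.
have mk : (m < k)%N by lia.
have H := IH m mk m0 b0; have mb0 : (0 < m * b)%N by rewrite muln_gt0 m0.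
rewrite E -mulnA (sw_pM pp mb0) (sw_pM pp m0).
have S0 := sw_ge1 m; have S1 := sw_ge1 b; have S2 := sw_ge1 (m * b); have q0 := rsq_ge0 p.
have [pm|pm] := boolP (p %| m)%N; first by rewrite (dvdn_mulr _ pm).
rewrite -mulrA; case: ifP => _; first by nra.
by apply: ler_wpM2l => //; lra.
Qed.

Lemma ler_sum_dvd (F : nat -> R) m n M : (forall d, 0 <= F d) -> (m %| n)%N ->
  \sum_(1 <= d < M.+1 | (d %| m)%N) F d <= \sum_(1 <= d < M.+1 | (d %| n)%N) F d.
Proof.
move=> F0 mn; rewrite big_mkcond [X in _ <= X]big_mkcond; apply: ler_sum => d _ /=.
by case: ifP => dm; case: ifP => dn //; rewrite (dvdn_trans dm mn) in dn.
Qed.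

(** Expanding the product yields the squarefree divisors; the terms of the others are
    nonnegative. *)
Lemma sw_le_sum r M : (0 < r <= M)%N -> sw r <= \sum_(1 <= d < M.+1 | (d %| r)%N) rsq d.
Proof.
have [k] := ubnP r; elim: k r => // k IH r rk /andP[r0 rM]; have [r1|r1] := leqP r 1.
  have -> : r = 1%N by lia.
  have M0 : (1 < M.+1)%N by lia.
  rewrite big_ltn_cond //= sw1 rsq1 lerDl; apply: sumr_ge0 => d _; exact: rsq_ge0.
have [p [m [pp m0 mr E]]] := split_prime r1.
have mk : (m < k)%N by lia.
have mM : (0 < m <= M)%N by rewrite m0; lia.
have H := IH m mk mM; rewrite E sw_pM //; case: ifP => pm.
  by apply: le_trans H _; apply: ler_sum_dvd => [d|]; [exact: rsq_ge0 | exact: dvdn_mull].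
rewrite sum_divisors_pM -?E // mulrDl mul1r; apply: lerD.
  apply: le_trans H _; rewrite big_mkcond [X in _ <= X]big_mkcond; apply: ler_sum => d _ /=.
  case: ifP => dm; last by case: ifP => _ //; exact: rsq_ge0.
  rewrite E dvdn_mull //=; case: ifP => //= /negbFE pd.
  by rewrite (dvdn_trans pd dm) in pm.
under [X in _ <= X]eq_bigr do rewrite rsqM.
by rewrite -big_distrr /=; apply: ler_wpM2l => //; exact: rsq_ge0.
Qed.

Lemma sw_exp_le r k M : (0 < r <= M)%N ->
  sw r ^+ k.+1 <= \sum_(1 <= d < M.+1 | (d %| r)%N) rsq d * sw r ^+ k.
Proof.
move=> rM; rewrite exprS -big_distrl /=; apply: ler_wpM2r; last exact: sw_le_sum.
by apply: exprn_ge0; have := sw_ge1 r; lra.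
Qed.

(* Summation against [sw ^ (k + 1)] is reduced to [sw ^ k] by expanding one factor over divisors. *)
Lemma sum_sw_step (k : nat) (t W : nat -> R) (K : R) M :
  (forall n, (0 < n)%N -> 0 <= t n) -> (forall n, (0 < n)%N -> 0 <= W n) ->
  (forall m n, (0 < m)%N -> (0 < n)%N -> t (m * n)%N = t m * t n) ->
  (forall d, (0 < d)%N -> \sum_(1 <= e < M.+1) sw e ^+ k * t e * W (d * e)%N <= K) ->
  \sum_(1 <= r < M.+1) sw r ^+ k.+1 * t r * W r <=
  K * \sum_(1 <= d < M.+1) rsq d * (sw d ^+ k * t d).
Proof.
move=> t0 W0 tM HK.
apply: (@le_trans _ _ (\sum_(1 <= r < M.+1) \sum_(1 <= d < M.+1 | (d %| r)%N) rsq d * sw r ^+ k * (t r * W r))).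
  rewrite big_nat_cond [X in _ <= X]big_nat_cond; apply: ler_sum => r /andP[/andP[r0 rM] _].
  rewrite -big_distrl /= -mulrA; apply: ler_wpM2r; first by rewrite mulr_ge0 ?t0 ?W0.
  by apply: sw_exp_le; rewrite r0 -ltnS.
rewrite (sum_divisors_reindex (fun d r => rsq d * sw r ^+ k * (t r * W r))) big_distrr /=.
rewrite big_nat_cond [X in _ <= X]big_nat_cond; apply: ler_sum => d /andP[/andP[d0 dM] _].
have sd0 : 0 <= sw d ^+ k by apply: exprn_ge0; have := sw_ge1 d; lra.
apply: (@le_trans _ _ (rsq d * (sw d ^+ k * t d) * \sum_(1 <= e < M.+1) sw e ^+ k * t e * W (d * e)%N)); last first.
  rewrite mulrC; apply: ler_wpM2r; last exact: HK.
  by rewrite !mulr_ge0 ?rsq_ge0 ?t0.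
have -> : \sum_(1 <= e < (M %/ d).+1) rsq d * sw (d * e) ^+ k * (t (d * e)%N * W (d * e)%N) =
  \sum_(1 <= e < M.+1) if (e <= M %/ d)%N then rsq d * sw (d * e) ^+ k * (t (d * e)%N * W (d * e)%N) else 0.
  rewrite (@sum_widen _ (M %/ d) M) ?leq_div //; last by move=> n /andP[n1 _]; rewrite leqNgt n1.
  by apply: eq_big_nat => e /andP[_]; rewrite ltnS => ->.
rewrite big_distrr /=.
rewrite big_nat_cond [X in _ <= X]big_nat_cond; apply: ler_sum => e /andP[/andP[e0 eM] _].
have se0 : 0 <= sw e ^+ k by apply: exprn_ge0; have := sw_ge1 e; lra.
have P : 0 <= rsq d * (sw d ^+ k * t d) * (sw e ^+ k * t e * W (d * e)%N).
  by rewrite !mulr_ge0 ?rsq_ge0 ?t0 ?W0 ?muln_gt0 ?d0.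
case: ifP => // _.
have H : sw (d * e) ^+ k <= sw d ^+ k * sw e ^+ k.
  rewrite -exprMn; apply: lerXn2r; rewrite ?nnegrE ?mulr_ge0 //; try (have := sw_ge1 d; have := sw_ge1 e; have := sw_ge1 (d * e); lra).
  exact: sw_leM.
rewrite tM //.
have -> : rsq d * (sw d ^+ k * t d) * (sw e ^+ k * t e * W (d * e)%N) =
  rsq d * (sw d ^+ k * sw e ^+ k) * (t d * t e * W (d * e)%N) by ring.
apply: ler_wpM2r; first by rewrite !mulr_ge0 ?t0 ?W0 ?muln_gt0 ?d0.
by apply: ler_wpM2l => //; exact: rsq_ge0.
Qed.

Lemma rsum_bigop (f : nat -> R) N : Zeta.rsum f N = \sum_(1 <= n < N.+1) f n.
Proof.
elim: N => [|N IH]; first by rewrite big_geq.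
by rewrite big_nat_recr //= -IH.
Qed.

Lemma rsqE n : (0 < n)%N -> rsq n = expR (- (2^-1 * ln n%:R)).
Proof.
move=> n0; rewrite expRN; congr _^-1.
have E : expR (2^-1 * ln n%:R) ^+ 2 = n%:R :> R.
  rewrite -expRM_natl -mulr_natl mulrA divff ?pnatr_eq0 // mul1r lnK //.
  by rewrite posrE ltr0n.
by rewrite -[X in Num.sqrt X]E sqrtr_sqr ger0_norm ?expR_ge0.
Qed.

Lemma sum_rsq_bound M : \sum_(1 <= d < M.+1) (d%:R^-1 * rsq d) <= 3.
Proof.
have h0 : Rdefinitions.Rlt 0 (2^-1 : R) by apply/RltP; rewrite invr_gt0 ltr0n.
have := Zeta.pw_sum_le (2^-1) M h0 => /RleP; rewrite rsum_bigop RplusE RinvE invrK => H.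
suff -> : \sum_(1 <= d < M.+1) (d%:R^-1 * rsq d) = \sum_(1 <= d < M.+1)
  Rtrigo_def.exp (Rdefinitions.Rmult (Rdefinitions.Ropp (Rdefinitions.Rplus 1 2^-1)) (Rpower.ln (Raxioms.INR d))).
  by apply: le_trans H _; rewrite R1E RplusE; lra.
apply: eq_big_nat => d /andP[d0 _].
rewrite RmultE RoppE RplusE INRE RexpE RlnE rsqE // mulNr mulrDl mul1r opprD exp.expRD.
by rewrite [expR (- ln _)]expRN lnK // posrE ltr0n.
Qed.

Lemma sum_sw_rsq k : exists Q, 0 <= Q /\ forall M, \sum_(1 <= d < M.+1) sw d ^+ k * (d%:R^-1 * rsq d) <= Q.
Proof.
elim: k => [|k [Q [Q0 HQ]]].
  exists 3; split=> // M; under eq_bigr do rewrite expr0 mul1r.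
  exact: sum_rsq_bound.
exists (Q * Q); split; first exact: mulr_ge0.
move=> M.
have H : \sum_(1 <= r < M.+1) sw r ^+ k.+1 * (r%:R^-1 * rsq r) * 1 <=
    Q * \sum_(1 <= d < M.+1) rsq d * (sw d ^+ k * (d%:R^-1 * rsq d)).
  apply: (@sum_sw_step k (fun d => d%:R^-1 * rsq d) (fun=> 1)) => //.
  - by move=> n _; rewrite mulr_ge0 ?invr_ge0 ?ler0n ?rsq_ge0.
  - by move=> m n _ _; rewrite natrM invfM rsqM mulrACA.
  - by move=> d _; under eq_bigr do rewrite mulr1.
move: H; under eq_bigr do rewrite mulr1; move=> H; apply: le_trans H _.
apply: ler_wpM2l => //; apply: le_trans (HQ M).
rewrite big_nat_cond [X in _ <= X]big_nat_cond; apply: ler_sum => d /andP[/andP[d0 _] _].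
rewrite ger_pMl // ?rsq_le1 // mulr_gt0 ?exprn_gt0 //; first by have := sw_ge1 d; lra.
by rewrite mulr_gt0 ?invr_gt0 ?sqrtr_gt0 ?ltr0n.
Qed.

Lemma wt_gt0 v : 0 < wt v.
Proof.
rewrite invr_gt0 exprn_gt0 //; have : 0 <= Num.max 0 v by rewrite le_max lexx.
lra.
Qed.

Lemma wt_le1 v : wt v <= 1.
Proof.
have H : 0 <= Num.max 0 v by rewrite le_max lexx.
rewrite /wt invf_le1 ?exprn_gt0 //; try lra.
by rewrite exprn_ege1 //; lra.
Qed.

Lemma wt_anti u v : u <= v -> wt v <= wt u.
Proof.
move=> uv; rewrite /wt; have H : 0 <= Num.max 0 u by rewrite le_max lexx.
have H2 : Num.max 0 u <= Num.max 0 v by rewrite ge_max !le_max lexx /= uv orbT.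
rewrite lef_pV2 ?posrE ?exprn_gt0 //; try lra.
by apply: lerXn2r; rewrite ?nnegrE; lra.
Qed.

Lemma wt_ge0 v : 0 <= v -> wt v = (1 + v / 4) ^- 2.
Proof. by move=> v0; rewrite /wt max_r. Qed.

Lemma wt_shift p v : (0 < p)%N -> wt (v - ln p%:R) * rsq p <= wt v.
Proof.
move=> p0; have L0 : 0 <= ln p%:R :> R by rewrite ln_ge0 // ler1n.
set l := ln p%:R in L0 *.
have S : (1 + l / 4) ^+ 2 <= (rsq p)^-1.
  rewrite rsqE // -expRN opprK.
  have -> : 2^-1 * ln p%:R = l / 4 + l / 4 :> R by rewrite -/l; lra.
  rewrite exp.expRD -expr2; apply: lerXn2r; rewrite ?nnegrE ?expR_ge0 ?expR_ge1Dx //; lra.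
have q0 : 0 < rsq p by rewrite invr_gt0 sqrtr_gt0 ltr0n.
have A : 0 <= Num.max 0 (v - l) by rewrite le_max lexx.
have B : Num.max 0 v <= Num.max 0 (v - l) + l.
  rewrite ge_max; apply/andP; split; first lra.
  by rewrite -lerBlDr le_max lexx orbT.
have B0 : 0 <= Num.max 0 v by rewrite le_max lexx.
rewrite /wt; set x := Num.max 0 (v - l) in A B *; set y := Num.max 0 v in B B0 *.
have H : 1 + y / 4 <= (1 + x / 4) * (1 + l / 4) by nra.
have H2 : (1 + y / 4) ^+ 2 <= (1 + x / 4) ^+ 2 * (rsq p)^-1.
  apply: (@le_trans _ _ (((1 + x / 4) * (1 + l / 4)) ^+ 2)).
    by apply: lerXn2r; rewrite ?nnegrE //; [lra | nra].
  by rewrite exprMn; apply: ler_wpM2l => //; exact: sqr_ge0.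
have y2 : 0 < (1 + y / 4) ^+ 2 by rewrite exprn_gt0 //; lra.
have x2 : 0 < (1 + x / 4) ^+ 2 by rewrite exprn_gt0 //; lra.
rewrite -[rsq p]invrK -invfM lef_pV2 // posrE mulr_gt0 // invr_gt0 //.
Qed.

Definition wt_trunc (a : R) (r : nat) : R := if ln r%:R <= a then wt (a - ln r%:R) else 0.

Lemma wt_trunc_ge0 a r : 0 <= wt_trunc a r.
Proof. by rewrite /wt_trunc; case: ifP => // _; rewrite ltW // wt_gt0. Qed.

Lemma lnrM m n : (0 < m)%N -> (0 < n)%N -> ln (m * n)%:R = ln m%:R + ln n%:R :> R.
Proof. by move=> m0 n0; rewrite natrM lnM ?posrE ?ltr0n. Qed.

Lemma wt_truncM a d e : (0 < d)%N -> (0 < e)%N -> wt_trunc a (d * e) = wt_trunc (a - ln d%:R) e.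
Proof. by move=> d0 e0; rewrite /wt_trunc lnrM // opprD addrA lerBrDl. Qed.

Lemma ln_step n : (0 < n)%N -> n.+1%:R^-1 <= ln n.+1%:R - ln n%:R :> R /\ ln n.+1%:R - ln n%:R <= 1 :> R.
Proof.
move=> n0; have n0R : 0 < n%:R :> R by rewrite ltr0n.
have n1R : 1 <= n%:R :> R by rewrite ler1n.
have nE : n.+1%:R = n%:R + 1 :> R by rewrite natr1.
set x : R := n%:R in n0R n1R nE *; rewrite nE; split.
  have i0 : 0 < (x + 1)^-1 by rewrite invr_gt0; lra.
  have i1 : (x + 1)^-1 < 1 by rewrite invf_lt1; lra.
  have := @le_ln1Dx R (- (x + 1)^-1) ltac:(lra).
  have -> : 1 + - (x + 1)^-1 = x / (x + 1) by field; lra.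
  by rewrite ln_div ?posrE //; lra.
rewrite -ln_div ?posrE //; try lra.
have i0 : 0 < x^-1 by rewrite invr_gt0.
have i1 : x^-1 <= 1 by rewrite invf_le1.
have -> : (x + 1) / x = 1 + x^-1 by field; lra.
have := @le_ln1Dx R x^-1 ltac:(lra); lra.
Qed.

(** Sum against integral: [th r] is the value at [x = ln r] of the primitive [4 / (1 + (a - x) / 4)]
    of [wt (a - x)]. The factor 5 / 4 pays for steps of [ln r] of length up to 1, and [th <= 4]
    gives [6 = 1 + 5]. *)
Lemma sum_wt_trunc M a : \sum_(1 <= r < M.+1) r%:R^-1 * wt_trunc a r <= 6.
Proof.
pose th (r : nat) : R := 4 / (1 + (a - ln r%:R) / 4).
suff [] : \sum_(1 <= r < M.+1) r%:R^-1 * wt_trunc a r <= 6 /\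
  ((0 < M)%N -> ln M%:R <= a -> \sum_(1 <= r < M.+1) r%:R^-1 * wt_trunc a r <= 1 + 5 / 4 * th M) by [].
elim: M => [|M [IH1 IH2]].
  by split => //; rewrite big_geq //; lra.
have th4 : ln M.+1%:R <= a -> th M.+1 <= 4.
  by move=> Ha; rewrite /th ler_pdivrMr; lra.
rewrite big_nat_recr //=.
have [Ha|Ha] := leP (ln M.+1%:R) a; last first.
  have E : wt_trunc a M.+1 = 0 by rewrite /wt_trunc leNgt Ha.
  by rewrite E mulr0 addr0; split=> // _ H; lra.
suff H : \sum_(1 <= r < M.+1) r%:R^-1 * wt_trunc a r + M.+1%:R^-1 * wt_trunc a M.+1 <= 1 + 5 / 4 * th M.+1.
  have t4 := th4 Ha; split=> [|_ _]; last exact: H.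
  by apply: le_trans H _; lra.
have th0 : 0 < th M.+1 by rewrite /th divr_gt0; lra.
have [M0|M0] := posnP M.
  rewrite M0 big_geq // add0r invr1 mul1r; rewrite M0 in th0.
  have := wt_le1 (a - ln 1%:R); rewrite /wt_trunc; case: ifP => _ W; [apply: le_trans W _ | ]; clear -th0; move: (th 1%N) th0 => t t0; lra.
have [L1 L2] := ln_step M0.
have LM : ln M%:R <= a.
  apply: le_trans Ha; rewrite -subr_ge0; apply: le_trans L1.
  by rewrite invr_ge0 ler0n.
have := IH2 M0 LM; rewrite /wt_trunc Ha wt_ge0; last lra.
set l' := ln M.+1%:R in L1 L2 Ha *; set l := ln M%:R in L1 L2 LM *.
set i := M.+1%:R^-1 in L1 *.
have i0 : 0 < i by rewrite invr_gt0 ltr0n.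
suff : i * (1 + (a - l') / 4) ^- 2 <= 5 / 4 * (th M.+1 - th M) by lra.
rewrite /th -/l -/l'.
set y := 1 + (a - l') / 4; have y1 : 1 <= y by rewrite /y; lra.
have -> : 1 + (a - l) / 4 = y + (l' - l) / 4 by rewrite /y; lra.
set z := y + (l' - l) / 4; have z1 : y <= z by rewrite /z; lra.
have z2 : z <= 5 / 4 * y by rewrite /z; lra.
have -> : 5 / 4 * (4 / y - 4 / z) = (5 / 4 * (l' - l)) / (y * z).
  by rewrite /z; field; rewrite -/z; lra.
apply: (@le_trans _ _ ((l' - l) * y ^- 2)).
  by apply: ler_wpM2r => //; rewrite invr_ge0 sqr_ge0.
rewrite ler_pdivlMr; last nra.
have -> : (l' - l) * y ^- 2 * (y * z) = (l' - l) * (z / y) by field; lra.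
rewrite [X in _ <= X]mulrC; apply: ler_wpM2l; first lra.
rewrite ler_pdivrMr; lra.
Qed.

Lemma sum_sw_wt k : exists K, 0 <= K /\ forall M a, \sum_(1 <= r < M.+1) sw r ^+ k * r%:R^-1 * wt_trunc a r <= K.
Proof.
elim: k => [|k [K [K0 HK]]].
  exists 6; split => // M a; under eq_bigr do rewrite expr0 mul1r.
  exact: sum_wt_trunc.
have [Q [Q0 HQ]] := sum_sw_rsq k.
exists (K * Q); split; first exact: mulr_ge0.
move=> M a.
have H : \sum_(1 <= r < M.+1) sw r ^+ k.+1 * r%:R^-1 * wt_trunc a r <=
    K * \sum_(1 <= d < M.+1) rsq d * (sw d ^+ k * d%:R^-1).
  apply: (@sum_sw_step k (fun d => d%:R^-1) (wt_trunc a)) => //.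
  - by move=> n _; exact: wt_trunc_ge0.
  - by move=> m n _ _; rewrite natrM invfM.
  - move=> d d0; rewrite (eq_big_nat _ _ (F2 := fun e => sw e ^+ k * e%:R^-1 * wt_trunc (a - ln d%:R) e)) //.
    by move=> e /andP[e0 _]; rewrite wt_truncM.
apply: le_trans H _; apply: ler_wpM2l => //; apply: le_trans (HQ M).
by apply: ler_sum => d _; rewrite mulrCA [rsq d * _]mulrC.
Qed.

(* [G_r(e^v)] of the header; the cut-off at [M] is harmless for [v <= ln M]. *)
Definition Gr (M r : nat) (v : R) : R :=
  \sum_(1 <= n < M.+1 | coprime n r) mobius n / n%:R * Num.max 0 (v - ln n%:R).

(** * Approximation of G_r by r / phi(r) *)

Lemma max_ln_eq0 n M (v : R) : (M < n)%N -> v <= ln M%:R -> Num.max 0 (v - ln n%:R) = 0.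
Proof.
move=> Mn vM; rewrite max_l // subr_le0; apply: le_trans vM _.
have [->|M0] := posnP M; first by rewrite ln0 // ln_ge0 // ler1n; lia.
by rewrite ler_ln ?posrE ?ltr0n ?ler_nat; lia.
Qed.

Lemma Gr_neg M r v : v < 0 -> Gr M r v = 0.
Proof.
move=> v0; rewrite /Gr big_nat_cond big1 // => n /andP[/andP[n0 _] _].
rewrite max_l ?mulr0 // subr_le0; apply: (@le_trans _ _ 0); first exact: ltW.
by rewrite ln_ge0 // ler1n.
Qed.

(** The [n] divisible by [p] are [p k], with [mobius (p k) = - mobius k] when [p] does not divide
    [k] and 0 otherwise. The relation yields [G_r] from [G_(p r)]; [Gr_bound] inverts it by
    iterating in [v]. *)
Lemma Gr_pM M p r v : prime p -> (0 < r)%N -> ~~ (p %| r)%N -> v <= ln M%:R ->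
  Gr M r v = Gr M (p * r) v - p%:R^-1 * Gr M (p * r) (v - ln p%:R).
Proof.
move=> pp r0 pr vM; have p0 := prime_gt0 pp.
have copr n : coprime n (p * r) = ~~ (p %| n)%N && coprime n r.
  by rewrite coprimeMr coprime_sym prime_coprime.
rewrite {1}/Gr (bigID (fun n => p %| n)%N) /= addrC; congr (_ + _).
  by apply: eq_bigl => n; rewrite copr andbC.
rewrite (eq_bigl (fun n => (p %| n)%N && coprime n r)); last by move=> n; rewrite andbC.
rewrite big_mkcondr /= sum_multiples //.
rewrite /Gr big_distrr -sumrN /= [RHS]big_mkcond /=.
rewrite (@sum_widen _ (M %/ p) M) ?leq_div //; last first.
  move=> n /andP[n1 _]; case: ifP => // _; rewrite -addrA -opprD -lnrM //; last exact: leq_ltn_trans n1.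
  rewrite (@max_ln_eq0 _ M) ?mulr0 ?oppr0 //.
  by rewrite ltn_divLR // mulnC in n1.
apply: eq_big_nat => n /andP[n0 _]; rewrite copr coprimeMl [coprime p r]prime_coprime // pr /=.
rewrite andbC; case: (coprime n r) => //=.
rewrite mobius_pM // lnrM // natrM invfM opprD addrA; case: (p %| n)%N => /=; first by rewrite !mul0r.
ring.
Qed.

Definition ftot (r : nat) : R := r%:R / (totient r)%:R.

Lemma ftot_pM p r : prime p -> (0 < r)%N -> ~~ (p %| r)%N -> ftot (p * r) = (1 - p%:R^-1)^-1 * ftot r.
Proof.
move=> pp r0 pr; rewrite /ftot totient_coprime ?prime_coprime // totient_prime // !natrM.
have p1 := prime_gt1 pp; have t0 : (0 < totient r)%N by rewrite totient_gt0.
have tR : (totient r)%:R != 0 :> R by rewrite pnatr_eq0 -lt0n.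
have pE : p%:R = p.-1%:R + 1 :> R by rewrite natr1 prednK // ltnW.
have q0 : 0 < p.-1%:R :> R by rewrite ltr0n; lia.
rewrite pE; field; rewrite tR /= ?andbT; do ?[apply/andP; split]; lra.
Qed.

(** The origin of the exponent 3: each prime costs [Gr_bound] a factor [1 / (1 - p^(-1/2))], which a
    power of [1 + p^(-1/2)] has to cover. The second power fails at [p = 2]. *)
Lemma sw3_factor p : (1 < p)%N -> 1 <= (1 + rsq p) ^+ 3 * (1 - rsq p).
Proof.
move=> p1; have q0 := rsq_ge0 p.
have q2 : rsq p ^+ 2 <= 2^-1.
  by rewrite /rsq exprVn sqr_sqrtr ?ler0n // lef_pV2 ?posrE ?ltr0n ?ler_nat // ltnW.
set q := rsq p in q0 q2 *.
have -> : (1 + q) ^+ 3 * (1 - q) = 1 + q * (2 - q ^+ 2 * (2 + q)) by ring.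
have q1 : q <= 1 by nra.
have : q ^+ 2 * (2 + q) <= 2 by nra.
nra.
Qed.

Lemma rsq_sqr p : rsq p * rsq p = p%:R^-1.
Proof. by rewrite -expr2 /rsq exprVn sqr_sqrtr ?ler0n. Qed.

Lemma ftot_le_sw r : (0 < r)%N -> sqfree r -> 0 <= ftot r <= sw r ^+ 3.
Proof.
have [k] := ubnP r; elim: k r => // k IH r rk r0 sq; have [r1|r1] := leqP r 1.
  have -> : r = 1%N by lia.
  by rewrite /ftot sw1 expr1n invr1; lra.
have [p [m [pp m0 mr E]]] := split_prime r1; move: sq; rewrite E sqfree_pM // => /andP[pm sq].
have mk : (m < k)%N by lia.
have /andP[H0 H] := IH m mk m0 sq.
rewrite ftot_pM // sw_pM // (negbTE pm) exprMn -rsq_sqr.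
have q0 := rsq_ge0 p; have F := sw3_factor (prime_gt1 pp).
have q1 : rsq p < 1.
  have : rsq p * rsq p < 1 by rewrite rsq_sqr invf_lt1 ?ltr0n ?prime_gt0 // ltr1n prime_gt1.
  nra.
set q := rsq p in q0 F q1 *.
have i0 : 0 < 1 - q * q by nra.
have i1 : 0 <= (1 - q * q)^-1 by rewrite invr_ge0 ltW.
apply/andP; split; first exact: mulr_ge0.
apply: ler_pM => //; rewrite invf_ple ?posrE ?exprn_gt0 //; last lra.
have c0 : 0 < (1 + q) ^+ 3 by rewrite exprn_gt0 //; lra.
rewrite -[X in X <= _]mul1r ler_pdivrMr //; nra.
Qed.

(* Removing one prime from r at a time; the inner induction is on the number of
   shifts of v by log p that keep v nonnegative. *)
Lemma Gr_bound (C : R) M : 1 <= C -> (forall v, v <= ln M%:R -> `|Gr M 1 v - 1| <= C * wt v) ->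
  forall r, (0 < r)%N -> sqfree r -> forall v, v <= ln M%:R ->
  `|Gr M r v - ftot r| <= C * sw r ^+ 3 * wt v.
Proof.
move=> C1 base r; have [k] := ubnP r; elim: k r => // k IH r rk r0 sq; have [r1|r1] := leqP r 1.
  have -> : r = 1%N by lia.
  move=> v vM; rewrite sw1 expr1n mulr1 /ftot invr1 mul1r; exact: base.
have fs := ftot_le_sw r0 sq.
have [p [m [pp m0 mr E]]] := split_prime r1; move: (sq); rewrite E sqfree_pM // => /andP[pm sqm].
have mk : (m < k)%N by lia.
have {}IH := IH m mk m0 sqm.
have p1 := prime_gt1 pp.
have lnp : 0 < ln p%:R :> R by rewrite ln_gt0 // ltr1n.
have neg (v : R) : v < 0 -> `|Gr M r v - ftot r| <= C * sw r ^+ 3 * wt v.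
  move=> v0; rewrite Gr_neg // sub0r normrN ger0_norm; last by case/andP: fs.
  rewrite /wt max_l; last exact: ltW.
  rewrite mul0r addr0 expr1n invr1 mulr1.
  case/andP: fs => f0 f1. apply: le_trans f1 _.
  by rewrite ler_peMl //; have := sw_ge1 r; move=> s1; rewrite exprn_ge0 //; lra.
rewrite -E => v vM.
suff H n : forall v, v <= ln M%:R -> v < n%:R * ln p%:R -> `|Gr M r v - ftot r| <= C * sw r ^+ 3 * wt v.
  apply: (H (Num.truncn (v / ln p%:R)).+1) => //.
  by rewrite -ltr_pdivrMr // truncnS_gt.
elim: n => [|n IHn] {}v {}vM vn; first by apply: neg; rewrite mul0r in vn.
have vp : v - ln p%:R <= ln M%:R by lra.
have vn' : v - ln p%:R < n%:R * ln p%:R by move: vn; rewrite -natr1 mulrDl mul1r; lra.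
have A := IH v vM; have B := IHn _ vp vn'.
(* [ftot] obeys the recursion of [Gr_pM] exactly, so the deviation of [Gr] from it obeys the same
   recursion. *)
have fE : ftot m = ftot r - p%:R^-1 * ftot r.
  rewrite E ftot_pM //.
  have : p%:R != 0 :> R by rewrite pnatr_eq0 -lt0n prime_gt0.
  have : 1 < p%:R :> R by rewrite ltr1n.
  by move=> H1 H2; field; rewrite H2 /=; lra.
rewrite (Gr_pM pp m0 pm vM) -E fE in A.
have wS := wt_shift v (prime_gt0 pp).
have q0 := rsq_ge0 p; have F := sw3_factor p1; have w0 := wt_gt0 v.
have sE : sw r = (1 + rsq p) * sw m by rewrite E sw_pM // (negbTE pm).
set X := Gr M r v - ftot r in A *; set Y := Gr M r (v - ln p%:R) - ftot r in B.
have EX : X = (X - p%:R^-1 * Y) + p%:R^-1 * Y by ring.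
have A' : `|X - p%:R^-1 * Y| <= C * sw m ^+ 3 * wt v.
  by apply: le_trans A; rewrite le_eqVlt; apply/orP; left; apply/eqP; congr `|_|; rewrite /X /Y; ring.
have sm0 : 0 < sw m ^+ 3 by rewrite exprn_gt0 //; have := sw_ge1 m; lra.
have sr0 : 0 < sw r ^+ 3 by rewrite exprn_gt0 //; have := sw_ge1 r; lra.
(* Of [p^(-1) = p^(-1/2) p^(-1/2)] one factor pays for the shift of the weight, and the other
   remains as a contraction. *)
have B' : `|p%:R^-1 * Y| <= rsq p * (C * sw r ^+ 3 * wt v).
  rewrite -rsq_sqr normrM [`|rsq p * _|]ger0_norm ?mulr_ge0 // -[X in X <= _]mulrA; apply: (ler_wpM2l q0).
  apply: (@le_trans _ _ (rsq p * (C * sw r ^+ 3 * wt (v - ln p%:R)))); first exact: (ler_wpM2l q0 B).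
  rewrite mulrCA; apply: ler_wpM2l; last by rewrite mulrC.
  by apply: mulr_ge0; [lra | exact: ltW].
rewrite EX; apply: le_trans (ler_normD _ _) _; apply: le_trans (lerD A' B') _.
have K : sw m ^+ 3 <= sw r ^+ 3 * (1 - rsq p).
  rewrite sE exprMn mulrAC -[X in X <= _]mul1r; apply: ler_wpM2r => //; exact: ltW.
have Cw : 0 < C * wt v by rewrite mulr_gt0 //; lra.
have -> : C * sw m ^+ 3 * wt v = C * wt v * sw m ^+ 3 by ring.
have -> : rsq p * (C * sw r ^+ 3 * wt v) = C * wt v * (rsq p * sw r ^+ 3) by ring.
have -> : C * sw r ^+ 3 * wt v = C * wt v * sw r ^+ 3 by ring.
rewrite -mulrDr; apply: ler_wpM2l; first exact: ltW.
lra.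
Qed.

Lemma mobius_like_mobius : Zeta.mobius_like mobius.
Proof.
split=> [n|f N /ssrnat.leP N0]; first by rewrite RabsE; apply/RleP; exact: normr_mobius.
rewrite rsum_bigop (eq_big_nat _ _ (F2 := fun n => \sum_(1 <= k < (N %/ n).+1) mobius n * f (n * k)%N)); last first.
  move=> n /andP[n0 _]; rewrite -big_distrr /= -rsum_bigop; congr (_ * Zeta.rsum _ _).
  by symmetry; apply: (PeanoNat.Nat.div_unique _ _ _ (N %% n)%N); [apply/ssrnat.ltP; rewrite ltn_mod | rewrite {1}(divn_eq N n) mulnC].
rewrite -(sum_divisors_reindex (fun d n => mobius d * f n)).
rewrite (eq_big_nat _ _ (F2 := fun n => (n == 1%N)%:R * f n)); last first.
  by move=> n nN; rewrite -big_distrl /= sum_mobius_dvd.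
rewrite (big_cat_nat _ _ (n := 2)) //= big_nat1 mul1r big_nat big1 ?addr0 // => n /andP[n1 _].
by rewrite (_ : n == 1%N = false) ?mul0r //; lia.
Qed.

(** The 1 in [1 + C] covers [v < 0], where [Gr] is 0 and [wt] is 1, and also [M = 0], where
    [ln 0 = 0] leaves only [v <= 0]. *)
Lemma base_bound : exists C : R, 1 <= C /\
  forall M v, v <= ln M%:R -> `|Gr M 1 v - 1| <= C * wt v.
Proof.
have [C [/RltP C0 H]] := Zeta.smoothed_bound.
exists (1 + C); rewrite lerDl (ltW C0); split=> // M v vM.
have triv : Gr M 1 v = 0 -> wt v = 1 -> `|Gr M 1 v - 1| <= (1 + C) * wt v.
  by move=> -> ->; rewrite sub0r normrN normr1 mulr1 lerDl ltW.
have [v0|v0] := ltP v 0; first by apply: triv; rewrite ?Gr_neg // /wt max_l ?(ltW v0) // mul0r addr0 expr1n invr1.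
have [M0|M0] := posnP M.
  have v00 : v = 0 by apply/eqP; rewrite eq_le v0 andbT; rewrite M0 ln0 in vM.
  apply: triv; first by rewrite M0 /Gr big_geq.
  by rewrite v00 /wt max_l // mul0r addr0 expr1n invr1.
have := H _ mobius_like_mobius M (expR v).
rewrite /Zeta.smoothed rsum_bigop RlnE expRK INRE => {}H.
have e1 : 1 <= expR v by apply: le_trans (expR_ge1Dx v); lra.
have {H} := H ltac:(exact/ssrnat.leP) ltac:(split; apply/RleP; [exact: e1 | rewrite -ler_ln ?posrE ?expR_gt0 ?ltr0n // expRK //]).
move=> /RleP; rewrite RabsE RdivE RpowE => H; apply: le_trans (_ : C / (1 + v) ^+ 2 <= _).
  move: H; rewrite R1E RplusE; apply: le_trans; rewrite le_eqVlt; apply/orP; left; apply/eqP; congr (`|_ - _|).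
  rewrite /Gr; apply: eq_big => n; first by rewrite coprimen1.
  by move=> _; rewrite !RmultE INRE RlnE RmaxE RdivE.
rewrite wt_ge0 //; have : 0 < (1 + v / 4) ^- 2 by rewrite invr_gt0 exprn_gt0 //; lra.
have : (1 + v) ^- 2 <= (1 + v / 4) ^- 2.
  by rewrite lef_pV2 ?posrE ?exprn_gt0 //; try lra; apply: lerXn2r; rewrite ?nnegrE; lra.
set p := (1 + v) ^- 2; set q := (1 + v / 4) ^- 2 => pq q0.
by have := ler_wpM2l (ltW C0) pq; lra.
Qed.

Lemma sum_mult_Gr M r (a : R) : (0 < r)%N -> a <= ln M%:R ->
  \sum_(1 <= d < M.+1 | (r %| d)%N) mobius d / d%:R * Num.max 0 (a - ln d%:R) =
  mobius r / r%:R * Gr M r (a - ln r%:R).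
Proof.
move=> r0 aM; rewrite sum_multiples // /Gr big_distrr /= [RHS]big_mkcond /=.
rewrite (@sum_widen _ (M %/ r) M) ?leq_div //; last first.
  move=> n /andP[n1 _]; case: ifP => // _; rewrite -addrA -opprD -lnrM //; last exact: leq_ltn_trans n1.
  rewrite (@max_ln_eq0 _ M) ?mulr0 //.
  by rewrite ltn_divLR // mulnC in n1.
apply: eq_big_nat => n /andP[n0 _]; rewrite mobiusM // coprime_sym.
case: (coprime n r); last by rewrite !mul0r.
by rewrite lnrM // natrM opprD addrA invfM; ring.
Qed.

(** After exchanging the sums, [d] carries the sum of [mobius r] over [r | d]; only [d = 1] remains,
    with value [a]. *)
Lemma sum_mobius_Gr M (a : R) : (0 < M)%N -> 0 <= a <= ln M%:R ->
  \sum_(1 <= r < M.+1) mobius r ^+ 2 / r%:R * Gr M r (a - ln r%:R) = a.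
Proof.
move=> M0 /andP[a0 aM].
rewrite (eq_big_nat _ _ (F2 := fun r => \sum_(1 <= d < M.+1 | (r %| d)%N)
   mobius r * (mobius d / d%:R * Num.max 0 (a - ln d%:R)))); last first.
  by move=> r /andP[r0 _]; rewrite -big_distrr /= sum_mult_Gr // expr2 !mulrA.
under eq_bigr do rewrite big_mkcond.
rewrite exchange_big /=.
rewrite (eq_big_nat _ _ (F2 := fun n => (n == 1%N)%:R * (mobius n / n%:R * Num.max 0 (a - ln n%:R)))); last first.
  by move=> n nN; rewrite -big_mkcond -big_distrl /= sum_mobius_dvd.
rewrite (big_cat_nat _ _ (n := 2)) //= big_nat1 mobius1 ln1 subr0 invr1 !mul1r max_r //.
rewrite big_nat big1 ?addr0 // => n /andP[n1 _].
by rewrite (_ : n == 1%N = false) ?mul0r //; lia.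
Qed.

(** * The sum T(A, B), with a = log A and b = log B *)

Definition logsum M (a b : R) : R :=
  \sum_(1 <= d1 < M.+1) \sum_(1 <= d2 < M.+1)
    mobius d1 * mobius d2 / (lcmn d1 d2)%:R * Num.max 0 (a - ln d1%:R) * Num.max 0 (b - ln d2%:R).

Lemma logsumC M a b : logsum M a b = logsum M b a.
Proof.
rewrite /logsum exchange_big /=; apply: eq_bigr => d _; apply: eq_bigr => e _.
by rewrite lcmnC; ring.
Qed.

Lemma mobius_lcm M d e : (0 < d <= M)%N -> (0 < e)%N ->
  mobius d * mobius e / (lcmn d e)%:R =
  \sum_(1 <= r < M.+1) (totient r)%:R * ((r %| d)%N%:R * (mobius d / d%:R)) * ((r %| e)%N%:R * (mobius e / e%:R)).
Proof.
move=> /andP[d0 dM] e0.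
(* For [d] not squarefree both sides vanish; otherwise [gcdn d e] is squarefree and is the sum of
   the totients of its divisors. *)
have [sq|nsq] := boolP (sqfree d); last first.
  rewrite mobiusE // (negbTE nsq) !mul0r big1 // => r _.
  by rewrite !(mul0r, mulr0).
rewrite (eq_bigr (fun r => (if (r %| gcdn d e)%N then (totient r)%:R else 0) * (mobius d / d%:R * (mobius e / e%:R)))); last first.
  move=> r _; rewrite dvdn_gcd; case: (r %| d)%N; case: (r %| e)%N; rewrite /= ?(mul0r, mulr0, mul1r) //; ring.
have g0 : (0 < gcdn d e)%N by rewrite gcdn_gt0 d0.
rewrite -big_distrl /= -big_mkcond sum_totient_dvd_sqfree; first last.
- by rewrite g0 (leq_trans _ dM) // dvdn_leq // dvdn_gcdl.
- by apply: sqfree_dvd sq => //; exact: dvdn_gcdl.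
have E : (lcmn d e)%:R * (gcdn d e)%:R = d%:R * e%:R :> R by rewrite -!natrM muln_lcm_gcd.
have l0 : (lcmn d e)%:R != 0 :> R by rewrite pnatr_eq0 -lt0n lcmn_gt0 d0.
have dR : d%:R != 0 :> R by rewrite pnatr_eq0 -lt0n.
have eR : e%:R != 0 :> R by rewrite pnatr_eq0 -lt0n.
have -> : (gcdn d e)%:R = d%:R * e%:R / (lcmn d e)%:R :> R.
  by rewrite -E mulrAC mulfV // mul1r.
by field; rewrite l0 dR eR.
Qed.

Lemma logsum_Gr M a b : a <= ln M%:R -> b <= ln M%:R ->
  logsum M a b = \sum_(1 <= r < M.+1) mobius r ^+ 2 * (totient r)%:R / r%:R ^+ 2 *
    Gr M r (a - ln r%:R) * Gr M r (b - ln r%:R).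
Proof.
move=> aM bM; rewrite /logsum.
pose t (c : R) r d := (r %| d)%N%:R * (mobius d / d%:R) * Num.max 0 (c - ln d%:R).
have tE c r : (0 < r)%N -> c <= ln M%:R -> \sum_(1 <= d < M.+1) t c r d = mobius r / r%:R * Gr M r (c - ln r%:R).
  move=> r0 cM; rewrite -sum_mult_Gr // [RHS]big_mkcond; apply: eq_bigr => d _.
  by rewrite /t; case: (r %| d)%N; rewrite ?mul1r ?mul0r.
rewrite (eq_big_nat _ _ (F2 := fun d => \sum_(1 <= r < M.+1) (totient r)%:R * t a r d * \sum_(1 <= e < M.+1) t b r e)).
  rewrite exchange_big /=; apply: eq_big_nat => r /andP[r0 _].
  rewrite -big_distrl -big_distrr /= !tE //.
  have rR : r%:R != 0 :> R by rewrite pnatr_eq0 -lt0n.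
  by field.
move=> d dM; under [RHS]eq_bigr do rewrite big_distrr.
rewrite exchange_big /=; apply: eq_big_nat => e /andP[e0 _].
rewrite (@mobius_lcm M) // !big_distrl /=; apply: eq_bigr => r _.
rewrite /t; ring.
Qed.

Lemma logsum_bound : exists K : R, 0 <= K /\ forall M a b,
  0 <= a <= ln M%:R -> 0 <= b <= ln M%:R -> `|logsum M a b - Num.min a b| <= K.
Proof.
have [C [C1 base]] := base_bound.
have [K [K0 HK]] := sum_sw_wt 6.
(* With [a <= b], only the factor at [b] is compared with [ftot]; the factor at [a] is merely
   bounded. This gives the constants [C] and [1 + C], and each factor costs [sw r ^+ 3], whence the
   power 6. *)
suff H M a b : 0 <= a -> a <= b -> b <= ln M%:R -> `|logsum M a b - a| <= (C * (1 + C)) * K.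
  exists (C * (1 + C) * K); split=> [|M a b /andP[a0 aM] /andP[b0 bM]].
    by rewrite !mulr_ge0 //; lra.
  have [ab|ba] := leP a b; first exact: H.
  by rewrite logsumC; apply: H => //; exact: ltW.
move=> a0 ab bM; have aM := le_trans ab bM.
have [M0|M0] := posnP M.
  have -> : a = 0 by apply/eqP; rewrite eq_le a0 andbT; rewrite M0 ln0 in aM.
  by rewrite M0 /logsum big_geq // subr0 normr0 !mulr_ge0 //; lra.
rewrite -{2}(@sum_mobius_Gr M a) ?a0 // logsum_Gr // -sumrB.
apply: le_trans (ler_norm_sum _ _ _) _.
apply: (@le_trans _ _ (\sum_(1 <= r < M.+1) C * (1 + C) * (sw r ^+ 6 * r%:R^-1 * wt_trunc a r))); last first.
  by rewrite -big_distrr /=; apply: ler_wpM2l; [apply: mulr_ge0; lra | exact: HK].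
apply: ler_sum_nat => r /andP[r0 _].
have rR : 0 < r%:R :> R by rewrite ltr0n.
have s1 := sw_ge1 r.
have s6 : 0 < sw r ^+ 6 by rewrite exprn_gt0 //; lra.
have trivial0 : 0 <= C * (1 + C) * (sw r ^+ 6 * r%:R^-1 * wt_trunc a r).
  by rewrite !mulr_ge0 ?wt_trunc_ge0 ?invr_ge0 ?ler0n //; try lra; exact: ltW.
have [sq|nsq] := boolP (sqfree r); last first.
  by rewrite mobiusE // (negbTE nsq) expr0n /= !mul0r subr0 normr0.
rewrite mobius_sqr // sq mul1r div1r.
have t0 : (0 < totient r)%N by rewrite totient_gt0.
have tR : 0 < (totient r)%:R :> R by rewrite ltr0n.
have tr : (totient r)%:R <= r%:R :> R.
  rewrite ler_nat totient_count_coprime; apply: (@leq_trans (\sum_(0 <= d < r) 1)).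
    by apply: leq_sum => d _; exact: leq_b1.
  by rewrite sum_nat_const_nat subn0 muln1.
set x := Gr M r (a - ln r%:R); set y := Gr M r (b - ln r%:R).
have -> : (totient r)%:R / r%:R ^+ 2 * x * y - r%:R^-1 * x =
    (totient r)%:R / r%:R * (r%:R^-1 * (x * (y - ftot r))).
  by rewrite /ftot; field; rewrite !gt_eqF.
move: trivial0; rewrite /wt_trunc; case: ifP => [ra|]; last first.
  move=> /negbT; rewrite -ltNge => ra _.
  by rewrite /x Gr_neg ?subr_lt0 // !(mul0r, mulr0) normr0.
move=> _; have l0 : 0 <= ln r%:R :> R by rewrite ln_ge0 // ler1n.
have X := Gr_bound C1 (base M) r0 sq (v := a - ln r%:R) ltac:(lra).
have Y := Gr_bound C1 (base M) r0 sq (v := b - ln r%:R) ltac:(lra).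
rewrite -/x in X; rewrite -/y in Y.
(* The deviation at [b] thus inherits the weight at [a]. As the factor at [a] vanishes for
   [ln r > a], this weight is the truncated one of [sum_sw_wt]. *)
have W : wt (b - ln r%:R) <= wt (a - ln r%:R) by apply: wt_anti; lra.
have w1 := wt_le1 (a - ln r%:R); have w0 := wt_gt0 (a - ln r%:R).
have /andP[f0 f1] := ftot_le_sw r0 sq.
set s := sw r ^+ 3 in X Y f1.
have sE : sw r ^+ 6 = s * s by rewrite /s -exprD.
have s0 : 0 < s by rewrite exprn_gt0 //; lra.
have X' : `|x| <= (1 + C) * s.
  have -> : x = (x - ftot r) + ftot r by ring.
  apply: le_trans (ler_normD _ _) _; rewrite (ger0_norm f0).
  have : C * s * wt (a - ln r%:R) <= C * s by rewrite ler_piMr // mulr_ge0 // ?ltW //; lra.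
  lra.
have Y' : `|y - ftot r| <= C * s * wt (a - ln r%:R).
  apply: le_trans Y _; apply: ler_wpM2l => //; apply: mulr_ge0; [lra | exact: ltW].
rewrite normrM [`|_ / _|]ger0_norm ?divr_ge0 ?ler0n // normrM [`|_^-1|]ger0_norm ?invr_ge0 ?ler0n //.
apply: (@le_trans _ _ (1 * (r%:R^-1 * (((1 + C) * s) * (C * s * wt (a - ln r%:R)))))).
  apply: ler_pM => //; rewrite ?divr_ge0 ?mulr_ge0 ?invr_ge0 ?ler0n //.
    by rewrite ler_pdivrMr // mul1r.
  apply: ler_wpM2l; first by rewrite invr_ge0 ler0n.
  by rewrite normrM; apply: ler_pM.
by rewrite sE le_eqVlt; apply/orP; left; apply/eqP; ring.
Qed.

(** * Absolute continuity and bounded variation *)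

(** The families of intervals of [abs_cont], with a lower bound for the first left end so that
    induction on the list goes through. *)
Fixpoint ordered (c : R) (s : seq (R * R)) : bool :=
  if s is p :: s' then [&& c <= p.1, p.1 <= p.2 & ordered p.2 s'] else true.

Definition total_length (s : seq (R * R)) : R := \sum_(p <- s) (p.2 - p.1).

Lemma ordered_sorted c s : ordered c s ->
  sorted (fun p q : R * R => p.2 <= q.1) s /\ all (fun p : R * R => p.1 <= p.2) s.
Proof.
elim: s c => // p [|q s] IH c /=; first by move=> /and3P[_ -> _].
move=> /and3P[_ -> H]; have [/= -> ->] := IH _ H.
by case/and3P: H => ->.
Qed.

Lemma sorted_ordered s : sorted (fun p q : R * R => p.2 <= q.1) s ->
  all (fun p : R * R => p.1 <= p.2) s -> ordered (head (0, 0) s).1 s.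
Proof.
case: s => // p s; rewrite /= lexx /=; elim: s p => [|q s IH] p /=; first by move=> _ ->.
by move=> /andP[pq H] /andP[-> H2] /=; rewrite pq IH.
Qed.

Lemma ordered_le c d s : c <= d -> ordered d s -> ordered c s.
Proof. by case: s => //= p s cd /and3P[/(le_trans cd) -> -> ->]. Qed.

Definition consecutive (a : R) (q : seq R) : seq (R * R) := zip (belast a q) q.

Lemma ordered_consecutive c a q s : c <= a -> path <%O a q -> ordered (last a q) s ->
  ordered c (consecutive a q ++ s).
Proof.
elim: q a c => [|x q IH] a c ca /=; first by move=> _; exact: ordered_le.
move=> /andP[ax H] H2; rewrite ca (ltW ax) /=; exact: IH.
Qed.

Lemma total_length_consecutive a q : total_length (consecutive a q) = last a q - a.
Proof.
rewrite /total_length; elim: q a => [|x q IH] a /=; first by rewrite big_nil subrr.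
by rewrite /consecutive /= big_cons -/(consecutive x q) IH /=; ring.
Qed.

Lemma variation_consecutive a b h q : itv_partition a b q ->
  variation a b h q = \sum_(p <- consecutive a q) `|h p.2 - h p.1|.
Proof.
move=> H; rewrite variation_zip // {H}; elim: q a => [|x q IH] a; first by rewrite !big_nil.
by rewrite /consecutive /= !big_cons /= IH.
Qed.

(* Refining every interval of t by a partition keeps the intervals ordered and
   the total length unchanged. *)
Lemma sum_total_variation_le (h : R -> R) t c (K : R) : ordered c t ->
  (forall s, ordered c s -> total_length s <= total_length t -> \sum_(p <- s) `|h p.2 - h p.1| <= K) ->
  (\sum_(p <- t) total_variation p.1 p.2 h <= K%:E)%E.
Proof.
elim: t c K => [|p t IH] c K /=.
  by move=> _ /(_ [::] isT (lexx _)); rewrite !big_nil.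
move=> /and3P[cp pp ot] H; rewrite big_cons.
have rest q : itv_partition p.1 p.2 q ->
    (\sum_(j <- t) total_variation j.1 j.2 h <= (K - variation p.1 p.2 h q)%:E)%E.
  move=> pq; apply: (IH p.2) => // s os ls; rewrite lerBrDl variation_consecutive // -big_cat /=.
  case: pq => pa /eqP la.
  apply: H; first by apply: ordered_consecutive => //; rewrite la.
  rewrite {1}/total_length big_cat /= -/(total_length _) total_length_consecutive la.
  by rewrite {1}/total_length big_cons lerD2l.
have nn : (0 <= \sum_(j <- t) total_variation j.1 j.2 h)%E.
  have : all (fun p : R * R => p.1 <= p.2) t by case: (ordered_sorted ot).
  move=> /allP at_; rewrite big_seq; apply: sume_ge0 => j /at_; exact: total_variation_ge0.
have : exists q, itv_partition p.1 p.2 q.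
  have [E|ne] := eqVneq p.1 p.2; first by exists [::]; split => //=; rewrite E.
  by exists [:: p.2]; apply: itv_partition1; rewrite lt_neqAle ne.
case=> q0 /rest H0.
have fin : (\sum_(j <- t) total_variation j.1 j.2 h)%E \is a fin_num.
  by rewrite ge0_fin_numE // (le_lt_trans H0) // ltry.
rewrite -leeBrDr //; apply: ge_ereal_sup => _ [_ [q pq <-] <-].
move: (rest q pq); rewrite -(fineK fin) -EFinB !lee_fin; lra.
Qed.

Lemma abs_cont_total_variation h : abs_cont h -> forall e : R, 0 < e -> exists2 d : R, 0 < d &
  forall c s, ordered c s -> total_length s < d -> (\sum_(p <- s) total_variation p.1 p.2 h <= e%:E)%E.
Proof.
move=> ac e e0; have [d d0 H] := ac e e0; exists d => // c s os ls.
apply: sum_total_variation_le os _ => t ot lt.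
have [st at_] := ordered_sorted ot.
by apply/ltW/H => //; exact: le_lt_trans ls.
Qed.

(** The interval is cut into steps of length at most [d / 2], on each of which the variation is at
    most 1. *)
Lemma abs_cont_bounded_variation h a b : abs_cont h -> a <= b -> total_variation a b h \is a fin_num.
Proof.
move=> ac ab; have [d d0 H] := abs_cont_total_variation ac ltr01.
suff K n : forall b, a <= b -> b - a <= n%:R * (d / 2) -> total_variation a b h \is a fin_num.
  apply: (K (Num.truncn ((b - a) / (d / 2))).+1) => //.
  by rewrite -ler_pdivrMr ?divr_gt0 // ltW // truncnS_gt.
elim: n => [|n IH] {ab}b ab.
  by rewrite mul0r subr_le0 => ba; rewrite (@le_anti _ _ a b) ?ab // total_variationxx.
rewrite -natr1 mulrDl mul1r => bn.
have small x : x <= b -> b - x <= d / 2 -> total_variation x b h \is a fin_num.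
  move=> xb bx; have /= := H x [:: (x, b)]; rewrite lexx xb /total_length !big_seq1 /= => /(_ isT) H1.
  rewrite ge0_fin_numE ?total_variation_ge0 //; apply: le_lt_trans (H1 _) _; last exact: ltry.
  lra.
have [bs|bs] := leP (b - a) (d / 2); first exact: small.
rewrite (@total_variationD _ a b (b - d / 2)) ?fin_numD; try lra.
by rewrite IH ?small //; lra.
Qed.

(** Variation is counted from 0 because [h] vanishes before. Then [h = tvf h - (tvf h - h)] is a
    difference of nondecreasing absolutely continuous functions, each of which has a Stieltjes
    measure. *)
Definition tvf (h : R -> R) (x : R) : R := fine (total_variation 0 (Num.max 0 x) h).

Lemma tvfB h x y : abs_cont h -> x <= y ->
  (tvf h y - tvf h x)%:E = total_variation (Num.max 0 x) (Num.max 0 y) h.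
Proof.
move=> ac xy; have m0 (z : R) : 0 <= Num.max 0 z by rewrite le_max lexx.
have mm : Num.max 0 x <= Num.max 0 y by rewrite ge_max m0 le_max xy orbT.
rewrite /tvf (@total_variationD _ 0 (Num.max 0 y) (Num.max 0 x)) //.
rewrite fineD ?abs_cont_bounded_variation //.
by rewrite addrAC subrr add0r fineK ?abs_cont_bounded_variation.
Qed.

Lemma tvf_le h x y : abs_cont h -> x <= y -> tvf h x <= tvf h y.
Proof.
move=> ac xy; rewrite -subr_ge0 -lee_fin tvfB // total_variation_ge0 //.
by rewrite ge_max !le_max lexx xy /= orbT.
Qed.

Lemma tvf_norm_le h x y : abs_cont h -> (forall x, x <= 0 -> h x = 0) -> x <= y ->
  `|h y - h x| <= tvf h y - tvf h x.
Proof.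
move=> ac h0 xy; have hm z : h z = h (Num.max 0 z).
  by have [z0|z0] := leP 0 z => //; rewrite !h0 // ltW.
rewrite (hm x) (hm y) -lee_fin tvfB //; apply: total_variation_ge.
by rewrite ge_max !le_max lexx xy /= orbT.
Qed.

Lemma abs_cont_tvf h : abs_cont h -> abs_cont (tvf h).
Proof.
move=> ac e e0; have [d d0 H] := abs_cont_total_variation ac (divr_gt0 e0 (ltr0n R 2)).
exists d => // s ss /[dup] sa /allP sA sd.
pose m (p : R * R) := (Num.max 0 p.1, Num.max 0 p.2).
have mono (x y : R) : x <= y -> Num.max 0 x <= Num.max 0 y by move=> xy; rewrite ge_max !le_max lexx xy orbT.
have os : ordered (Num.max 0 (head (0, 0) s).1) [seq m p | p <- s].
  have := sorted_ordered ss sa; elim: (s) (head _ _).1 => //= p t IH c /and3P[cp pp ot].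
  by rewrite !mono //= IH.
rewrite -lte_fin.
have -> : (\sum_(p <- s) `|tvf h p.2 - tvf h p.1|)%:E = (\sum_(p <- [seq m p | p <- s]) total_variation p.1 p.2 h)%E.
  rewrite big_map -sumEFin big_seq [RHS]big_seq; apply: eq_bigr => p /sA pp.
  by rewrite -tvfB // ger0_norm // subr_ge0; exact: tvf_le.
apply: (@le_lt_trans _ _ (e / 2)%:E); last by rewrite lte_fin; lra.
apply: H os _; apply: le_lt_trans sd; rewrite /total_length big_map.
rewrite big_seq [X in _ <= X]big_seq; apply: ler_sum => p /sA pp /=.
have [p1|p1] := leP 0 p.1; have [p2|p2] := leP 0 p.2; lra.
Qed.

Lemma abs_contB f g : abs_cont f -> abs_cont g -> abs_cont (fun x => f x - g x).
Proof.
move=> af ag e e0; have e2 : 0 < e / 2 by lra.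
have [d1 d10 H1] := af _ e2; have [d2 d20 H2] := ag _ e2.
exists (Num.min d1 d2); first by rewrite lt_min d10.
move=> s ss sa; rewrite lt_min => /andP[l1 l2].
have -> : e = e / 2 + e / 2 by lra.
apply: le_lt_trans (ltrD (H1 s ss sa l1) (H2 s ss sa l2)).
rewrite -big_split /=; apply: ler_sum => p _.
rewrite [X in `|X|](_ : _ = (f p.2 - f p.1) - (g p.2 - g p.1)); last by ring.
exact: ler_normB.
Qed.

Lemma abs_cont_continuous (f : R -> R) : abs_cont f -> continuous f.
Proof.
move=> ac x; apply/(@cvgrPdist_lt _ R^o) => e e0; have [d d0 H] := ac e e0.
near=> y; have yd : `|x - y| < d by near: y; apply: (@cvgr_dist_lt _ R^o) => //; exact: cvg_id.
have [xy|/ltW yx] := leP x y.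
  have := H [:: (x, y)] isT; rewrite /= xy !big_seq1 /= => /(_ isT).
  by rewrite distrC; apply; move: yd; rewrite distrC ger0_norm // subr_ge0.
have := H [:: (y, x)] isT; rewrite /= yx !big_seq1 /= => /(_ isT); apply.
by move: yd; rewrite ger0_norm // subr_ge0.
Unshelve. all: by end_near. Qed.

(** * Dyadic cells and domination by Lebesgue measure *)

Notation leb := (@lebesgue_measure R).
Notation mR := (measurableTypeR R).

Definition gpt (n j : nat) : R := j%:R / (2 ^ n)%:R.

Lemma gpt_le n i j : (i <= j)%N -> gpt n i <= gpt n j.
Proof. by move=> ij; rewrite ler_wpM2r ?invr_ge0 ?ler0n // ler_nat. Qed.

Lemma gptS n j : gpt n j.+1 - gpt n j = (2 ^ n)%:R^-1.
Proof. by rewrite /gpt -mulrBl -natr1 addrAC subrr add0r mul1r. Qed.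

Definition cell n j : set mR := `](gpt n j), (gpt n j.+1)]%classic.

Lemma gpt_double n j : gpt n.+1 j.*2 = gpt n j.
Proof.
by rewrite /gpt -muln2 expnSr !natrM invfM mulrACA mulfV ?mulr1.
Qed.

Lemma cell_exists n (x : R) : 0 < x -> x <= 1 -> exists2 j, (j < 2 ^ n)%N & cell n j x.
Proof.
elim: n => [|n IH] x0 x1.
  exists 0%N => //; rewrite /cell /gpt /= in_itv /= expn0 mul0r divr1; lra.
have [j jn] := IH x0 x1; rewrite /cell /= in_itv /= -(gpt_double n j) -(gpt_double n j.+1).
move=> /andP[H1 H2]; have [x2|x2] := leP x (gpt n.+1 j.*2.+1).
  exists j.*2; last by rewrite /= in_itv /= H1.
  by rewrite expnS mul2n ltn_double.
exists j.*2.+1; last by rewrite /= in_itv /= x2.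
by rewrite expnS mul2n; lia.
Qed.

Lemma cell_parent n j : exists k, [/\ cell n.+1 j `<=` cell n k & j./2 = k].
Proof.
exists j./2; split => // x; rewrite /cell /= !in_itv /= => /andP[H1 H2].
rewrite -!(gpt_double n); apply/andP; split.
  by apply: le_lt_trans H1; apply: gpt_le; lia.
by apply: le_trans H2 _; apply: gpt_le; lia.
Qed.

Lemma trivIset_cell n : trivIset setT (cell n).
Proof.
apply/trivIsetP => i j _ _; wlog ij : i j / (i < j)%N.
  move=> H ne; have [ij|ji|E] := ltngtP i j; first exact: H.
    by rewrite setIC; apply: H => //; rewrite eq_sym.
  by rewrite E eqxx in ne.
move=> _; apply/seteqP; split => // x []; rewrite /cell /= !in_itv /= => /andP[_ H1] /andP[H2 _].
have := le_lt_trans (le_trans H1 (gpt_le n ij)) H2.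
by rewrite ltxx.
Qed.

Definition subcell (U : set mR) n j : set mR := if `[< cell n j `<=` U >] then cell n j else set0.

(** An open set meets []0, 1]] in the increasing union of these sets. At each level they consist of
    finitely many consecutive intervals, to which [abs_cont] applies directly, whereas the
    components of [U] may be infinitely many. *)
Definition subcells U n : set mR := \big[setU/set0]_(j < 2 ^ n) subcell U n j.

Lemma subcellsP U n x : subcells U n x <-> exists j, [/\ (j < 2 ^ n)%N, cell n j `<=` U & cell n j x].
Proof.
rewrite /subcells -bigcup_mkord; split.
  move=> [j /= jn]; rewrite /subcell; case: ifPn => // /asboolP cU cx.
  by exists j.
move=> [j [jn cU cx]]; exists j => //=; rewrite /subcell.
by move/asboolP : cU => ->.
Qed.

Lemma measurable_subcell U n j : measurable (subcell U n j).
Proof. by rewrite /subcell; case: ifP => _; [exact: measurable_itv | exact: measurable0]. Qed.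

Lemma measurable_subcells U n : measurable (subcells U n).
Proof. by apply: bigsetU_measurable => j _; exact: measurable_subcell. Qed.

Lemma measure_subcells (m : {measure set mR -> \bar R}) U n :
  m (subcells U n) = (\sum_(j <- [seq j <- index_iota 0 (2 ^ n) | `[< cell n j `<=` U >]]) m (cell n j))%E.
Proof.
rewrite /subcells measure_bigsetU; first last.
- apply/trivIsetP => i j _ _ ne; have /trivIsetP/(_ i j I I ne) E := @trivIset_cell n.
  by rewrite /subcell; case: ifP => _; case: ifP => _; rewrite ?(set0I, setI0).
- by move=> j; exact: measurable_subcell.
rewrite big_filter big_mkord [RHS]big_mkcond /=; apply: eq_bigr => j _.
by rewrite /subcell; case: ifP => // _; rewrite measure0.
Qed.

Lemma nondecreasing_subcells U : nondecreasing_seq (subcells U).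
Proof.
apply/nondecreasing_seqP => n; apply/subsetPset => x /subcellsP[j [jn cU cx]].
have /andP[x0 x1] : 0 < x <= 1.
  move: cx; rewrite /cell /= in_itv /= => /andP[H1 H2].
  have p0 : 0 < (2 ^ n)%:R :> R by rewrite ltr0n expn_gt0.
  rewrite (le_lt_trans _ H1) ?divr_ge0 ?ler0n // (le_trans H2) // ler_pdivrMr // mul1r ler_nat //.
have [k kn cx'] := cell_exists n.+1 x0 x1.
apply/subcellsP; exists k; split => // y cy; have [i [ci _]] := cell_parent n k.
apply: cU; suff <- : i = j by exact: ci.
apply/eqP/negP => /negP ne; have /trivIsetP/(_ i j I I ne) E := @trivIset_cell n.
suff : (cell n i `&` cell n j) x by rewrite E.
by split=> //; exact: ci.
Qed.

Lemma bigcup_subcells (U : set R) : open U -> \bigcup_n subcells U n = U `&` `]0, 1]%classic.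
Proof.
move=> oU; apply/seteqP; split => x.
  move=> [n _ /subcellsP[j [jn cU cx]]]; split; first exact: cU.
  move: cx; rewrite /cell /= !in_itv /= => /andP[H1 H2].
  have p0 : 0 < (2 ^ n)%:R :> R by rewrite ltr0n expn_gt0.
  by rewrite (le_lt_trans _ H1) ?divr_ge0 ?ler0n // (le_trans H2) // ler_pdivrMr // mul1r ler_nat.
move=> [Ux]; rewrite /= in_itv /= => /andP[x0 x1].
have : nbhs x U by exact: open_nbhs_nbhs.
move=> /nbhs_ballP[e /= e0 eU].
have [n ne] : exists n, (2 ^ n)%:R^-1 < e.
  exists (Num.truncn e^-1).+1; rewrite invf_plt ?posrE ?ltr0n ?expn_gt0 //.
  apply: lt_le_trans (truncnS_gt _) _; rewrite ler_nat; exact/ltnW/ltn_expl.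
have [j jn cx] := cell_exists n x0 x1; exists n => //; apply/subcellsP; exists j; split => // y.
move: cx; rewrite /cell /= !in_itv /= => /andP[H1 H2] /andP[H3 H4].
apply: eU; rewrite /ball /= ltr_norml; have := gptS n j.
move: (gpt n j.+1) (gpt n j) H1 H2 H3 H4 => u v; lra.
Qed.

(** A null set lies in an open [U] of Lebesgue measure below the [d] belonging to [e]. The finite
    unions of cells inside [U] then have [m]-measure at most [e], and so has their union. *)
Lemma abs_cont_dominates (F : R -> R) (m : {measure set mR -> \bar R}) :
  abs_cont F -> {homo F : x y / x <= y} ->
  (forall a b, a <= b -> m `]a, b]%classic = (F b - F a)%:E) ->
  forall A : set mR, measurable A -> leb A = 0%E -> m (A `&` `]0, 1]%classic) = 0%E.
Proof.
move=> ac nd mE A mA A0; apply/eqP; rewrite eq_le measure_ge0 andbT.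
apply/lee_addgt0Pr => e e0; rewrite add0e.
have [d d0 H] := ac e e0.
have [|U [oU AU Ud]] := @lebesgue_regularity_outer R A d mA _ d0; first by rewrite [X in (X < _)%E]A0 ltry.
have mU : measurable (U : set mR) by exact: open_measurable.
have {}Ud : (leb U < d%:E)%E.
  rewrite (_ : U = (U `\` A) `|` A); last by rewrite setUC setDUK.
  rewrite measureU //; last 2 first.
  - exact: measurableD.
  - by apply/seteqP; split => // x [[]].
  by rewrite [X in (_ + X)%E]A0 adde0.
have bound n : (m (subcells U n) <= e%:E)%E.
  set s := [seq j <- index_iota 0 (2 ^ n) | `[< cell n j `<=` U >]].
  have L : \sum_(j <- s) (gpt n j.+1 - gpt n j) < d.
    rewrite -lte_fin; apply: le_lt_trans Ud; rewrite -sumEFin.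
    apply: (@le_trans _ _ (leb (subcells U n))); last first.
      apply: le_measure; rewrite ?inE //; first exact: measurable_subcells.
      by move=> x /subcellsP[j [_ cU cx]]; exact: cU.
    rewrite (measure_subcells leb) le_eqVlt; apply/orP; left; apply/eqP; apply: eq_bigr => j _.
    rewrite [RHS](@lebesgue_measure_itv R `](gpt n j), (gpt n j.+1)]) /= lte_fin.
    by have -> : gpt n j < gpt n j.+1 by rewrite -subr_gt0 gptS invr_gt0 ltr0n expn_gt0.
  rewrite measure_subcells -/s.
  have -> : (\sum_(j <- s) m (cell n j) = (\sum_(j <- s) (F (gpt n j.+1) - F (gpt n j)))%:E)%E.
    rewrite -sumEFin; apply: eq_bigr => j _; rewrite mE //; exact: gpt_le.
  rewrite lee_fin ltW //; have := H [seq (gpt n j, gpt n j.+1) | j <- s].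
  rewrite !big_map /= => /(_ _ _ L) H2.
  apply: (le_lt_trans _ (H2 _ _)).
  - by apply: ler_sum => j _; exact: ler_norm.
  - rewrite sorted_map; apply: (@sub_sorted _ ltn); first by move=> i j /= ij; exact: gpt_le.
    by apply: sorted_filter; [exact: ltn_trans | exact: iota_ltn_sorted].
  - by apply/allP => p /mapP[j _ ->] /=; exact: gpt_le.
have C := nondecreasing_cvg_mu (mu := m) (fun n => measurable_subcells U n)
  (bigcupT_measurable _ (fun n => measurable_subcells U n)) (@nondecreasing_subcells U).
apply: (@le_trans _ _ (m (\bigcup_n subcells U n))).
  rewrite bigcup_subcells //; apply: le_measure; rewrite ?inE.
  - by apply: measurableI => //; exact: measurable_itv.
  - by apply: measurableI => //; exact: measurable_itv.
  - by move=> x [Ax ?]; split => //; exact: AU.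
rewrite -(cvg_lim _ C) //; apply: lime_le; first by apply/cvg_ex; eexists; exact: C.
by near=> n; exact: bound.
Unshelve. all: by end_near. Qed.

(** * Densities of absolutely continuous functions *)

Lemma stieltjes_measure_exists (K : realType) (F : K -> K) :
  {homo F : x y / x <= y} -> continuous F ->
  exists m : {measure set (measurableTypeR K) -> \bar K},
    forall a b, a <= b -> m `]a, b]%classic = (F b - F a)%:E.
Proof.
move=> nd cF; have rc := right_continuousW cF.
pose Fc : cumulative K K := HB.pack F (isCumulative.Build K _ K F nd rc).
exists (lebesgue_stieltjes_measure Fc) => a b ab.
rewrite /= /lebesgue_stieltjes_measure /measure_extension measurable_mu_extE /=; last exact: is_ocitv.
by rewrite wlength_itv_bnd.
Qed.

Lemma abs_cont_mono_density (F : R -> R) : abs_cont F -> {homo F : x y / x <= y} ->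
  exists f : mR -> R, leb.-integrable setT (EFin \o f) /\
    forall a b, 0 <= a -> a <= b -> b <= 1 -> (\int[leb]_(x in `]a, b]%classic) (f x)%:E = (F b - F a)%:E)%E.
Proof.
move=> ac nd.
have [m mE] := @stieltjes_measure_exists R F nd (abs_cont_continuous ac).
have mI : measurable (`]0, 1]%classic : set mR) by exact: measurable_itv.
have fI : (m `]0%R, 1%R]%classic < +oo)%E by rewrite mE // ltry.
pose nu : {finite_measure set mR -> \bar R} := mfrestr mI fI.
have dom : nu `<< leb.
  apply/null_content_dominatesP => A mA A0; rewrite /nu /= /mfrestr /mrestr /=.
  exact: (abs_cont_dominates ac nd mE).
have [f [f0 ff fi fE]] := @radon_nikodym_sigma_finite _ _ _ leb nu dom.
exists (fine \o f); have E : EFin \o (fine \o f) = f by apply/funext => x /=; rewrite fineK.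
split; first by rewrite E.
move=> a b a0 ab b1; under eq_integral do rewrite fineK //.
rewrite -fE; last exact: measurable_itv.
rewrite /nu /= /mfrestr /mrestr setIidl; first exact: mE.
move=> x; rewrite /= !in_itv /= => /andP[x0 x1]; apply/andP; split.
  exact: le_lt_trans x0.
exact: le_trans b1.
Qed.

Lemma abs_cont_density (h : R -> R) : abs_cont h -> (forall x, x <= 0 -> h x = 0) ->
  exists f : mR -> R, leb.-integrable setT (EFin \o f) /\
    forall a b, 0 <= a -> a <= b -> b <= 1 -> \int[leb]_(x in `]a, b]%classic) f x = h b - h a.
Proof.
move=> ac h0.
have [f1 [i1 E1]] := abs_cont_mono_density (abs_cont_tvf ac) (fun x y => @tvf_le h x y ac).
have nd : {homo (fun x => tvf h x - h x) : x y / x <= y}.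
  move=> x y xy; have := tvf_norm_le ac h0 xy; rewrite ler_norml; lra.
have [f2 [i2 E2]] := abs_cont_mono_density (abs_contB (abs_cont_tvf ac) ac) nd.
exists (fun x => f1 x - f2 x); split; first exact: (integrableB measurableT i1 i2).
move=> a b a0 ab b1; rewrite RintegralB; last 3 first.
- exact: measurable_itv.
- exact: integrableS i1.
- exact: integrableS i2.
by rewrite /Rintegral E1 // E2 //=; ring.
Qed.

Lemma abs_cont_derivative (h : R -> R) : abs_cont h -> (forall x, x <= 0 -> h x = 0) ->
  (forall x, 1 <= x -> h x = h 1) ->
  exists f : mR -> R, [/\ leb.-integrable setT (EFin \o f),
    forall a b, 0 <= a -> a <= b -> b <= 1 -> \int[leb]_(x in `]a, b]%classic) f x = h b - h a &
    {ae leb, forall x, 0 < x < 1 -> der h x = f x}].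
Proof.
move=> ac h0 h1; have [f [fi fE]] := abs_cont_density ac h0.
exists f; split => //.
have := @FTC1 R f (BRight 0).
have iy y : leb.-integrable `]0, y]%classic (EFin \o f).
  by apply: integrableS fi => //; exact: measurable_itv.
move=> /(_ iy (open_integrable_locally openT fi)).
apply: filterS; first exact: (ae_filter_ringOfSetsType leb).
move=> x H /andP[x0 x1]; have [|_ <-] := H; first by rewrite lte_fin.
have nE : \forall y \near (x : R), h y = \int[leb]_(t in `]0, y]%classic) f t.
  near=> y; have /andP[y0 y1] : 0 < y < 1.
    by apply/andP; split; near: y; [exact: lt_nbhsr | exact: lt_nbhsl].
  by rewrite fE // ?(h0 0) ?subr0 // ltW.
rewrite /der !derive1E; exact: (@near_eq_derive R R^o R^o h _ x 1 nE).
Unshelve. all: by end_near. Qed.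

(** * Representatives of bounded variation *)

Import HBNNSimple.

(* Unlike in ae_eq_integral, f and g need not be measurable: the Lebesgue integral
   is defined by nonnegative simple functions below f, which may be cut off on a null set. *)
Lemma ge0_ae_eq_integral_nonmeasurable d (T : measurableType d) (K : realType)
  (m : {measure set T -> \bar K}) (f g : T -> \bar K) :
  (forall x, 0 <= f x)%E -> (forall x, 0 <= g x)%E -> {ae m, forall x, f x = g x} ->
  (\int[m]_x f x = \int[m]_x g x)%E.
Proof.
suff H f' g' : (forall x, 0 <= f' x)%E -> (forall x, 0 <= g' x)%E -> {ae m, forall x, f' x = g' x} ->
    (\int[m]_x f' x <= \int[m]_x g' x)%E.
  move=> f0 g0 fg; apply/eqP; rewrite eq_le !H //.
  by apply: filterS fg => x ->.
move=> {}f0 {}g0 [N [mN N0 NS]]; rewrite !ge0_integralTE //.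
apply: ge_ereal_sup => _ [s /= sf <-].
have pE x : proj_nnsfun s (measurableC mN) x = s x * \1_(~` N) x by [].
apply: (@le_trans _ _ (sintegral m (proj_nnsfun s (measurableC mN)))).
  rewrite -!integralT_nnsfun le_eqVlt; apply/orP; left; apply/eqP.
  apply: ge0_ae_eq_integral => //.
  - exact/measurable_EFinP/measurable_funPT.
  - exact/measurable_EFinP/measurable_funPT.
  - by move=> x _; rewrite lee_fin.
  - by move=> x _; rewrite lee_fin.
  - exists N; split => // x; apply: contra_notP => Nx _.
    by rewrite pE indicE mem_set // mulr1.
apply: ereal_sup_ubound => /=; exists (proj_nnsfun s (measurableC mN)) => // x.
rewrite pE indicE; have [xN|xN] := boolP (x \in ~` N).
  rewrite mulr1; apply: le_trans (sf x) _; suff -> : f' x = g' x by [].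
  by apply: contrapT => ne; move: xN; rewrite inE; apply; exact: NS.
by rewrite mulr0.
Qed.

Lemma ae_eq_integral_nonmeasurable d (T : measurableType d) (K : realType)
  (m : {measure set T -> \bar K}) (f g : T -> \bar K) :
  {ae m, forall x, f x = g x} -> (\int[m]_x f x = \int[m]_x g x)%E.
Proof.
move=> fg; rewrite integralE [RHS]integralE; congr (_ - _)%E.
  apply: ge0_ae_eq_integral_nonmeasurable => //.
  by apply: filterS fg => x E; rewrite !funeposE E.
apply: ge0_ae_eq_integral_nonmeasurable => //.
by apply: filterS fg => x E; rewrite !funenegE E.
Qed.

Lemma der_locally_cst (h : R -> R) x (c : R) : (\forall y \near x, h y = c) -> der h x = 0.
Proof.
move=> H; rewrite /der derive1E.
rewrite (@near_eq_derive R R^o R^o h (fun=> c) x 1 H); exact: (@derive_cst R R^o R^o c x 1).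
Qed.

Lemma ae_exists_itv (P : mR -> Prop) (a b : R) : a < b -> {ae leb, forall x, P x} ->
  exists x, a < x < b /\ P x.
Proof.
move=> ab [N [mN N0 NS]]; apply: contrapT => H.
suff : (leb `]a, b[%classic <= leb N)%E.
  rewrite [X in (_ <= X)%E]N0 [X in (X <= _)%E](@lebesgue_measure_itv R `]a, b[) /= lte_fin ab.
  by rewrite -EFinB lee_fin; lra.
apply: le_measure; rewrite ?inE //.
move=> x; rewrite /= in_itv /= => xab; apply: NS => /= Px; apply: H; by exists x.
Qed.

Lemma TVR_ge0 g : (0 <= TVR g)%E.
Proof. by apply: ereal_sup_ubound; exists (0, 0) => //=; rewrite total_variationxx. Qed.

Lemma Vess_ge0 f : (0 <= Vess f)%E.
Proof. by apply: le_ereal_inf_tmp => _ [g _ <-]; exact: TVR_ge0. Qed.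

(** The infimum in [Vess] is only approached, whence [e]. [g] is a nearly optimal representative
    frozen outside [[y0, y1]], where [y0 < 0] and [y1 > 1] are points at which it agrees with the
    derivative and so vanishes; [w] is its variation function. *)
Lemma bv_derivative (h : R -> R) (e : R) :
  (forall x, x <= 0 -> h x = 0) -> (forall x, 1 <= x -> h x = h 1) ->
  (Vess (der h) < +oo)%E -> 0 < e ->
  exists g w : R -> R, exists V : R,
  [/\ V <= fine (Vess (der h)) + e,
      forall x y, x <= y -> `|g y - g x| <= w y - w x,
      forall x y, w y - w x <= V,
      (exists2 y, y < 0 & g y = 0) /\ (exists2 y, 1 < y & g y = 0) &
      {ae leb, forall x, der h x = g x}].
Proof.
move=> h0 h1 Vfin e0.
have Vf : Vess (der h) \is a fin_num by rewrite ge0_fin_numE // Vess_ge0.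
have [_ [g0 /= ae0 <-] tv0] := lb_ereal_inf_adherent e0 Vf.
have {}tv0 : (TVR g0 < Vess (der h) + e%:E)%E := tv0.
have d0 x : x < 0 -> der h x = 0.
  move=> x0; apply: (@der_locally_cst _ _ 0); near=> y; apply: h0.
  by apply/ltW; near: y; exact: lt_nbhsl.
have d1 x : 1 < x -> der h x = 0.
  move=> x1; apply: (@der_locally_cst _ _ (h 1)); near=> y; apply: h1.
  by apply/ltW; near: y; exact: lt_nbhsr.
have [y0 [/andP[_ y00] gy0]] := @ae_exists_itv _ (-1) 0 ltac:(lra) ae0.
have [y1 [/andP[y11 _] gy1]] := @ae_exists_itv _ 1 2 ltac:(lra) ae0.
rewrite d0 // in gy0; rewrite d1 // in gy1.
pose clip (x : R) := Num.max y0 (Num.min x y1).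
have clip_le x y : x <= y -> clip x <= clip y.
  by move=> xy; rewrite /clip ge_max !le_max lexx /= le_min !ge_min xy lexx /= !orbT.
have cb x : y0 <= clip x <= y1.
  by rewrite /clip le_max lexx /= ge_max ge_min lexx orbT andbT; lra.
have tvT : (total_variation y0 y1 g0 <= TVR g0)%E by apply: ereal_sup_ubound; exists (y0, y1).
have tvfin x y : y0 <= x -> x <= y -> y <= y1 -> total_variation x y g0 \is a fin_num.
  move=> H1 H2 H3; rewrite ge0_fin_numE ?total_variation_ge0 //.
  apply: (@le_lt_trans _ _ (total_variation y0 y1 g0)).
    rewrite (@total_variationD _ y0 y1 x) ?(@total_variationD _ x y1 y) //; last exact: le_trans H3.
    rewrite addeCA leeDl // adde_ge0 ?total_variation_ge0 //.
  by apply: le_lt_trans tvT _; apply: lt_trans tv0 _; rewrite -(fineK Vf) -EFinD ltry.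
pose w x := fine (total_variation y0 (clip x) g0).
have wB x y : x <= y -> w y - w x = fine (total_variation (clip x) (clip y) g0).
  move=> xy; have /andP[a1 a2] := cb x; have /andP[b1 b2] := cb y; have c := clip_le _ _ xy.
  rewrite /w (@total_variationD _ y0 (clip y) (clip x)) // fineD ?tvfin //; ring.
exists (g0 \o clip), w, (fine (total_variation y0 y1 g0)); split.
- rewrite -lee_fin EFinD !fineK //; last by apply: tvfin; lra.
  by apply: le_trans tvT _; exact: ltW.
- move=> x y xy; have /andP[a1 a2] := cb x; have /andP[b1 b2] := cb y; have c := clip_le _ _ xy.
  by rewrite wB // -lee_fin fineK ?tvfin //; exact: total_variation_ge.
- move=> x y; have /andP[a1 a2] := cb x; have /andP[b1 b2] := cb y.
  have wx : 0 <= w x by rewrite fine_ge0 // total_variation_ge0.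
  suff : w y <= fine (total_variation y0 y1 g0) by lra.
  rewrite /w (@total_variationD _ y0 y1 (clip y)) // fineD ?tvfin // lerDl.
  by rewrite fine_ge0 // total_variation_ge0.
- split; [exists y0 => //= | exists y1 => //=].
    by rewrite /clip min_l ?maxxx //; lra.
  by rewrite /clip minxx max_r //; lra.
- apply: (@filterS _ _ (ae_filter_ringOfSetsType leb) _ _ _ ae0) => x gx /=; rewrite /clip.
  have [x1|x1] := leP x y1; last by rewrite max_r -?gy1 ?d1 //; lra.
  have [x0|x0] := leP y0 x; first exact: gx.
  by rewrite -gy0 d0 //; lra.
Unshelve. all: by end_near. Qed.

Lemma der_eq0 (h : R -> R) x : (forall x, x <= 0 -> h x = 0) -> (forall x, 1 <= x -> h x = h 1) ->
  (x < 0) || (1 < x) -> der h x = 0.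
Proof.
move=> h0 h1 /orP[x0|x1].
  apply: (@der_locally_cst _ _ 0); near=> y; apply: h0.
  by apply/ltW; near: y; exact: lt_nbhsl.
apply: (@der_locally_cst _ _ (h 1)); near=> y; apply: h1.
by apply/ltW; near: y; exact: lt_nbhsr.
Unshelve. all: by end_near. Qed.

Lemma Rintegral_near_cst (f : mR -> R) (a b c v : R) : a <= b ->
  leb.-integrable `]a, b]%classic (EFin \o f) ->
  (forall x, a < x <= b -> `|f x - c| <= v) ->
  `| \int[leb]_(x in `]a, b]%classic) f x - c * (b - a) | <= v * (b - a).
Proof.
move=> ab fi H; have mI : measurable (`]a, b]%classic : set mR) by exact: measurable_itv.
have lI : leb `]a, b]%classic = (b - a)%:E.
  rewrite [LHS](@lebesgue_measure_itv R `]a, b]) /= lte_fin.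
  by case: ltP => // ba; rewrite (@le_anti _ _ a b) ?ab // subrr.
have ci (k : R) : leb.-integrable `]a, b]%classic (EFin \o cst k).
  apply: measurable_bounded_integrable => //; first by rewrite [X in (X < _)%E]lI ltry.
  exact: bounded_cst.
have C (k : R) : \int[leb]_(x in `]a, b]%classic) k = k * (b - a) by rewrite Rintegral_cst // [X in fine X]lI.
rewrite -(C c) -(C v) -RintegralB //; last exact: ci.
apply: le_trans (le_normr_Rintegral _ _) _ => //; first exact: (integrableB mI fi (ci c)).
apply: le_Rintegral => //; [exact: (integrable_norm (integrableB mI fi (ci c))) | exact: ci].
Qed.

(** [w] majorises the increments of [g], so sums of increments along increasing points telescope to
    at most [V]. The zeros of [g] on both sides of [[0, 1]] bring the jumps at 0 and 1 into this
    count. *)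
Definition bv_data (h g w : R -> R) (V : R) : Prop :=
  [/\ forall x y, x <= y -> `|g y - g x| <= w y - w x,
      forall x y, w y - w x <= V,
      (exists2 y, y < 0 & g y = 0) /\ (exists2 y, 1 < y & g y = 0) &
      {ae leb, forall x, der h x = g x}].

Lemma bv_data_bounded h g w V x : bv_data h g w V -> `|g x| <= V.
Proof.
move=> [gw wV [[y _ gy] _] _].
have [xy|/ltW yx] := leP x y.
  by have := le_trans (gw _ _ xy) (wV _ _); rewrite gy sub0r normrN.
by have := le_trans (gw _ _ yx) (wV _ _); rewrite gy subr0.
Qed.

(** [g] is [w] minus [w - g], and both of these are nondecreasing. *)
Lemma bv_data_measurable h g w V : bv_data h g w V -> measurable_fun setT (g : mR -> Real.sort R).
Proof.
move=> [gw _ _ _].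
have -> : g = (fun x => w x - (w x - g x)) by apply/funext => x; ring.
apply: measurable_funB; apply: nondecreasing_measurable => // x y xy; have := gw _ _ xy.
  by have := normr_ge0 (g y - g x); lra.
by rewrite ler_norml; lra.
Qed.

Lemma bounded_measurable_integrable_itv (f : mR -> Real.sort R) (B : R) (i : interval R) :
  measurable_fun setT f -> (forall x, `|f x| <= B) -> (leb [set` i] < +oo)%E ->
  leb.-integrable [set` i] (EFin \o f).
Proof.
move=> mf fB li; apply: measurable_bounded_integrable => //.
- exact: measurable_funS mf.
- exists B; split; rewrite ?num_real // => x Bx y _ /=; exact: le_trans (fB y) (ltW Bx).
Qed.

Lemma bv_data_approx h g w V : abs_cont h -> (forall x, x <= 0 -> h x = 0) ->
  (forall x, 1 <= x -> h x = h 1) -> bv_data h g w V ->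
  forall a b, 0 <= a -> a <= b -> b <= 1 -> `|h b - h a - g a * (b - a)| <= (w b - w a) * (b - a).
Proof.
move=> ac h0 h1 D a b a0 ab b1; have [f [fi fE fd]] := abs_cont_derivative ac h0 h1.
have lI : (leb `]a, b]%classic < +oo)%E.
  by rewrite [X in (X < _)%E](@lebesgue_measure_itv R `]a, b]) /=; case: ifP; rewrite ?ltry.
have gi := bounded_measurable_integrable_itv (bv_data_measurable D) (fun x => bv_data_bounded x D) lI.
have [gw wV _ dg] := D.
rewrite -fE //.
have -> : \int[leb]_(x in `]a, b]%classic) f x = \int[leb]_(x in `]a, b]%classic) g x.
  congr fine; apply: ae_eq_integral.
  - exact: measurable_itv.
  - by have /measurable_int := fi; apply: measurable_funS.
  - exact: measurable_int gi.
  have [A [mA A0 sA]] := fd; have [B [mB B0 sB]] := dg.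
  (* [der h = f] is available on the open interval only, while [b] may be 1. *)
  exists (A `|` B `|` [set 1]); split.
  - by apply: measurableU; [exact: measurableU | exact: measurable_set1].
  - apply/eqP; rewrite eq_le measure_ge0 andbT; apply: le_trans (measureU2 _ _ _) _; rewrite ?measurable_set1 //.
      exact: measurableU.
    rewrite [X in (_ + X <= _)%E]lebesgue_measure_set1 adde0; apply: le_trans (measureU2 _ _ _) _ => //.
    by rewrite [X in (X + _ <= _)%E]A0 [X in (_ + X <= _)%E]B0 adde0.
  move=> x; apply: contra_notP => /not_orP[/not_orP[xA xB] x1] /=; rewrite in_itv /= => /andP[ax xb].
  have E1 : 0 < x < 1 -> der h x = f x by apply: contrapT => /sA.
  have E2 : der h x = g x by apply: contrapT => /sB.
  rewrite -E2 E1 //; apply/andP; split; first exact: le_lt_trans ax.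
  by rewrite lt_neqAle (le_trans xb) // andbT; apply/eqP.
apply: Rintegral_near_cst => // x /andP[ax xb].
by apply: le_trans (gw _ _ (ltW ax)) _; have := le_trans (normr_ge0 _) (gw _ _ xb); lra.
Qed.

Lemma bv_data_product h1 g1 w1 V1 h2 g2 w2 V2 :
  (forall x, x <= 0 -> h1 x = 0) -> (forall x, 1 <= x -> h1 x = h1 1) ->
  bv_data h1 g1 w1 V1 -> bv_data h2 g2 w2 V2 ->
  exists K : R -> R,
    K 1 - K 0 = \int[leb]_x (der h1 x * der h2 x) /\
    forall a b, 0 <= a -> a <= b -> b <= 1 ->
      `|K b - K a - g1 a * g2 a * (b - a)| <= (V1 * (w2 b - w2 a) + V2 * (w1 b - w1 a)) * (b - a).
Proof.
move=> h10 h11 D1 D2.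
pose p (x : mR) : Real.sort R := g1 x * g2 x.
have mp : measurable_fun setT p.
  by apply: measurable_funM; [exact: bv_data_measurable D1 | exact: bv_data_measurable D2].
have pB x : `|p x| <= V1 * V2.
  by rewrite normrM; apply: ler_pM => //; [exact: bv_data_bounded D1 | exact: bv_data_bounded D2].
have pI (s t : bool) (a b : R) : leb.-integrable [set` Interval (BSide s a) (BSide t b)] (EFin \o p).
  apply: bounded_measurable_integrable_itv mp pB _.
  by rewrite [X in (X < _)%E]lebesgue_measure_itv /=; case: ifP; rewrite ?ltry.
exists (fun x => \int[leb]_(t in `]0, x]%classic) p t); split.
  rewrite [X in _ - X](_ : _ = 0) ?subr0; last first.
    by rewrite (_ : `]0, 0]%classic = set0) ?Rintegral_set0 // set_itvE.
  rewrite Rintegral_itv_obnd_cbnd // Rintegral_mkcond /Rintegral; congr fine.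
  (* Nothing is known about measurability of [der h1 * der h2]. It is replaced off a null set by
     [g1 * g2] cut off to [[0, 1]], since [der h1] vanishes outside. *)
  apply: ae_eq_integral_nonmeasurable.
  have [_ _ _ [A [mA A0 sA]]] := D1; have [_ _ _ [B [mB B0 sB]]] := D2.
  exists (A `|` B); split; first exact: measurableU.
    apply/eqP; rewrite eq_le measure_ge0 andbT; apply: le_trans (measureU2 _ _ _) _ => //.
    by rewrite [X in (X + _ <= _)%E]A0 [X in (_ + X <= _)%E]B0 adde0.
  move=> x; apply: contra_notP => /not_orP[xA xB]; congr EFin.
  have E1 : der h1 x = g1 x by apply: contrapT => /sA.
  have E2 : der h2 x = g2 x by apply: contrapT => /sB.
  rewrite patchE; case: ifPn; first by rewrite E1 E2.
  rewrite mem_setE in_itv /= negb_and -!ltNge => x01.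
  by rewrite (der_eq0 h10 h11 x01) mul0r.
move=> a b a0 ab b1; rewrite Rintegral_itvB; first last.
- by rewrite bnd_simp.
- by rewrite bnd_simp.
- exact: pI.
have [gw1 wV1 _ _] := D1; have [gw2 wV2 _ _] := D2.
apply: Rintegral_near_cst => // x /andP[ax xb].
have -> : p x - g1 a * g2 a = g1 x * (g2 x - g2 a) + g2 a * (g1 x - g1 a) by rewrite /p; ring.
apply: le_trans (ler_normD _ _) _; rewrite !normrM; apply: lerD; apply: ler_pM => //.
- exact: bv_data_bounded D1.
- by apply: le_trans (gw2 _ _ (ltW ax)) _; have := le_trans (normr_ge0 _) (gw2 _ _ xb); lra.
- exact: bv_data_bounded D2.
- by apply: le_trans (gw1 _ _ (ltW ax)) _; have := le_trans (normr_ge0 _) (gw1 _ _ xb); lra.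
Qed.

(** * Step functions and Riemann sums *)

Lemma le_of_le_add_inv (a b E : R) : (forall n, (0 < n)%N -> a <= b + E / n%:R) -> a <= b.
Proof.
move=> H; apply/ler_addgt0Pr => e e0; set n := (Num.truncn (`|E| / e)).+1.
have n0 : 0 < n%:R :> R by rewrite ltr0n.
apply: le_trans (H n isT) _; rewrite lerD2l ler_pdivrMr // mulrC -ler_pdivrMr //.
apply: le_trans (ltW (truncnS_gt _)); rewrite ler_wpM2r ?ler_norm // invr_ge0; exact: ltW.
Qed.

Lemma abel_sum (c u : nat -> R) n : c 0%N = 0 -> c n.+1 = 0 ->
  \sum_(j < n.+1) (c j.+1 - c j) * u j = \sum_(j < n) c j.+1 * (u j - u j.+1).
Proof.
move=> c0 cn; under eq_bigr do rewrite mulrBl.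
under [RHS]eq_bigr do rewrite mulrBr.
by rewrite !sumrB big_ord_recr /= cn mul0r addr0 [X in _ - X = _]big_ord_recl /= c0 mul0r add0r.
Qed.

Definition node n j : R := j%:R / n%:R.

Lemma node_le n i j : (i <= j)%N -> node n i <= node n j.
Proof. by move=> ij; rewrite ler_wpM2r ?invr_ge0 ?ler0n // ler_nat. Qed.

Lemma node_itv n j : (j <= n)%N -> 0 <= node n j <= 1.
Proof.
move=> jn; rewrite divr_ge0 ?ler0n //=; have [n0|n0] := posnP n; first by rewrite /node n0 invr0 mulr0.
by rewrite ler_pdivrMr ?ltr0n // mul1r ler_nat.
Qed.

Lemma nodeS n j : node n j.+1 - node n j = n%:R^-1.
Proof. by rewrite /node -mulrBl -natr1 addrAC subrr add0r mul1r. Qed.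

Lemma nodenn n : (0 < n)%N -> node n n = 1.
Proof. by move=> n0; rewrite /node divff // pnatr_eq0 -lt0n. Qed.

Lemma node0 n : node n 0 = 0.
Proof. by rewrite /node mul0r. Qed.

(** The integral from 0 to [x] of the step function with value [g(j / n)] on the cell after [j / n].
    Through the minima it is 0 for [x <= 0] and constant for [x >= 1], like [h]. *)
Definition step_int (g : R -> R) n (x : R) : R :=
  \sum_(j < n) g (node n j) * (Num.min x (node n j.+1) - Num.min x (node n j)).

(** The same minima cut [h x] into increments. On each cell the two increments differ by at most the
    increment of [w] times [1 / n], and these telescope. *)
Lemma step_int_approx h g w V n x : abs_cont h -> (forall x, x <= 0 -> h x = 0) ->
  (forall x, 1 <= x -> h x = h 1) -> bv_data h g w V -> (0 < n)%N ->
  `|h x - step_int g n x| <= V / n%:R.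
Proof.
move=> ac h0 h1 D n0; have A := bv_data_approx ac h0 h1 D; have [gw wV _ _] := D.
have wm a b : a <= b -> w a <= w b by move=> ab; have := le_trans (normr_ge0 _) (gw _ _ ab); lra.
have n0R : 0 < n%:R^-1 :> R by rewrite invr_gt0 ltr0n.
pose f j := h (Num.min x (node n j)).
have -> : h x = \sum_(0 <= j < n) (f j.+1 - f j).
  rewrite telescope_sumr // /f node0 nodenn // (h0 (Num.min x 0)) ?subr0; last by rewrite ge_min lexx orbT.
  by case: leP => // x1; rewrite h1 // ltW.
rewrite big_mkord /step_int -sumrB; apply: le_trans (ler_norm_sum _ _ _) _.
apply: (@le_trans _ _ (\sum_(0 <= j < n) (w (node n j.+1) - w (node n j)) / n%:R)); last first.
  by rewrite -big_distrl /= telescope_sumr // ler_wpM2r // ltW.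
rewrite big_mkord; apply: ler_sum => j _.
have /andP[j0 j1] := node_itv (ltn_ord j); have S := nodeS n j.
have /andP[i0 _] := node_itv (ltnW (ltn_ord j)).
have jj : node n j <= node n j.+1 by exact: node_le.
rewrite /f; have [xj|xj] := leP x (node n j).
  rewrite (min_l (le_trans xj jj)) !subrr mulr0 subr0 normr0 mulr_ge0 ?subr_ge0 ?wm //; exact: ltW.
set b := Num.min x (node n j.+1).
have bj : node n j <= b by rewrite le_min (ltW xj).
have bj1 : b <= node n j.+1 by rewrite ge_min lexx orbT.
apply: le_trans (A _ _ i0 bj (le_trans bj1 j1)) _.
by apply: ler_pM; rewrite ?subr_ge0 ?wm //; [have := wm _ _ bj1; lra | lra].
Qed.

Lemma step_int_product h1 g1 w1 V1 h2 g2 w2 V2 n :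
  (forall x, x <= 0 -> h1 x = 0) -> (forall x, 1 <= x -> h1 x = h1 1) ->
  bv_data h1 g1 w1 V1 -> bv_data h2 g2 w2 V2 -> (0 < n)%N ->
  `|\int[leb]_x (der h1 x * der h2 x) - (\sum_(j < n) g1 (node n j) * g2 (node n j)) / n%:R|
    <= 2 * (V1 * V2) / n%:R.
Proof.
move=> h10 h11 D1 D2 n0; have [K [<- A]] := bv_data_product h10 h11 D1 D2.
have [gw1 wV1 _ _] := D1; have [gw2 wV2 _ _] := D2.
have n0R : 0 < n%:R^-1 :> R by rewrite invr_gt0 ltr0n.
have V10 : 0 <= V1 by have := wV1 0 0; rewrite subrr.
have V20 : 0 <= V2 by have := wV2 0 0; rewrite subrr.
have -> : K 1 - K 0 = \sum_(0 <= j < n) (K (node n j.+1) - K (node n j)).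
  by rewrite (telescope_sumr (fun j => K (node n j))) // node0 nodenn.
rewrite big_mkord big_distrl /= -sumrB; apply: le_trans (ler_norm_sum _ _ _) _.
apply: (@le_trans _ _ (\sum_(0 <= j < n) (V1 * (w2 (node n j.+1) - w2 (node n j)) + V2 * (w1 (node n j.+1) - w1 (node n j))) / n%:R)); last first.
  rewrite -big_distrl /= ler_wpM2r ?(ltW n0R) // big_split /= -!big_distrr /=.
  rewrite (telescope_sumr (fun j => w2 (node n j))) // (telescope_sumr (fun j => w1 (node n j))) //.
  rewrite (_ : 2 * (V1 * V2) = V1 * V2 + V2 * V1); last by ring.
  by apply: lerD; apply: ler_wpM2l.
rewrite big_mkord; apply: ler_sum => j _.
have /andP[_ j1] := node_itv (ltn_ord j); have /andP[i0 _] := node_itv (ltnW (ltn_ord j)).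
by have := A _ _ i0 (node_le n (leqnSn j)) j1; rewrite nodeS.
Qed.

(** * The bilinear sum for step functions and its limit *)

Definition bilin M (r1 r2 : nat -> R) : R :=
  \sum_(1 <= d1 < M) \sum_(1 <= d2 < M) mobius d1 * mobius d2 / (lcmn d1 d2)%:R * r1 d1 * r2 d2.

(** [E] is independent of [n], [s1] and [s2]. It may depend on [M] at will, since [M] is fixed while
    [n] tends to infinity. *)
Lemma bilin_approx M (r1 r2 : nat -> R) (V1 V2 : R) : exists E : R, forall (s1 s2 : nat -> R) n, (0 < n)%N ->
  (forall d, `|r1 d - s1 d| <= V1 / n%:R) -> (forall d, `|r2 d - s2 d| <= V2 / n%:R) ->
  `|bilin M r1 r2 - bilin M s1 s2| <= E / n%:R.
Proof.
pose co d1 d2 := `|mobius d1 * mobius d2 / (lcmn d1 d2)%:R : R|.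
exists (\sum_(1 <= d1 < M) \sum_(1 <= d2 < M) co d1 d2 * (V1 * `|r2 d2| + (`|r1 d1| + V1) * V2)).
move=> s1 s2 n n0 H1 H2.
rewrite /bilin -sumrB; apply: le_trans (ler_norm_sum _ _ _) _; rewrite big_distrl /=.
apply: ler_sum => d1 _; rewrite -sumrB; apply: le_trans (ler_norm_sum _ _ _) _; rewrite big_distrl /=.
apply: ler_sum => d2 _; rewrite /co -[leRHS]mulrA; set q := mobius d1 * mobius d2 / _.
have -> : q * r1 d1 * r2 d2 - q * s1 d1 * s2 d2 = q * (r1 d1 * r2 d2 - s1 d1 * s2 d2) by ring.
rewrite normrM; apply: ler_wpM2l => //.
have n0R : 0 < n%:R^-1 :> R by rewrite invr_gt0 ltr0n.
have n1R : n%:R^-1 <= 1 :> R by rewrite invf_le1 ?ltr0n // ler1n.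
have V10 : 0 <= V1 by have := le_trans (normr_ge0 _) (H1 0%N); rewrite pmulr_lge0.
have -> : r1 d1 * r2 d2 - s1 d1 * s2 d2 = (r1 d1 - s1 d1) * r2 d2 + s1 d1 * (r2 d2 - s2 d2) by ring.
apply: le_trans (ler_normD _ _) _; rewrite !normrM [leRHS]mulrDl; apply: lerD.
  by rewrite mulrAC; apply: ler_wpM2r.
rewrite -mulrA; apply: ler_pM => //.
have -> : s1 d1 = r1 d1 - (r1 d1 - s1 d1) by ring.
apply: le_trans (ler_normB _ _) _; rewrite lerD2l; apply: le_trans (H1 d1) _.
by rewrite ler_piMr.
Qed.

(** The values of the step function, shifted by one and padded with zeros: the differences are its
    jumps at the nodes [0, ..., n], both ends included, and [abel_sum] has no boundary terms. *)
Definition coefs (g : R -> R) n (j : nat) : R := if (0 < j <= n)%N then g (node n j.-1) else 0.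

Lemma sum_norm_coefs h g w V n : bv_data h g w V -> (0 < n)%N ->
  \sum_(j < n.+1) `|coefs g n j.+1 - coefs g n j| <= V.
Proof.
move=> [gw wV [[y0 y00 gy0] [y1 y11 gy1]] _] n0.
(* The padding zeros are values of [g] at [y0 < 0] and [y1 > 1], so all jumps are increments of [g]
   along one increasing sequence. *)
pose z j : R := if j is i.+1 then (if (i < n)%N then node n i else y1) else y0.
have cz j : coefs g n j = g (z j).
  by rewrite /coefs; case: j => [|j] //=; case: ifP.
have zm j : z j <= z j.+1.
  case: j => [|j] /=; first by rewrite n0 node0 ltW.
  case: (ltnP j n) => jn; case: (ltnP j.+1 n) => jn1 //; [exact: node_le | | lia].
  by have /andP[_ H] := node_itv (ltnW jn); apply: le_trans H (ltW _).
apply: (@le_trans _ _ (\sum_(0 <= j < n.+1) (w (z j.+1) - w (z j)))); last first.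
  by rewrite (telescope_sumr (fun j => w (z j))).
by rewrite big_mkord; apply: ler_sum => j _; rewrite !cz; exact: gw.
Qed.

(** Since [x - min(x, s) = max(0, x - s)], summation by parts makes [step_int] a combination of
    ramps with the jumps as coefficients. At [x = (a - ln d) / L] these ramps are the weights of
    [logsum]. *)
Lemma step_intE g n (a L : R) d : 0 < L -> step_int g n ((a - ln d%:R) / L) =
  L^-1 * \sum_(j < n.+1) (coefs g n j.+1 - coefs g n j) * Num.max 0 (a - L * node n j - ln d%:R).
Proof.
move=> L0; rewrite (@abel_sum (coefs g n) (fun j => Num.max 0 (a - L * node n j - ln d%:R))); last 2 first.
- by [].
- by rewrite /coefs ltnn.
rewrite big_distrr /=; apply: eq_bigr => j _; rewrite /coefs ltn_ord /= mulrCA; congr (_ * _).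
have H s : Num.min ((a - ln d%:R) / L) s = (a - ln d%:R) / L - L^-1 * Num.max 0 (a - L * s - ln d%:R).
  have E : a - L * s - ln d%:R = L * ((a - ln d%:R) / L - s).
    by rewrite mulrBr mulrCA divff ?gt_eqF // mulr1; ring.
  have E2 u : Num.max 0 (L * u) = L * Num.max 0 u by rewrite maxr_pMr ?mulr0 // ltW.
  rewrite E E2 mulrA mulVf ?gt_eqF // mul1r.
  by case: (leP ((a - ln d%:R) / L) s) => xs; [rewrite max_l | rewrite max_r]; lra.
rewrite !H; ring.
Qed.

(** Summation by parts in both variables: the mixed second difference of the minimum is [L / n] on
    the diagonal and 0 off it, so a double sum over jumps becomes a single sum over values. *)
Lemma sum_coefs_min g1 g2 n (a L : R) : 0 < L -> (0 < n)%N ->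
  \sum_(j < n.+1) \sum_(k < n.+1) (coefs g1 n j.+1 - coefs g1 n j) * (coefs g2 n k.+1 - coefs g2 n k) *
    Num.min (a - L * node n j) (a - L * node n k) =
  L * ((\sum_(j < n) g1 (node n j) * g2 (node n j)) / n%:R).
Proof.
move=> L0 n0.
have c0 g : coefs g n 0 = 0 by [].
have cn g : coefs g n n.+1 = 0 by rewrite /coefs ltnn.
pose G k := \sum_(j < n | (k <= j)%N) g1 (node n j) * (L / n%:R).
have in1 k : \sum_(j < n.+1) (coefs g1 n j.+1 - coefs g1 n j) * Num.min (a - L * node n j) (a - L * node n k) = G k.
  rewrite (@abel_sum (coefs g1 n) (fun j => Num.min (a - L * node n j) (a - L * node n k))) // /G [RHS]big_mkcond /=.
  apply: eq_bigr => j _; rewrite /coefs ltn_ord /=.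
  have mono i i' : (i <= i')%N -> a - L * node n i' <= a - L * node n i.
    by move=> ii; rewrite lerD2l lerN2 ler_wpM2l ?(ltW L0) // node_le.
  case: leqP => kj.
    rewrite !min_l ?mono //; last exact: leqW.
    congr (_ * _); rewrite -(nodeS n j); ring.
  by rewrite !min_r ?mono // ?subrr ?mulr0 // ltnW.
rewrite exchange_big /=.
rewrite (eq_bigr (fun k : 'I_n.+1 => (coefs g2 n k.+1 - coefs g2 n k) * G k)); last first.
  by move=> k _; rewrite -in1 big_distrr /=; apply: eq_bigr => j _; ring.
rewrite (@abel_sum (coefs g2 n) G) // big_distrl big_distrr /=; apply: eq_bigr => k _.
rewrite /coefs ltn_ord /= /G (bigD1 k) //= (eq_bigl (fun j : 'I_n => (k.+1 <= j)%N)); last first.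
  by move=> j; rewrite ltn_neqAle andbC -val_eqE eq_sym.
rewrite addrK; ring.
Qed.

Lemma bilin_step K M n (a L : R) h1 g1 w1 V1 h2 g2 w2 V2 : 0 <= K ->
  (forall a b, 0 <= a <= ln M%:R -> 0 <= b <= ln M%:R -> `|logsum M a b - Num.min a b| <= K) ->
  0 < L -> L <= a -> a <= ln M%:R -> (0 < n)%N -> bv_data h1 g1 w1 V1 -> bv_data h2 g2 w2 V2 ->
  `|bilin M.+1 (fun d => step_int g1 n ((a - ln d%:R) / L)) (fun d => step_int g2 n ((a - ln d%:R) / L))
     - (\sum_(j < n) g1 (node n j) * g2 (node n j)) / n%:R / L| <= K * (V1 * V2) / L ^+ 2.
Proof.
move=> K0 HK L0 La aM n0 D1 D2; have L2 : 0 < L ^- 2 by rewrite invr_gt0 exprn_gt0.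
pose c1 j := coefs g1 n j.+1 - coefs g1 n j; pose c2 j := coefs g2 n j.+1 - coefs g2 n j.
pose al j := a - L * node n j.
(* [L <= a] keeps every [a - L * node n j] nonnegative, where the estimate for [logsum] is
   available; in the theorem this is [1 <= D1]. *)
have alr (j : 'I_n.+1) : 0 <= al j <= ln M%:R.
  have /andP[H1 H2] : 0 <= node n j <= 1 by apply: node_itv; rewrite -ltnS.
  rewrite /al; have := ler_wpM2l (ltW L0) H2; have := mulr_ge0 (ltW L0) H1; lra.
have -> : bilin M.+1 (fun d => step_int g1 n ((a - ln d%:R) / L)) (fun d => step_int g2 n ((a - ln d%:R) / L)) =
    L ^- 2 * \sum_(j < n.+1) \sum_(k < n.+1) c1 j * c2 k * logsum M (al j) (al k).
  rewrite /bilin /logsum.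
  transitivity (L ^- 2 * \sum_(1 <= d1 < M.+1) \sum_(1 <= d2 < M.+1) \sum_(j < n.+1) \sum_(k < n.+1)
      c1 j * c2 k * (mobius d1 * mobius d2 / (lcmn d1 d2)%:R * Num.max 0 (al j - ln d1%:R) * Num.max 0 (al k - ln d2%:R))).
    rewrite big_distrr /=; apply: eq_bigr => d1 _; rewrite big_distrr /=; apply: eq_bigr => d2 _.
    rewrite !step_intE // -/c1 -/c2.
    transitivity (L ^- 2 * (mobius d1 * mobius d2 / (lcmn d1 d2)%:R) *
       ((\sum_(j < n.+1) c1 j * Num.max 0 (al j - ln d1%:R)) * (\sum_(k < n.+1) c2 k * Num.max 0 (al k - ln d2%:R)))).
      by rewrite expr2 invfM /c1 /c2 /al; ring.
    rewrite -mulrA; congr (_ * _); rewrite big_distrl big_distrr /=; apply: eq_bigr => j _.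
    rewrite !big_distrr /=; apply: eq_bigr => k _; ring.
  congr (_ * _); under eq_bigr do rewrite exchange_big /=.
  rewrite exchange_big /=; apply: eq_bigr => j _.
  under eq_bigr do rewrite exchange_big /=.
  rewrite exchange_big /=; apply: eq_bigr => k _.
  by rewrite big_distrr /=; apply: eq_bigr => d1 _; rewrite big_distrr.
have -> : (\sum_(j < n) g1 (node n j) * g2 (node n j)) / n%:R / L =
    L ^- 2 * \sum_(j < n.+1) \sum_(k < n.+1) c1 j * c2 k * Num.min (al j) (al k).
  rewrite sum_coefs_min //; set X := (\sum_(j < n) _) / _; field; exact: lt0r_neq0.
rewrite -mulrBr normrM ger0_norm ?(ltW L2) // [leRHS]mulrC; apply: ler_wpM2l; first exact: ltW.
rewrite -sumrB; apply: le_trans (ler_norm_sum _ _ _) _.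
apply: (@le_trans _ _ (\sum_(j < n.+1) \sum_(k < n.+1) K * (`|c1 j| * `|c2 k|))).
  apply: ler_sum => j _; rewrite -sumrB; apply: le_trans (ler_norm_sum _ _ _) _.
  apply: ler_sum => k _; rewrite -mulrBr !normrM mulrC; apply: ler_wpM2r; first exact: mulr_ge0.
  by apply: HK.
under eq_bigr do rewrite -big_distrr -big_distrr /=.
rewrite -big_distrr -big_distrl /=; apply: ler_wpM2l => //.
apply: ler_pM; rewrite ?sumr_ge0 //; [exact: sum_norm_coefs D1 _ | exact: sum_norm_coefs D2 _].
Qed.

(** Passes from [d < M] to [d <= M], the range of [logsum]. The arguments [ln (D2 / d)] and
    [ln D2 - ln d] are identified for [d > 0] only. *)
Lemma bilin_extend M (r1 r2 s1 s2 : nat -> R) : (0 < M)%N ->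
  (forall d, (0 < d)%N -> r1 d = s1 d) -> (forall d, (0 < d)%N -> r2 d = s2 d) ->
  s1 M = 0 -> s2 M = 0 -> bilin M r1 r2 = bilin M.+1 s1 s2.
Proof.
move=> M0 E1 E2 s10 s20; rewrite /bilin big_nat_recr //= [X in _ = _ + X]big1 ?addr0; last first.
  by move=> d _; rewrite s10 mulr0 mul0r.
apply: eq_big_nat => d /andP[d0 _]; rewrite big_nat_recr //= s20 mulr0 addr0.
by apply: eq_big_nat => e /andP[e0 _]; rewrite E1 ?E2.
Qed.

Lemma bilin_bv_bound K M (a L : R) h1 g1 w1 V1 h2 g2 w2 V2 : 0 <= K ->
  (forall a b, 0 <= a <= ln M%:R -> 0 <= b <= ln M%:R -> `|logsum M a b - Num.min a b| <= K) ->
  0 < L -> L <= a -> a <= ln M%:R -> abs_cont h1 -> abs_cont h2 ->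
  (forall x, x <= 0 -> h1 x = 0) -> (forall x, 1 <= x -> h1 x = h1 1) ->
  (forall x, x <= 0 -> h2 x = 0) -> (forall x, 1 <= x -> h2 x = h2 1) ->
  bv_data h1 g1 w1 V1 -> bv_data h2 g2 w2 V2 ->
  `|bilin M.+1 (fun d => h1 ((a - ln d%:R) / L)) (fun d => h2 ((a - ln d%:R) / L))
     - \int[leb]_x (der h1 x * der h2 x) / L| <= K * (V1 * V2) / L ^+ 2.
Proof.
move=> K0 HK L0 La aM ac1 ac2 h10 h11 h20 h21 D1 D2.
have [E HE] := bilin_approx M.+1 (fun d => h1 ((a - ln d%:R) / L)) (fun d => h2 ((a - ln d%:R) / L)) V1 V2.
apply: (@le_of_le_add_inv _ _ (E + 2 * (V1 * V2) / L)) => n n0.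
have A1 := HE _ _ n n0 (fun d => step_int_approx _ ac1 h10 h11 D1 n0) (fun d => step_int_approx _ ac2 h20 h21 D2 n0).
have A2 := bilin_step K0 HK L0 La aM n0 D1 D2.
have A3 := step_int_product h10 h11 D1 D2 n0.
set S := bilin _ _ _ in A1 *; set Sn := bilin _ _ _ in A1 A2; set I0 := Rintegral _ _ _ in A3 *.
set Q := (\sum_(j < n) _) / _ in A2 A3.
have -> : S - I0 / L = (S - Sn) + (Sn - Q / L) + (- ((I0 - Q) / L)) by ring.
have Li : 0 < L^-1 by rewrite invr_gt0.
apply: le_trans (ler_normD _ _) _; rewrite normrN normrM (gtr0_norm Li).
apply: le_trans (lerD (ler_normD _ _) (ler_wpM2r (ltW Li) A3)) _.
have -> : (E + 2 * (V1 * V2) / L) / n%:R = E / n%:R + 2 * (V1 * V2) / n%:R / L by ring.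
lra.
Qed.

Theorem theorem2 :
  exists C : R, 0 < C /\
  forall (D1 D2 : R) (h1 h2 : R -> R),
    1 <= D1 -> D1 < D2 ->
    abs_cont h1 -> abs_cont h2 ->
    (forall x, x <= 0 -> h1 x = 0) -> (forall x, 1 <= x -> h1 x = h1 1) ->
    (forall x, x <= 0 -> h2 x = 0) -> (forall x, 1 <= x -> h2 x = h2 1) ->
    (Vess (der h1) < +oo)%E -> (Vess (der h2) < +oo)%E ->
    let L := ln (D2 / D1) in
    let rho1 := fun t : R => h1 (ln (D2 / t) / L) in
    let rho2 := fun t : R => h2 (ln (D2 / t) / L) in
    let N := (Num.truncn D2).+1 in
    `| \sum_(1 <= d1 < N) \sum_(1 <= d2 < N)
          mobius d1 * mobius d2 / (lcmn d1 d2)%:R * rho1 d1%:R * rho2 d2%:R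
       - Rintegral (@lebesgue_measure R) setT (fun x => (der h1) x * (der h2) x) / L |
    <= C * (fine (Vess (der h1)) * fine (Vess (der h2))) / L ^+ 2.
Proof.
have [K [K0 HK]] := logsum_bound.
(* [K] is only known to be nonnegative; adding 1 makes the constant positive. *)
exists (K + 1); split; first lra.
move=> D1 D2 h1 h2 D11 D12 ac1 ac2 h10 h11 h20 h21 Vf1 Vf2; cbv zeta.
set L := ln (D2 / D1); set N := (Num.truncn D2).+1.
pose rho1 (t : R) := h1 (ln (D2 / t) / L); pose rho2 (t : R) := h2 (ln (D2 / t) / L).
have D2p : 0 < D2 by lra.
have LE : L = ln D2 - ln D1 by rewrite /L ln_div ?posrE //; lra.
have L0 : 0 < L by rewrite LE subr_gt0 ltr_ln ?posrE //; lra.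
have La : L <= ln D2 by rewrite LE; have := ln_ge0 D11; lra.
have DN : D2 < N%:R by exact: truncnS_gt.
have N0 : 0 < N%:R :> R by rewrite ltr0n.
have aM : ln D2 <= ln N%:R by rewrite ler_ln ?posrE // ltW.
have argE d : (0 < d)%N -> ln (D2 / d%:R) = ln D2 - ln d%:R.
  by move=> d0; rewrite ln_div ?posrE ?ltr0n.
(* [N] exceeds [D2], so the arguments of [h1] and [h2] at [d = N] are at most 0 and the added terms
   vanish. *)
have argN : (ln D2 - ln N%:R) / L <= 0 by rewrite pmulr_lle0 ?invr_gt0 // subr_le0.
rewrite -/(bilin N (fun d => rho1 d%:R) (fun d => rho2 d%:R)).
rewrite (@bilin_extend N _ _ (fun d => h1 ((ln D2 - ln d%:R) / L)) (fun d => h2 ((ln D2 - ln d%:R) / L))) //; first last.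
- exact: h20.
- exact: h10.
- by move=> d d0; rewrite /rho2 argE.
- by move=> d d0; rewrite /rho1 argE.
set S := _ - _; set v1 := fine _; set v2 := fine _.
have v10 : 0 <= v1 by rewrite fine_ge0 // Vess_ge0.
have v20 : 0 <= v2 by rewrite fine_ge0 // Vess_ge0.
have L2 : 0 < (L ^+ 2)^-1 by rewrite invr_gt0 exprn_gt0.
apply: (@le_trans _ _ (K * (v1 * v2) / L ^+ 2)); last first.
  by apply: ler_wpM2r; [exact: ltW | apply: ler_wpM2r; [exact: mulr_ge0 | lra]].
(* The variation bounds of the representatives may exceed [Vess] by [1 / n]. For [e <= 1], [(v1 + e)
   (v2 + e) <= v1 v2 + (v1 + v2 + 1) e], and the excess disappears as [n] grows. *)
apply: (@le_of_le_add_inv _ _ (K * (v1 + v2 + 1) / L ^+ 2)) => n n0.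
have e0 : 0 < n%:R^-1 :> R by rewrite invr_gt0 ltr0n.
have e1 : n%:R^-1 <= 1 :> R by rewrite invf_le1 ?ltr0n // ler1n.
have [g1 [w1 [V1 [W1 b11 b12 b13 b14]]]] := bv_derivative h10 h11 Vf1 e0.
have [g2 [w2 [V2 [W2 b21 b22 b23 b24]]]] := bv_derivative h20 h21 Vf2 e0.
have B1 : bv_data h1 g1 w1 V1 by [].
have B2 : bv_data h2 g2 w2 V2 by [].
apply: le_trans (bilin_bv_bound K0 (HK N) L0 La aM ac1 ac2 h10 h11 h20 h21 B1 B2) _.
have V10 : 0 <= V1 by have := b12 0 0; rewrite subrr.
have V20 : 0 <= V2 by have := b22 0 0; rewrite subrr.
rewrite -/v1 in W1; rewrite -/v2 in W2; set e := n%:R^-1 in e0 e1 W1 W2 *.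
have -> : K * (v1 * v2) / L ^+ 2 + K * (v1 + v2 + 1) / L ^+ 2 * e =
  K * (v1 * v2 + (v1 + v2 + 1) * e) / L ^+ 2 by ring.
apply: ler_wpM2r; first exact: ltW.
apply: ler_wpM2l => //; apply: le_trans (ler_pM V10 V20 W1 W2) _.
have -> : (v1 + e) * (v2 + e) = v1 * v2 + (v1 + v2 + e) * e by ring.
by rewrite lerD2l; apply: ler_wpM2r; [exact: ltW | lra].
Qed.
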